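(* Let $m>5/2$, $v_0\in H^m(\mathbb{R}^3)$ with $\operatorname{div}v_0=0$, $T\in(0,\infty]$, and let $\omega=\operatorname{curl}v$ be the vorticity of the solution $v\in C([0,T);H^m(\mathbb{R}^3))$ of the Euler equations with initial data $v_0$; let $\omega_0=\operatorname{curl}v_0$. Then for all $\gamma\ge1$ and all $t\in[0,T)$ the upper estimate $$\|\omega(t)\|_{L^\infty}\le\frac{\|\omega_0\|_{L^\infty}\exp\left[\gamma\int_0^t\|\nabla v(\tau)\|_{L^\infty}d\tau\right]}{1+(\gamma-1)\|\omega_0\|_{L^\infty}\int_0^t\exp\left[\gamma\int_0^\tau\|\nabla v(\sigma)\|_{L^\infty}d\sigma\right]d\tau}$$ and the lower estimate $$\|\omega(t)\|_{L^\infty}\ge\frac{\|\omega_0\|_{L^\infty}\exp\left[-\gamma\int_0^t\|\nabla v(\tau)\|_{L^\infty}d\tau\right]}{1-(\gamma-1)\|\omega_0\|_{L^\infty}\int_0^t\exp\left[-\gamma\int_0^\tau\|\nabla v(\sigma)\|_{L^\infty}d\sigma\right]d\tau}$$ hold. Moreover, the denominator in the lower estimate satisfies $$1-(\gamma-1)\|\omega_0\|_{L^\infty}\int_0^t\exp\left[-\gamma\int_0^\tau\|\nabla v(\sigma)\|_{L^\infty}d\sigma\right]d\tau\ge\frac{1}{(1+\|\omega_0\|_{L^\infty}t)^{\gamma-1}}.$$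
   Context: The 3D incompressible Euler equations are $\partial_t v+(v\cdot\nabla)v=-\nabla p$, $\operatorname{div} v=0$ in $\mathbb{R}^3\times(0,T)$, $v(x,0)=v_0(x)$. Here $\|\omega\|_{L^\infty}=\sup_x|\omega(x)|$ with the Euclidean norm on vectors, and $\|\nabla v\|_{L^\infty}=\sup_x|\nabla v(x)|$, where the norm $|\cdot|$ on $3\times3$ matrices is normalized so that, pointwise, $|\xi\cdot(\nabla v)\xi|\le|\nabla v|$ for every unit vector $\xi$ and $|\operatorname{curl}v|\le|\nabla v|$ (for instance $|A|=\sum_{i,j}|A_{ij}|$). *)

(* Defs.v *)
From HB Require Import structures.
From mathcomp Require Import all_boot all_order all_algebra.
From mathcomp Require Import all_classical all_reals all_analysis.

Set Implicit Arguments.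
Unset Strict Implicit.
Unset Printing Implicit Defensive.

Import Order.TTheory GRing.Theory Num.Theory.
Import numFieldNormedType.Exports.
Local Open Scope classical_set_scope.
Local Open Scope ring_scope.

(* The library has Lebesgue measure on R and binary products of measures, so
   integration over the space uses triples, turned into vectors by vec3. *)
Notation R3 R := (measurableTypeR R * measurableTypeR R * measurableTypeR R)%type.
Notation leb3 R :=
  ((@lebesgue_measure R \x @lebesgue_measure R) \x @lebesgue_measure R)%E.

Section euclidean_space.
Variable R : realType.
Implicit Types u v : 'rV[R]_3.

(* The library norm on 'rV[R]_3 is the max norm; its topology is the usual one,
   but the Euclidean length has to be spelled out. *)
Definition edot u v : R := \sum_i u 0 i * v 0 i.
Definition enorm u : R := Num.sqrt (edot u u).

Definition vec3 (x : R3 R) : 'rV[R]_3 :=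
  \row_(i < 3) [:: x.1.1; x.1.2; x.2]`_i.

End euclidean_space.

Section sobolev.
Variable R : realType.
Implicit Types (f : 'rV[R]_3 -> R) (a b : R3 R -> R).

Definition square_integrable a : Prop :=
  measurable_fun [set: R3 R] a /\ ('N[leb3 R]_2%:E [EFin \o a] < +oo)%E.

(* Real and imaginary parts of the integral of
   (a k + i b k) exp (2 i pi x.k) over the ball |k| <= r. *)
Definition inv_fourier_re a b (r : R) (x : 'rV[R]_3) : R :=
  \int[leb3 R]_(k in [set k | enorm (vec3 k) <= r])
    (a k * cos (2 * pi * edot x (vec3 k)) - b k * sin (2 * pi * edot x (vec3 k))).
Definition inv_fourier_im a b (r : R) (x : 'rV[R]_3) : R :=
  \int[leb3 R]_(k in [set k | enorm (vec3 k) <= r])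
    (a k * sin (2 * pi * edot x (vec3 k)) + b k * cos (2 * pi * edot x (vec3 k))).

(* a + i b is the Fourier-Plancherel transform of the real function f, i.e. f is
   the L2 limit of the truncated inverse Fourier integrals of a + i b. *)
Definition is_fourier f a b : Prop :=
  [/\ square_integrable a, square_integrable b,
      ('N[leb3 R]_2%:E[(fun x => (f (vec3 x) - inv_fourier_re a b r (vec3 x))%:E)])%E
        @[r --> +oo] --> 0%E
    & ('N[leb3 R]_2%:E[(fun x => (inv_fourier_im a b r (vec3 x))%:E)])%E
        @[r --> +oo] --> 0%E].

(* The transform is unique up to a null set, so the infimum is over one value;
   it is +oo when f has no transform. *)
Definition sobolev_norm (s : R) f : \bar R :=
  ereal_inf [set c | exists a b, is_fourier f a b /\
    c = ('N[leb3 R]_2%:E[(fun k =>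
      ((1 + enorm (vec3 k) ^+ 2) `^ (s / 2) *
         Num.sqrt (a k ^+ 2 + b k ^+ 2))%:E)])%E].

Definition in_sobolev (s : R) f : Prop :=
  square_integrable (f \o @vec3 R) /\ (sobolev_norm s f < +oo)%E.

Definition in_sobolev3 (s : R) (u : 'rV[R]_3 -> 'rV[R]_3) : Prop :=
  forall i, in_sobolev s (fun x => u x 0 i).

End sobolev.

Section euler.
Variable R : realType.
Implicit Types (u : 'rV[R]_3 -> 'rV[R]_3) (v : R -> 'rV[R]_3 -> 'rV[R]_3).

(* ('J u x) i j is the i-th partial derivative of the j-th component of u, so the
   derivative of u at x in the direction w is w *m 'J u x. *)
Definition div u (x : 'rV[R]_3) : R := \tr ('J u x).

Definition curl_mx (A : 'M[R]_3) : 'rV[R]_3 :=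
  \row_(i < 3) (A (i + 1) (i + 2) - A (i + 2) (i + 1)).
Definition curl u (x : 'rV[R]_3) : 'rV[R]_3 := curl_mx ('J u x).

Definition grad (q : 'rV[R]_3 -> R) (x : 'rV[R]_3) : 'rV[R]_3 :=
  \row_i 'D_('e_i) q x.

Definition lifespan (T : \bar R) : set R := [set t | 0 <= t /\ (t%:E < T)%E].

Definition continuous_in_sobolev (s : R) (T : \bar R) v : Prop :=
  (forall t, lifespan T t -> in_sobolev3 s (v t)) /\
  (forall t, lifespan T t -> forall i,
     sobolev_norm s (fun x => v t' x 0 i - v t x 0 i)
       @[t' --> within (lifespan T) (nbhs t)] --> 0%E).

(* Elements of the Sobolev space are represented by continuous functions
   (available since s > 3/2).  For s > 5/2 solutions are classical: the pressure
   gradient is continuous in (t, x), and so are all terms of the equation. *)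
Definition euler_solution (s : R) (T : \bar R) (v0 : 'rV[R]_3 -> 'rV[R]_3) v : Prop :=
  [/\ continuous_in_sobolev s T v,
      (forall t, lifespan T t -> continuous (v t)),
      v 0 = v0
    & exists p : R -> 'rV[R]_3 -> R,
        forall t x, 0 < t -> (t%:E < T)%E ->
          [/\ derivable (v ^~ x) t 1,
              differentiable (v t) x,
              differentiable (p t) x,
              {for (t, x), continuous (fun z : R * 'rV[R]_3 => grad (p z.1) z.2)}
            & 'D_1 (v ^~ x) t + v t x *m 'J (v t) x = - grad (p t) x
              /\ div (v t) x = 0]].

Record admissible_norm (N : 'M[R]_3 -> R) : Prop := AdmissibleNorm {
  admissible_triangle : forall A B, N (A + B) <= N A + N B ;
  admissible_scale : forall c A, N (c *: A) = `|c| * N A ;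
  admissible_definite : forall A, N A = 0 -> A = 0 ;
  admissible_strain : forall A (xi : 'rV[R]_3), enorm xi = 1 ->
    `|edot xi (xi *m A)| <= N A ;
  admissible_curl : forall A, enorm (curl_mx A) <= N A
}.

(* The real sup of an unbounded set is 0; both functions below are bounded when u
   is a continuous field in the Sobolev space of order s > 5/2. *)
Definition vec_sup u : R := sup (range (fun x => enorm (u x))).
Definition grad_sup (N : 'M[R]_3 -> R) u : R := sup (range (fun x => N ('J u x))).

End euler.

(* Main.v *)
(* The vorticity omega along a particle path X satisfies omega' = omega . grad v, so
   y = |omega (X)| obeys |y'| <= g y and y <= g with g = |grad v|_oo.  Hence
   exp (gamma G) / y - (gamma - 1) I is nondecreasing and
   exp (- gamma G) / y + (gamma - 1) J is nonincreasing, where G is the primitive of g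
   and I, J those of exp (gamma G), exp (- gamma G).  Comparing the values at 0 and t and
   taking suprema over the end points of paths gives the two estimates.  For gamma = 1 the
   lower one reads g exp G >= |omega_0|_oo, so exp G >= 1 + |omega_0|_oo t, which bounds
   the denominator after integration.

   The pressure has no second derivatives here, so the vorticity equation cannot be
   obtained by differentiating the Euler equations.  Instead the velocity is integrated
   around a small square translated rigidly along X: the pressure gradient contributes
   nothing to the circulation, and dividing by the area of the square and letting it
   shrink yields the equation.  Continuity of grad v in space and time comes from the
   Sobolev embedding, proved on the Fourier side. *)
Require Import Defs.
From HB Require Import structures.
From mathcomp Require Import all_boot all_order all_algebra.
From mathcomp Require Import all_classical all_reals all_analysis.
From mathcomp Require Import measurable_realfun ring lra.

Set Implicit Arguments.
Unset Strict Implicit.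
Unset Printing Implicit Defensive.

Import Order.TTheory GRing.Theory Num.Theory.
Import numFieldNormedType.Exports.
Local Open Scope classical_set_scope.
Local Open Scope ring_scope.

(** * Sobolev embedding *)

(** The threshold $5/2$ is where $(1+|k|^2)^{1/2}|\hat v(k)|$ becomes integrable for every $v$ in
    the Sobolev space. The embedding is uniform in space, so a small Sobolev distance between two
    times controls the gradient everywhere, and $g$ is continuous in time with a genuine primitive.
    Time is frozen outside $[0,t]$, which turns the velocity into a bounded field on the whole line,
    Lipschitz in space, with paths through every point. The upper estimate follows a path backward
    from an arbitrary point at time $t$, the lower one forward from an arbitrary point at time $0$;
    uniqueness of paths never enters. The bounds $|y'|\le gy$ and $y\le g$ are the two pointwise
    properties of the matrix norm, and in the derivative of each monotone quantity $\gamma g$ is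
    spent as one $g$ on the former and $(\gamma-1)g$ on the latter. The length $y$ need not be
    differentiable where the vorticity vanishes, so the argument starts from $y^2$, and the
    inequalities along paths are stated multiplied out, which covers a vanishing initial value. *)

(* The sigma-finiteness of a product of sigma-finite measures is proved in the
   library, but the corresponding instance is shadowed by the one for
   subprobabilities. *)
Section sigma_finite_product.
Context d1 d2 (T1 : measurableType d1) (T2 : measurableType d2) (R : realType).
Variables (m1 : {sigma_finite_measure set T1 -> \bar R})
  (m2 : {sigma_finite_measure set T2 -> \bar R}).

Definition sigma_finite_prod : set (T1 * T2) -> \bar R := (m1 \x m2)%E.

HB.instance Definition _ := Measure.on sigma_finite_prod.

Let sigma_finite_prodT : sigma_finite setT sigma_finite_prod.
Proof.
have /sigma_finiteP[F [TF ndF Foo]] := sigma_finiteT m1.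
have /sigma_finiteP[G [TG ndG Goo]] := sigma_finiteT m2.
exists (fun n => F n `*` G n) => [|n].
  rewrite -setXTT TF TG; apply/seteqP; split => -[x y] /=.
    move=> [[n _ Fx] [k _ Gy]]; exists (maxn n k) => //; split.
      by move: Fx; apply/subsetPset/ndF/leq_maxl.
    by move: Gy; apply/subsetPset/ndG/leq_maxr.
  by move=> [n _ [Fx Gy]]; split; exists n.
have [mF Fn] := Foo n; have [mG Gn] := Goo n; split; first exact: measurableX.
by rewrite /sigma_finite_prod product_measure1E// lte_mul_pinfty// ge0_fin_numE.
Qed.

HB.instance Definition _ :=
  Measure_isSigmaFinite.Build _ _ _ sigma_finite_prod sigma_finite_prodT.

End sigma_finite_product.

Lemma integral_prod d1 d2 (T1 : measurableType d1) (T2 : measurableType d2)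
    (R : realType) (m1 : {sigma_finite_measure set T1 -> \bar R})
    (m2 : {sigma_finite_measure set T2 -> \bar R}) (f : T1 -> R) (g : T2 -> R) :
  measurable_fun setT f -> measurable_fun setT g ->
  (forall x, 0 <= f x) -> (forall y, 0 <= g y) ->
  (\int[m1 \x m2]_z (f z.1 * g z.2)%:E =
   \int[m1]_x (f x)%:E * \int[m2]_y (g y)%:E)%E.
Proof.
move=> mf mg f0 g0.
rewrite (@fubini_tonelli1 _ _ _ _ R m1 m2 (fun z => (f z.1 * g z.2)%:E)); last 2 first.
- apply/measurable_EFinP; apply: measurable_funM.
  + exact: (measurableT_comp mf measurable_fst).
  + exact: (measurableT_comp mg measurable_snd).
- by move=> z; rewrite lee_fin mulr_ge0.
rewrite -ge0_integralZr//; last 3 first.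
- by apply/measurable_EFinP.
- by move=> x _; rewrite lee_fin.
- by apply: integral_ge0 => y _; rewrite lee_fin.
apply: eq_integral => x _; rewrite /fubini_F /=.
under eq_integral do rewrite EFinM.
rewrite ge0_integralZl//.
- by apply/measurable_EFinP.
- by move=> y _; rewrite lee_fin.
- by rewrite lee_fin.
Qed.

(** * Integrability of the weights $(1+|k|^2)^{-s}$ *)

Section bessel.
Variable R : realType.

(** Follows from $(1+x)^2\le 2(1+x^2)$. It trades the weight for a power of $1+x$, which has an
    explicit primitive. *)
Lemma powR_sqr_le (q x : R) : 0 <= q -> 0 <= x ->
  (1 + x ^+ 2) `^ (- q) <= 2 `^ q * (1 + x) `^ (- (2 * q)).
Proof.
move=> q0 x0.
have h : (1 + x) ^+ 2 <= 2 * (1 + x ^+ 2) by have := sqr_ge0 (1 - x); nra.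
have h1 : 0 < 1 + x ^+ 2 by have := sqr_ge0 x; lra.
have -> : (1 + x) `^ (- (2 * q)) = (((1 + x) ^+ 2) `^ q)^-1.
  by rewrite -powR_mulrn ?addr_ge0// -powRrM powRN.
rewrite powRN ler_pdivlMr ?powR_gt0//; last by rewrite exprn_gt0//; lra.
rewrite mulrC ler_pdivrMr ?powR_gt0//.
rewrite -powRM; [|by []|lra].
by apply: ge0_ler_powR => //; rewrite nnegrE ?sqr_ge0//; lra.
Qed.

Lemma integral_powR_lty (s : R) : 1 < s ->
  (\int[lebesgue_measure]_(x in `[0%R, +oo[) ((1 + x) `^ (- s))%:E < +oo)%E.
Proof.
move=> s1.
have d1 : 1 - s != 0 by lra.
pose F (x : R) := (1 + x) `^ (1 - s) / (1 - s).
have h (a p : R) : 0 < 1 + a ->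
    is_derive a (1 : R) (fun a : R => (1 + a) `^ p) (p * (1 + a) `^ (p - 1)).
  move=> x0.
  have x1 : 1 + a \in `]0, +oo[ by rewrite in_itv/= andbT; lra.
  have H1 : is_derive (1 + a) (1 : R) (fun a : R => a `^ p) (p * (1 + a) `^ (p - 1)).
    apply: DeriveDef; first exact: derivable_powR.
    by rewrite -derive1E powR_derive1.
  have H2 : is_derive a (1 : R) (fun x : R => 1 + x) 1.
    by rewrite (_ : (fun x : R => 1 + x) = cst 1 + id) //; apply: is_derive_eq; rewrite add0r.
  rewrite -[X in is_derive _ _ _ X]mulr1.
  exact: (@is_derive1_comp R (fun a => a `^ p) (fun x => 1 + x)).
have dF (x : R) : 0 <= x -> is_derive x (1 : R) F ((1 + x) `^ (- s)).
  move=> x0.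
  have hx := h x (1 - s) ltac:(lra).
  have -> : F = (1 - s)^-1 *: (fun a : R => (1 + a) `^ (1 - s)).
    by apply/funext => y; rewrite /F /= mulrC.
  apply: is_derive_eq.
  rewrite scalerA mulVf// scale1r; congr (_ `^ _); lra.
have cF (p x : R) : 0 <= x -> {for x, continuous (fun a : R => (1 + a) `^ p)}.
  move=> x0; have := h x p ltac:(lra) => -[+ _].
  by move/derivable1_diffP/differentiable_continuous.
rewrite (@ge0_continuous_FTC2y _ _ F 0 0) //.
- by rewrite ltry.
- by move=> x _; rewrite powR_ge0.
- apply: continuous_in_subspaceT => x; rewrite inE/= in_itv/= andbT => x0.
  exact: cF.
- rewrite -[X in _ --> X](mul0r (1 - s)^-1) /F.
  apply: cvgMl.
  apply/cvgrPdist_le => e e0; near=> x.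
  have x1 : 1 <= x by near: x; apply: nbhs_pinfty_ge; rewrite num_real.
  rewrite sub0r normrN ger0_norm ?powR_ge0// -opprB powRN.
  rewrite -[leRHS]invrK lef_pV2 ?posrE ?invr_gt0// ?powR_gt0//; last by lra.
  have -> : e^-1 = (e^-1 `^ (s - 1)^-1) `^ (s - 1).
    by rewrite -powRrM mulVf ?powRr1 ?invr_ge0 ?ltW//; lra.
  rewrite ge0_ler_powR ?nnegrE ?powR_ge0//; [lra|lra|].
  apply: (@le_trans _ _ x); last by lra.
  by near: x; apply: nbhs_pinfty_ge; rewrite num_real.
- by move=> x x0; have [] := dF x (ltW x0).
- apply: cvg_at_right_filter.
  have [] := dF 0 (lexx _).
  by move=> /derivable1_diffP/differentiable_continuous.
- move=> x; rewrite in_itv/= andbT => x0.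
  by rewrite derive1E; have [_ ->] := dF x (ltW x0).
Unshelve. all: by end_near. Qed.

(** Evenness reduces the integral to the half-line, where [powR_sqr_le] compares it with a power of
    exponent $2q>1$. *)
Lemma integral_bessel1_lty (q : R) : 1 / 2 < q ->
  (\int[lebesgue_measure]_x ((1 + x ^+ 2) `^ (- q))%:E < +oo)%E.
Proof.
move=> q2.
have cb : continuous (fun x : R => (1 + x ^+ 2) `^ (- q)).
  move=> x.
  have x1 : 1 + x ^+ 2 \in `]0, +oo[.
    by rewrite in_itv/= andbT; have := sqr_ge0 x; lra.
  apply: (@continuous_comp _ _ _ (fun x : R => 1 + x ^+ 2) (fun a : R => a `^ (- q))).
    by apply: cvgD; [exact: cvg_cst|exact: exprn_continuous].
  have : derivable (fun a : R => a `^ (- q)) (1 + x ^+ 2) 1 by exact: derivable_powR.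
  by move/derivable1_diffP/differentiable_continuous.
rewrite ge0_symfun_integralT//; last 2 first.
- by move=> x; exact: powR_ge0.
- by move=> x /=; rewrite sqrrN.
apply: lte_mul_pinfty => //.
rewrite -set_itvcy.
apply: (@le_lt_trans _ _ (\int[lebesgue_measure]_(x in `[0%R, +oo[)
    (2 `^ q * (1 + x) `^ (- (2 * q)))%:E)%E).
  apply: ge0_le_integral => //.
  - by move=> x _; rewrite lee_fin powR_ge0.
  - apply/measurable_EFinP/measurable_funTS.
    exact: continuous_measurable_fun.
  - apply/measurable_EFinP/measurable_funTS/measurable_funM => //.
    by apply: (measurableT_comp (measurable_powR _)); exact: measurable_funD.
  - move=> x; rewrite /= in_itv/= andbT => x0.
    by rewrite lee_fin powR_sqr_le//; lra.
under eq_integral do rewrite EFinM.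
rewrite ge0_integralZl//.
- apply: lte_mul_pinfty => //.
  by apply: integral_powR_lty; lra.
- apply/measurable_EFinP/measurable_funTS.
  by apply: (measurableT_comp (measurable_powR _)); exact: measurable_funD.
- by move=> x _; rewrite lee_fin powR_ge0.
Qed.


Notation mu3 := (leb3 R).

Lemma measurable_vec3 (i : 'I_3) : measurable_fun [set: R3 R] (fun k : R3 R => vec3 k 0 i).
Proof.
pose G (j : nat) (k : R3 R) : R := [:: k.1.1; k.1.2; k.2]`_j.
rewrite (_ : (fun k => _) = G i); last first.
  by apply/funext => k; rewrite /vec3 mxE.
case: i => -[|[|[|//]]] /= _.
- exact: (measurableT_comp measurable_fst measurable_fst).
- exact: (measurableT_comp measurable_snd measurable_fst).
- exact: measurable_snd.
Qed.

Lemma vec3E (k : R3 R) : [/\ vec3 k 0 0 = k.1.1, vec3 k 0 1 = k.1.2 & vec3 k 0 2 = k.2].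
Proof. by split; rewrite /vec3 mxE. Qed.

Lemma edotE (u v : 'rV[R]_3) : edot u v = u 0 0 * v 0 0 + u 0 1 * v 0 1 + u 0 2 * v 0 2.
Proof.
rewrite /edot !big_ord_recr big_ord0 /= add0r.
by congr (_ * _ + _ * _ + _ * _); congr (_ 0 _); apply/val_inj.
Qed.

Lemma edot_ge0 (u : 'rV[R]_3) : 0 <= edot u u.
Proof. by rewrite edotE -!expr2 !addr_ge0 ?sqr_ge0. Qed.

Lemma enorm_ge0 (u : 'rV[R]_3) : 0 <= enorm u.
Proof. exact: sqrtr_ge0. Qed.

Lemma enorm_sqr (u : 'rV[R]_3) : enorm u ^+ 2 = edot u u.
Proof. by rewrite sqr_sqrtr ?edot_ge0. Qed.

Lemma measurable_edot_vec3 (x : 'rV[R]_3) :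
  measurable_fun [set: R3 R] (fun k : R3 R => edot x (vec3 k)).
Proof.
rewrite (_ : (fun k => _) = (fun k => x 0 0 * vec3 k 0 0 + x 0 1 * vec3 k 0 1 + x 0 2 * vec3 k 0 2)).
  by apply: measurable_funD; [apply: measurable_funD|]; apply: measurable_funM => //; exact: measurable_vec3.
by apply/funext => k; rewrite edotE.
Qed.

Lemma measurable_enorm_vec3 : measurable_fun [set: R3 R] (fun k : R3 R => enorm (vec3 k)).
Proof.
apply: (measurableT_comp (continuous_measurable_fun (@sqrt_continuous R))) => /=.
rewrite (_ : (fun k => _) = (fun k => vec3 k 0 0 ^+ 2 + vec3 k 0 1 ^+ 2 + vec3 k 0 2 ^+ 2)).
  by apply: measurable_funD; [apply: measurable_funD|]; apply: measurable_funX => //; exact: measurable_vec3.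
by apply/funext => k; rewrite edotE !expr2.
Qed.

(** Each of $1+x^2$, $1+y^2$, $1+z^2$ is at most $1+|k|^2$, so for $q=s/3$ the weight is bounded by
    a product of three one-dimensional weights of exponent $q$. The condition $q>1/2$ is exactly
    $s>3/2$. *)
Lemma integral_bessel3_lty (s : R) : 3 / 2 < s ->
  (\int[mu3]_k ((1 + enorm (vec3 k) ^+ 2) `^ (- s))%:E < +oo)%E.
Proof.
move=> s32.
pose q := s / 3.
have q12 : 1 / 2 < q by rewrite /q; lra.
pose f (x : R) := (1 + x ^+ 2) `^ (- q).
have f0 x : 0 <= f x by exact: powR_ge0.
have mf : measurable_fun [set: measurableTypeR R] f.
  apply: (measurableT_comp (measurable_powR _)).
  by apply: measurable_funD => //; exact: exprn_measurable.
have I1 := integral_bessel1_lty q12.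
have m3 : measurable_fun [set: R3 R] (fun k : R3 R => (f k.1.1 * f k.1.2 * f k.2)%:E).
  apply/measurable_EFinP; apply: measurable_funM; first apply: measurable_funM.
  - exact: (measurableT_comp mf (measurableT_comp measurable_fst measurable_fst)).
  - exact: (measurableT_comp mf (measurableT_comp measurable_snd measurable_fst)).
  - exact: (measurableT_comp mf measurable_snd).
apply: (@le_lt_trans _ _ (\int[mu3]_k (f k.1.1 * f k.1.2 * f k.2)%:E)%E).
  apply: ge0_le_integral => //.
  - by move=> x _; rewrite lee_fin powR_ge0.
  - apply/measurable_EFinP; apply: (measurableT_comp (measurable_powR _)).
    by apply: measurable_funD => //; apply: measurable_funX; exact: measurable_enorm_vec3.
  - move=> k _; rewrite lee_fin /f.
    rewrite enorm_sqr edotE; have [-> -> ->] := vec3E k; rewrite -!expr2.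
    set x := k.1.1; set y := k.1.2; set z := k.2; set n := 1 + _.
    have [x0 y0 z0] := And3 (sqr_ge0 x) (sqr_ge0 y) (sqr_ge0 z).
    have -> : n `^ (- s) = (n `^ q * n `^ q * n `^ q)^-1.
      rewrite powRN -!powRD; [congr ((_ `^ _)^-1); rewrite /q; lra|
        by apply/implyP => _; rewrite gt_eqF// /n; lra..].
    rewrite !powRN -!invfM lef_pV2 ?posrE ?mulr_gt0 ?powR_gt0//; [|rewrite /n; lra..].
    rewrite !ler_pM ?mulr_ge0 ?powR_ge0//; apply: ge0_ler_powR; rewrite ?nnegrE /n; lra.
have m12 : measurable_fun [set: measurableTypeR R * measurableTypeR R] (fun z => f z.1 * f z.2).
  apply: measurable_funM.
  - exact: (measurableT_comp mf measurable_fst).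
  - exact: (measurableT_comp mf measurable_snd).
have p12 (z : measurableTypeR R * measurableTypeR R) : 0 <= f z.1 * f z.2 by rewrite mulr_ge0.
(* The inner product measure is passed as [sigma_finite_prod], which carries the sigma-finite
   structure that [integral_prod] asks for. *)
have E1 := @integral_prod _ _ _ _ R
  (sigma_finite_prod (@lebesgue_measure R) (@lebesgue_measure R))
  (@lebesgue_measure R) _ _ m12 mf p12 f0.
have E2 := @integral_prod _ _ _ _ R (@lebesgue_measure R) (@lebesgue_measure R)
  _ _ mf mf f0 f0.
move: E1; rewrite /= => E1.
set I : \bar R := (\int[lebesgue_measure]_z (f z)%:E)%E.
have I0 : (0 <= I)%E by apply: integral_ge0 => z _; rewrite lee_fin.
have fI : I \is a fin_num by rewrite ge0_fin_numE.
have -> : (\int[mu3]_k (f k.1.1 * f k.1.2 * f k.2)%:E = I * I * I)%E.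
  exact: (etrans E1 (congr1 (fun z => z * _)%E E2)).
by rewrite -(fineK fI) -!EFinM ltry.
Qed.

Definition bracket (k : R3 R) : R := 1 + enorm (vec3 k) ^+ 2.

Lemma bracket_ge1 k : 1 <= bracket k.
Proof. by rewrite /bracket lerDl sqr_ge0. Qed.

Lemma measurable_bracket : measurable_fun [set: R3 R] bracket.
Proof.
by apply: measurable_funD => //; apply: measurable_funX; exact: measurable_enorm_vec3.
Qed.

(** Cauchy-Schwarz after writing the exponent $1/2$ as $(1-m)/2+m/2$: the square of the first factor
    is the weight of exponent $m-1>3/2$. The power $1/2$ of [bracket] is worth one derivative, so
    the left side will control both a function and its gradient. *)
Lemma integral_fourier_le (m : R) : 5 / 2 < m -> exists2 K : R, 0 < K &
  forall c : R3 R -> R, measurable_fun [set: R3 R] c -> (forall k, 0 <= c k) ->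
  (\int[mu3]_k (bracket k `^ (1 / 2) * c k)%:E <=
    K%:E * 'N[mu3]_2%:E[EFin \o (fun k => bracket k `^ (m / 2) * c k)%R])%E.
Proof.
move=> m52.
pose f k := bracket k `^ ((1 - m) / 2).
have mb p : measurable_fun [set: R3 R] (fun k => bracket k `^ p).
  exact: (measurableT_comp (measurable_powR _) measurable_bracket).
have b0 k : 0 < bracket k by rewrite (lt_le_trans ltr01)// bracket_ge1.
have Ly : ('N[mu3]_2%:E[EFin \o f] < +oo)%E.
  rewrite unlock /= poweR_lty//.
  rewrite (eq_integral (fun k => (bracket k `^ (- (m - 1)))%:E)); last first.
    move=> k _; rewrite /= ger0_norm ?powR_ge0// -powRrM; congr ((_ `^ _)%:E); lra.
  by apply: integral_bessel3_lty; lra.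
have L0 : (0 <= 'N[mu3]_2%:E[EFin \o f])%E by exact: Lnorm_ge0.
have Lf : ('N[mu3]_2%:E[EFin \o f])%E \is a fin_num by rewrite ge0_fin_numE.
exists (1 + fine ('N[mu3]_2%:E[EFin \o f])%E); first by rewrite ltr_pwDl ?fine_ge0.
move=> c mc c0.
have h2 : (2^-1 + 2^-1 = 1 :> R)%R by lra.
have := hoelder mu3 (mb ((1 - m) / 2)) (measurable_funM (mb (m / 2)) mc) (ltr0Sn R 1) (ltr0Sn R 1) h2.
rewrite Lnorm1 => H.
apply: (@le_trans _ _ ('N[mu3]_2%:E[EFin \o f] * 'N[mu3]_2%:E[EFin \o (fun k => bracket k `^ (m / 2) * c k)%R])%E).
  apply: le_trans H.
  rewrite le_eqVlt; apply/orP; left; apply/eqP.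
  apply: eq_integral => k _; rewrite /= ger0_norm ?mulr_ge0 ?powR_ge0//.
  rewrite mulrA -powRD; last by rewrite (gt_eqF (b0 k)) implybT.
  congr ((_ `^ _ * _)%:E); lra.
rewrite lee_wpmul2r ?Lnorm_ge0// -[X in (X <= _)%E](fineK Lf) lee_fin; lra.
Qed.
End bessel.

(** * Plane waves and their Taylor remainders *)

Section plane_wave.
Variable R : realType.

Lemma ord3P (P : 'I_3 -> Prop) : P 0 -> P 1 -> P 2 -> forall i, P i.
Proof.
move=> h0 h1 h2 [[|[|[|//]]] /= Hi].
- by rewrite (_ : Ordinal Hi = 0)//; exact/val_inj.
- by rewrite (_ : Ordinal Hi = 1)//; exact/val_inj.
- by rewrite (_ : Ordinal Hi = 2)//; exact/val_inj.
Qed.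

Lemma rV_coord_le n (x : 'rV[R]_n) i : `|x 0 i| <= `|x|.
Proof.
rewrite /Num.norm /= mx_normrE.
exact: (le_bigmax_cond _ (fun ij : 'I_1 * 'I_n => `|x ij.1 ij.2|) (erefl true : xpredT (0, i))).
Qed.

Lemma rV_norm_le n (x : 'rV[R]_n) e : 0 <= e -> (forall i, `|x 0 i| <= e) -> `|x| <= e.
Proof.
move=> e0 h; rewrite /Num.norm /= mx_normrE; apply: bigmax_le => //= -[i j] _ /=.
by rewrite (ord1 i).
Qed.

Lemma MVT_unordered (f df : R -> R) x y : (forall x, is_derive x (1 : R) f (df x)) ->
  exists2 z, `|z - x| <= `|y - x| & f y - f x = df z * (y - x).
Proof.
move=> h.
have cf a c : {within `[a, c], continuous f}.
  apply: continuous_subspaceT => z; have [+ _] := h z.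
  by move/derivable1_diffP/differentiable_continuous.
have [xy|yx] := leP x y.
  have [z] := @MVT_segment R f df x y xy (fun x _ => h x) (cf _ _).
  rewrite in_itv/= => /andP[xz zy] E; exists z => //.
  by rewrite !ger0_norm ?subr_ge0//; lra.
have [z] := @MVT_segment R f df y x (ltW yx) (fun x _ => h x) (cf _ _).
rewrite in_itv/= => /andP[xz zy] E; exists z; last by lra.
by rewrite !ler0_norm ?subr_le0//; lra.
Qed.

Section wave.
Variables p q : R.
Let c := Num.sqrt (p ^+ 2 + q ^+ 2).
Let w t := p * cos t - q * sin t.
Let dw t := - p * sin t - q * cos t.

(** $(p^2+q^2)(\cos^2t+\sin^2t)-(p\cos t-q\sin t)^2$ is the square $(p\sin t+q\cos t)^2$. *)
Lemma wave_le t : `|w t| <= c.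
Proof.
rewrite -(sqrtr_sqr (w t)) ler_sqrt; last by rewrite addr_ge0 ?sqr_ge0.
have -> : p ^+ 2 + q ^+ 2 = (p ^+ 2 + q ^+ 2) * (cos t ^+ 2 + sin t ^+ 2).
  by rewrite cos2Dsin2 mulr1.
rewrite /w; have := sqr_ge0 (p * sin t + q * cos t); lra.
Qed.

Lemma dwave_le t : `|dw t| <= c.
Proof.
rewrite -(sqrtr_sqr (dw t)) ler_sqrt; last by rewrite addr_ge0 ?sqr_ge0.
have -> : p ^+ 2 + q ^+ 2 = (p ^+ 2 + q ^+ 2) * (cos t ^+ 2 + sin t ^+ 2).
  by rewrite cos2Dsin2 mulr1.
rewrite /dw; have := sqr_ge0 (p * cos t - q * sin t); lra.
Qed.

Lemma is_derive_wave t : is_derive t (1 : R) w (dw t).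
Proof.
rewrite (_ : w = p *: cos - q *: sin)//.
by apply: is_derive_eq; rewrite /dw /GRing.scale /=; lra.
Qed.

Lemma is_derive_dwave t : is_derive t (1 : R) dw (- w t).
Proof.
rewrite (_ : dw = (- p) *: sin - q *: cos)//.
by apply: is_derive_eq; rewrite /w /GRing.scale /=; lra.
Qed.

(** The remainder is $(w'(z)-w'(t))d$ for an intermediate $z$; the bracket is at most $2c$, and by a
    second mean value theorem at most $c|d|$. The linear bound serves at high frequencies, the
    quadratic one at low frequencies, where the phase increment is small. *)
Lemma wave_taylor t d : `|w (t + d) - w t - dw t * d| <= 2 * c * `|d| /\
  `|w (t + d) - w t - dw t * d| <= c * `|d| ^+ 2.
Proof.
have [z + E] := MVT_unordered t (t + d) is_derive_wave.
rewrite addrAC subrr add0r => zd.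
have -> : w (t + d) - w t - dw t * d = (dw z - dw t) * d by rewrite E; ring.
rewrite normrM; split.
  rewrite ler_wpM2r//; apply: (le_trans (ler_normB _ _)).
  have := dwave_le z; have := dwave_le t; lra.
have [z' zz' E'] := MVT_unordered t z is_derive_dwave.
rewrite E' mulNr normrN normrM expr2 mulrA ler_wpM2r// ler_pM// wave_le//.
Qed.
End wave.
End plane_wave.

(** * The inverse Fourier integral and its differential *)

Section fourier.
Variable R : realType.
Notation mu3 := (leb3 R).
Variables a b : R3 R -> R.
Hypothesis ma : measurable_fun [set: R3 R] a.
Hypothesis mb : measurable_fun [set: R3 R] b.
Definition modulus (k : R3 R) : R := Num.sqrt (a k ^+ 2 + b k ^+ 2).
(** The integral of this density bounds the inverse Fourier integral and, up to a factor $6\pi$, its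
    differential. *)
Definition weighted (k : R3 R) : R := bracket k `^ (1 / 2) * modulus k.
Hypothesis Hy : (\int[mu3]_k (weighted k)%:E < +oo)%E.

Lemma measurable_modulus : measurable_fun [set: R3 R] modulus.
Proof.
apply: (measurableT_comp (continuous_measurable_fun (@sqrt_continuous R))).
by apply: measurable_funD; exact: measurable_funX.
Qed.

Lemma measurable_weighted : measurable_fun [set: R3 R] weighted.
Proof.
apply: measurable_funM measurable_modulus.
exact: (measurableT_comp (measurable_powR _) (@measurable_bracket R)).
Qed.

Lemma modulus_ge0 k : 0 <= modulus k. Proof. exact: sqrtr_ge0. Qed.

Lemma weighted_ge0 k : 0 <= weighted k.
Proof. by rewrite mulr_ge0 ?powR_ge0 ?modulus_ge0. Qed.

Lemma bracket_half (k : R3 R) : bracket k `^ (1 / 2) = Num.sqrt (bracket k).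
Proof. by rewrite div1r powR12_sqrt// (le_trans ler01)// bracket_ge1. Qed.

Lemma modulus_le k : modulus k <= weighted k.
Proof.
rewrite /weighted ler_peMl ?modulus_ge0// bracket_half.
by rewrite -[leLHS]sqrtr1 ler_sqrt ?bracket_ge1// (le_trans ler01)// bracket_ge1.
Qed.

Lemma enorm_modulus_le k : enorm (vec3 k) * modulus k <= weighted k.
Proof.
rewrite /weighted ler_wpM2r ?modulus_ge0// bracket_half.
rewrite -[leLHS]ger0_norm ?enorm_ge0// -sqrtr_sqr ler_sqrt.
  by rewrite /bracket lerDr.
by rewrite (le_trans ler01)// bracket_ge1.
Qed.

Lemma integrable_weighted : mu3.-integrable setT (EFin \o weighted).
Proof.
apply/integrableP; split; first by apply/measurable_EFinP; exact: measurable_weighted.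
apply: le_lt_trans Hy; rewrite le_eqVlt; apply/orP; left; apply/eqP.
by apply: eq_integral => k _; rewrite /= ger0_norm ?weighted_ge0.
Qed.

Lemma integrable_scale (D : set (R3 R)) (s : R) (f : R3 R -> R) : measurable D ->
  mu3.-integrable D (EFin \o f) -> mu3.-integrable D (EFin \o (fun k => s * f k)).
Proof. by move=> mD; exact: integrableZl. Qed.

Lemma integrable_add (D : set (R3 R)) (f g : R3 R -> R) : measurable D ->
  mu3.-integrable D (EFin \o f) -> mu3.-integrable D (EFin \o g) ->
  mu3.-integrable D (EFin \o (fun k => f k + g k)).
Proof. by move=> mD; exact: integrableD. Qed.

Lemma integrable_sub (D : set (R3 R)) (f g : R3 R -> R) : measurable D ->
  mu3.-integrable D (EFin \o f) -> mu3.-integrable D (EFin \o g) ->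
  mu3.-integrable D (EFin \o (fun k => f k - g k)).
Proof. by move=> mD; exact: integrableB. Qed.

Lemma integrable_dominated (D : set (R3 R)) (f h : R3 R -> R) : measurable D ->
  measurable_fun D f -> (forall k, D k -> `|f k| <= h k) ->
  mu3.-integrable D (EFin \o h) ->
  mu3.-integrable D (EFin \o f) /\
  `|\int[mu3]_(k in D) f k| <= \int[mu3]_(k in D) h k.
Proof.
move=> mD mf fh ih.
have jf : mu3.-integrable D (EFin \o f).
  apply: (le_integrable mD _ _ ih); first exact/measurable_EFinP.
  by move=> k Dk; rewrite /= lee_fin (le_trans (fh _ Dk))// ler_norm.
split=> //; apply: (le_trans (le_normr_Rintegral mD jf)).
apply: le_Rintegral => //.
apply: (le_integrable mD _ _ ih).
  by apply/measurable_EFinP; exact: measurableT_comp.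
by move=> k Dk; rewrite /= lee_fin normr_id (le_trans (fh _ Dk))// ler_norm.
Qed.

Definition high (r : R) := [set k : R3 R | r < enorm (vec3 k)].

Lemma measurable_high r : measurable (high r).
Proof.
have := @measurable_enorm_vec3 R measurableT [set` `]r, +oo[] (measurable_itv _).
rewrite setTI; congr (measurable _); apply/seteqP; split => k /=;
  by rewrite /high /= in_itv/= andbT.
Qed.

Lemma weighted_high r k : 0 <= weighted k * \1_(high r) k <= weighted k.
Proof.
have h := weighted_ge0 k; rewrite indicE; case: (_ \in _).
  by rewrite mulr1 h lexx.
by rewrite mulr0 h lexx.
Qed.

(** Dominated convergence: every fixed frequency eventually leaves [high n]. *)
Lemma tail_small e : 0 < e -> exists2 r, 0 < r &
  \int[mu3]_k (weighted k * \1_(high r) k) < e.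
Proof.
move=> e0.
pose f_ (n : nat) k := (weighted k * \1_(high n%:R) k)%:E.
have mf n : measurable_fun [set: R3 R] (f_ n).
  apply/measurable_EFinP; apply: measurable_funM measurable_weighted _.
  by apply: measurable_indic; exact: measurable_high.
have cf k : [set: R3 R] k -> f_ n k @[n --> \oo] --> (cst 0%E : R3 R -> \bar R) k.
  move=> _; apply: cvg_near_cst.
  near=> n; rewrite /f_ indicE memNset ?mulr0//.
  rewrite /high /=; apply/negP; rewrite -leNgt; near: n.
  exact: nbhs_infty_ger.
have := @dominated_cvg _ _ R mu3 setT measurableT f_ _ (EFin \o weighted) mf cf
  (fun _ _ => erefl) integrable_weighted.
rewrite integral_cst// mul0e => H.
have {}H : (\int[mu3]_k f_ n k @[n --> \oo] --> 0)%E.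
  apply: H => n k _; have /andP[h0 h1] := weighted_high n%:R k.
  by rewrite lee_fin ger0_norm.
have /fine_cvg/cvgrPdist_lt/(_ e e0) [n _ /(_ n.+1 (leqnSn n))] := H.
rewrite sub0r normrN => h.
(* The index [n.+1] instead of [n] makes the radius positive. *)
exists n.+1%:R => //; apply: le_lt_trans h.
by rewrite ler_norm.
Unshelve. all: by end_near. Qed.

Definition phase (x : 'rV[R]_3) (k : R3 R) : R := 2 * pi * edot x (vec3 k).

Lemma phaseD x y k : phase (x + y) k = phase x k + phase y k.
Proof. by rewrite /phase !edotE !mxE; ring. Qed.

(** The constant is $2\pi\cdot 3$: the norm of [x] is the max norm, and the dot product is bounded
    by three products of coordinates. *)
Lemma phase_le x k : `|phase x k| <= 6 * pi * `|x| * enorm (vec3 k).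
Proof.
have h i : `|vec3 k 0 i| <= enorm (vec3 k).
  rewrite -sqrtr_sqr ler_sqrt ?edot_ge0//.
  by rewrite /edot (bigD1 i)//= -expr2 lerDl sumr_ge0// => j _; rewrite -expr2 sqr_ge0.
rewrite /phase edotE normrM ger0_norm ?mulr_ge0 ?pi_ge0//.
rewrite (_ : 6 * pi * `|x| * enorm (vec3 k) = 2 * pi * (3 * `|x| * enorm (vec3 k))); last ring.
rewrite ler_wpM2l ?mulr_ge0 ?pi_ge0//.
apply: (le_trans (ler_normD _ _)); apply: (le_trans (lerD (ler_normD _ _) (lexx _))).
rewrite !normrM.
have h' i : `|x 0 i| * `|vec3 k 0 i| <= `|x| * enorm (vec3 k) by rewrite ler_pM ?rV_coord_le.
have := h' 0; have := h' 1; have := h' 2; lra.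
Qed.

Lemma measurable_phase x : measurable_fun [set: R3 R] (phase x).
Proof. by apply: measurable_funM => //; exact: measurable_edot_vec3. Qed.

Definition wave x (k : R3 R) : R := a k * cos (phase x k) - b k * sin (phase x k).
(** The derivative of the plane wave with respect to its phase; [dwave x k * phase y k] is thus its
    differential at [x] in the direction [y]. *)
Definition dwave x (k : R3 R) : R := - a k * sin (phase x k) - b k * cos (phase x k).

Lemma measurable_cos_phase x : measurable_fun [set: R3 R] (fun k => cos (phase x k)).
Proof. exact: (measurableT_comp (continuous_measurable_fun (@continuous_cos R)) (measurable_phase x)). Qed.

Lemma measurable_sin_phase x : measurable_fun [set: R3 R] (fun k => sin (phase x k)).
Proof. exact: (measurableT_comp (continuous_measurable_fun (@continuous_sin R)) (measurable_phase x)). Qed.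

Lemma measurable_wave x : measurable_fun [set: R3 R] (wave x).
Proof.
apply: measurable_funB; apply: measurable_funM => //.
  exact: measurable_cos_phase.
exact: measurable_sin_phase.
Qed.

Lemma measurable_dwave x : measurable_fun [set: R3 R] (dwave x).
Proof.
apply: measurable_funB; apply: measurable_funM => //.
- exact: measurableT_comp.
- exact: measurable_sin_phase.
- exact: measurable_cos_phase.
Qed.

(** The real part of the full inverse Fourier integral, followed by its candidate differential and
    by the constant that bounds both. *)
Definition synth x : R := \int[mu3]_k wave x k.
Definition dsynth x y : R := \int[mu3]_k (dwave x k * phase y k).
Definition mass : R := \int[mu3]_k weighted k.

Lemma mass_ge0 : 0 <= mass.
Proof. by apply: Rintegral_ge0 => k _; exact: weighted_ge0. Qed.

Lemma synth_int x : mu3.-integrable setT (EFin \o wave x) /\ `|synth x| <= mass.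
Proof.
apply: integrable_dominated => //; [exact: measurable_wave| |exact: integrable_weighted].
by move=> k _; apply: (le_trans (wave_le _ _ _)); exact: modulus_le.
Qed.

Lemma dsynth_int x y : mu3.-integrable setT (EFin \o (fun k => dwave x k * phase y k)) /\
  `|dsynth x y| <= 6 * pi * mass * `|y|.
Proof.
rewrite (_ : _ * mass * _ = \int[mu3]_k (6 * pi * `|y| * weighted k)); last first.
  by rewrite RintegralZl//; [rewrite /mass; ring|exact: integrable_weighted].
apply: integrable_dominated => //.
- by apply: measurable_funM; [exact: measurable_dwave|exact: measurable_phase].
- move=> k _; rewrite normrM.
  apply: (le_trans (ler_pM (normr_ge0 _) (normr_ge0 _) (dwave_le _ _ _) (phase_le _ _))).
  rewrite -/(modulus k) (_ : modulus k * _ = 6 * pi * `|y| * (enorm (vec3 k) * modulus k)).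
    by rewrite ler_wpM2l ?enorm_modulus_le// mulr_ge0// mulr_ge0// pi_ge0.
  by ring.
- exact: integrable_scale integrable_weighted.
Qed.

Lemma dsynthD x y z : dsynth x (y + z) = dsynth x y + dsynth x z.
Proof.
rewrite /dsynth -RintegralD//; [|by have [] := dsynth_int x y|by have [] := dsynth_int x z].
by apply: eq_Rintegral => k _; rewrite phaseD mulrDr.
Qed.

Lemma dsynthZ x y (s : R) : dsynth x (s *: y) = s * dsynth x y.
Proof.
rewrite /dsynth -RintegralZl//; last by have [] := dsynth_int x y.
by apply: eq_Rintegral => k _; rewrite /phase !edotE !mxE; ring.
Qed.

(** Frequencies are split at a radius [r]. Beyond it the linear Taylor bound suffices because the
    tail is small; below it the quadratic bound gains a factor proportional to $r|y|$. The radius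
    [d] does not depend on [x], which later yields continuity of the gradient. *)
Lemma synth_diff e : 0 < e -> exists2 d, 0 < d &
  forall x y, `|y| < d -> `|synth (x + y) - synth x - dsynth x y| <= e * `|y|.
Proof.
move=> e0.
have [C C0 CE] : exists2 C : R, 0 < C & 6 * pi = C.
  by exists (6 * pi) => //; rewrite mulr_gt0 ?pi_gt0.
have e1 : 0 < e / (4 * C) by rewrite divr_gt0// mulr_gt0.
have [r r0 hr] := tail_small e1.
(* Chosen so that the low-frequency part of [h] below integrates to at most $e|y|/2$; the tail bound
   $e/(4C)$ does the same for the high-frequency part. The added 1 guards against a zero mass. *)
exists (e / (2 * C ^+ 2 * r * (mass + 1))).
  by rewrite divr_gt0 ?mulr_gt0 ?exprn_gt0//; have := mass_ge0; lra.
move=> x y yd.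
pose h k := C * `|y| * 2 * (weighted k * \1_(high r) k) + C * `|y| * C * `|y| * r * weighted k.
have iw := integrable_weighted.
have it : mu3.-integrable setT (EFin \o (fun k => weighted k * \1_(high r) k)).
  apply: (le_integrable measurableT _ _ iw).
    apply/measurable_EFinP; apply: measurable_funM measurable_weighted _.
    by apply: measurable_indic; exact: measurable_high.
  move=> k _; have /andP[h0 h1] := weighted_high r k.
  by rewrite lee_fin !ger0_norm ?weighted_ge0.
have ih : mu3.-integrable setT (EFin \o h).
  by apply: integrable_add => //; exact: integrable_scale.
have [i1 _] := synth_int (x + y); have [i2 _] := synth_int x.
have [i3 _] := dsynth_int x y.
have -> : synth (x + y) - synth x - dsynth x y =
    \int[mu3]_k (wave (x + y) k - wave x k - dwave x k * phase y k).
  rewrite RintegralB//; last exact: integrable_sub.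
  by rewrite RintegralB.
have mw : measurable_fun setT (fun k => wave (x + y) k - wave x k - dwave x k * phase y k).
  apply: measurable_funB.
    by apply: measurable_funB; exact: measurable_wave.
  by apply: measurable_funM; [exact: measurable_dwave|exact: measurable_phase].
have wh k : [set: R3 R] k -> `|wave (x + y) k - wave x k - dwave x k * phase y k| <= h k.
  move=> _; have [] := wave_taylor (a k) (b k) (phase x k) (phase y k).
  rewrite -phaseD -/(modulus k) -/(wave x k) -/(wave (x + y) k) -/(dwave x k) /h.
  set Q := `|_|; move=> Q1 Q2.
  have P1 := phase_le y k; rewrite CE in P1; have P2 := enorm_modulus_le k.
  have w0 := weighted_ge0 k; have m0 := modulus_ge0 k.
  have E0 := enorm_ge0 (vec3 k); set E := enorm _ in E0 P1 P2 *.
  have z0 : 0 <= C * `|y| by rewrite mulr_ge0// ltW.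
  have P3 : modulus k * `|phase y k| <= C * `|y| * weighted k.
    apply: (le_trans (ler_wpM2l m0 P1)).
    rewrite (_ : modulus k * (C * `|y| * E) = C * `|y| * (E * modulus k)); last by ring.
    by rewrite ler_wpM2l.
  have r00 := ltW r0.
  rewrite indicE; have [kr|/negP] := boolP (k \in high r).
    rewrite mulr1 (le_trans Q1)//.
    have t0 : 0 <= C * `|y| * C * `|y| * r * weighted k.
      by apply: mulr_ge0 => //; apply: mulr_ge0 => //; apply: mulr_ge0 => //; apply: mulr_ge0 => //; exact: ltW.
    lra.
  rewrite inE /high /= -/E => /negP; rewrite -leNgt => Er.
  rewrite !mulr0 add0r (le_trans Q2)// expr2 mulrA.
  apply: (le_trans (ler_pM _ _ P3 P1)) => //; first by rewrite mulr_ge0.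
  rewrite (_ : C * `|y| * C * `|y| * r * weighted k = C * `|y| * weighted k * (C * `|y| * r)); last ring.
  rewrite ler_wpM2l//; first exact: mulr_ge0.
  by rewrite ler_wpM2l.
have [_ H] := integrable_dominated measurableT mw wh ih.
apply: (le_trans H).
rewrite RintegralD//; [|exact: integrable_scale..].
rewrite !RintegralZl// -/mass.
have M0 := mass_ge0.
have A1 : C * `|y| * 2 * \int[mu3]_k (weighted k * \1_(high r) k) <= `|y| * (e / 2).
  rewrite (_ : `|y| * (e / 2) = C * `|y| * 2 * (e / (4 * C))); last by field; lra.
  by rewrite ler_wpM2l ?(ltW hr)// !mulr_ge0// ltW.
have A2 : C * `|y| * C * `|y| * r * mass <= `|y| * (e / 2).
  rewrite (_ : C * `|y| * C * `|y| * r * mass = `|y| * (`|y| * (C ^+ 2 * r * mass))); last ring.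
  rewrite ler_wpM2l//.
  move: yd; rewrite ltr_pdivlMr ?mulr_gt0 ?exprn_gt0//; last by lra.
  have : 0 <= `|y| * (C ^+ 2 * r) by rewrite !mulr_ge0// ?exprn_ge0// ltW.
  nra.
lra.
Qed.

(** The difference is the integral over the frequencies beyond [r], dominated by the tail of
    [weighted] whatever the point [x]. *)
Lemma inv_fourier_close e : 0 < e -> exists2 r0, 0 < r0 & forall r x, r0 <= r ->
  `|synth x - inv_fourier_re a b r x| < e.
Proof.
move=> e0; have [r0 r00 hr] := tail_small e0.
exists r0 => // r x rr.
have [i1 _] := synth_int x.
have mD : measurable (~` high r) by apply: measurableC; exact: measurable_high.
have -> : inv_fourier_re a b r x = \int[mu3]_(k in ~` high r) wave x k.
  rewrite /inv_fourier_re; congr Rintegral.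
  apply/seteqP; split => k; rewrite /high /=; first by move=> h; apply/negP; rewrite -leNgt.
  by move=> /negP; rewrite -leNgt.
have -> : synth x = \int[mu3]_(k in high r) wave x k + \int[mu3]_(k in ~` high r) wave x k.
  rewrite -(Rintegral_setU (measurable_high r) mD) ?setUv//.
  exact/disj_setPCl.
rewrite addrK.
have iw := integrable_weighted.
have mh := measurable_high r.
have mw : measurable_fun (high r) (wave x).
  by apply: measurable_funTS; exact: measurable_wave.
have wh k : high r k -> `|wave x k| <= weighted k.
  by move=> _; apply: (le_trans (wave_le _ _ _)); exact: modulus_le.
have [_ H] := integrable_dominated mh mw wh (integrableS measurableT mh (@subsetT _ _) iw).
apply: (le_lt_trans H); apply: le_lt_trans hr.
have it r' : mu3.-integrable setT (EFin \o (fun k => weighted k * \1_(high r') k)).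
  have mt : measurable_fun [set: R3 R] (fun k => weighted k * \1_(high r') k).
    by apply: measurable_funM measurable_weighted _; apply: measurable_indic; exact: measurable_high.
  have wt k : [set: R3 R] k -> `|weighted k * \1_(high r') k| <= weighted k.
    by move=> _; have /andP[h0 h1] := weighted_high r' k; rewrite ger0_norm.
  by have [] := integrable_dominated measurableT mt wt iw.
rewrite Rintegral_mkcond (_ : weighted \_ (high r) = (fun k => weighted k * \1_(high r) k)).
  apply: le_Rintegral => // k _; rewrite ler_wpM2l ?weighted_ge0// !indicE.
  have [kr|//] := boolP (k \in high r); rewrite (_ : k \in high r0)//.
  by move: kr; rewrite !inE /high /=; exact: le_lt_trans.
apply/funext => k; rewrite patchE indicE; case: (_ \in _); by rewrite ?mulr1 ?mulr0.
Qed.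

Lemma synth_continuous x e : 0 < e -> exists2 d, 0 < d &
  forall y, `|y - x| < d -> `|synth y - synth x| < e.
Proof.
move=> e0; have [d d0 hd] := synth_diff ltr01.
have M0 := mass_ge0; have C0 : 0 <= 6 * pi * mass :> R by rewrite !mulr_ge0 ?pi_ge0.
exists (Num.min d (e / (2 + 6 * pi * mass))).
  by rewrite lt_min d0 divr_gt0//; lra.
move=> y; rewrite lt_min => /andP[yd]; rewrite ltr_pdivlMr; last by lra.
have := hd x _ yd; rewrite subrKC mul1r => h1 h2.
have [_ h3] := dsynth_int x (y - x).
rewrite (_ : synth y - synth x = (synth y - synth x - dsynth x (y - x)) + dsynth x (y - x)); last ring.
apply: (le_lt_trans (ler_normD _ _)).
have := normr_ge0 (y - x); nra.
Qed.

(** A test set of positive finite measure, written in the space of triples where the measure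
    lives. *)
Definition cube (x : 'rV[R]_3) (d : R) : set (R3 R) :=
  (`]x 0 0 - d, x 0 0 + d[ `*` `]x 0 1 - d, x 0 1 + d[) `*` `]x 0 2 - d, x 0 2 + d[.

Lemma measurable_cube x d : measurable (cube x d).
Proof. by apply: measurableX => //; apply: measurableX. Qed.

Lemma measure_cube x d : 0 < d -> mu3 (cube x d) = ((2 * d) ^+ 3)%:E.
Proof.
move=> d0; have l (c : R) : lebesgue_measure `]c - d, c + d[%classic = (2 * d)%:E.
  rewrite lebesgue_measure_itv /= lte_fin ltrBlDr -addrA ltrDl addr_gt0//.
  by rewrite -EFinD; congr (_%:E); lra.
have m1 c : measurable (`]c - d, c + d[%classic : set (measurableTypeR R)) by [].
rewrite /cube product_measure1E//; last by apply: measurableX.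
transitivity ((2 * d)%:E * (2 * d)%:E * (2 * d)%:E)%E.
  congr (_ * _)%E; last exact: l.
  by apply: etrans (product_measure1E _ _ (m1 _) (m1 _)) _; congr (_ * _)%E; exact: l.
by rewrite -!EFinM; congr (_%:E); ring.
Qed.

Lemma cube_near x d k : 0 < d -> cube x d k -> `|vec3 k - x| <= d.
Proof.
move=> d0; have [E0 E1 E2] := vec3E k.
rewrite /cube /= !in_itv/= => -[[/andP[a1 a2] /andP[b1 b2]] /andP[c1 c2]].
apply: rV_norm_le; first exact: ltW.
have h0 : `|vec3 k 0 0 - x 0 0| <= d by rewrite E0 ler_norml; lra.
have h1 : `|vec3 k 0 1 - x 0 1| <= d by rewrite E1 ler_norml; lra.
have h2 : `|vec3 k 0 2 - x 0 2| <= d by rewrite E2 ler_norml; lra.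
by apply: ord3P; rewrite !mxE -?E0 -?E1 -?E2 mxE in h0 h1 h2 *.
Qed.

Import HBNNSimple.

(** A Chebyshev inequality for an arbitrary [F], measurable or not: the simple function $e^2 1_B$
    lies below $|F|^2$, and the integral of a nonnegative function is the supremum over such simple
    functions. Hence nothing has to be proved about the dependence of the truncated integrals on
    [x]. *)
Lemma Lnorm2_ge (B : set (R3 R)) (F : R3 R -> R) e : measurable B -> 0 <= e ->
  (forall k, B k -> e <= `|F k|) ->
  (((e `^ 2)%:E * mu3 B) `^ 2^-1 <= 'N[mu3]_2%:E[EFin \o F])%E.
Proof.
move=> mB e0 h.
rewrite unlock /=.
rewrite gt0_ler_poweR ?invr_ge0//.
- by rewrite in_itv/= leey andbT mule_ge0// lee_fin powR_ge0.
- by rewrite in_itv/= leey andbT integral_ge0// => k _; rewrite lee_fin powR_ge0.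
have -> : ((e `^ 2)%:E * mu3 B = \int[mu3]_k ((e `^ 2) * \1_B k)%:E)%E.
  under eq_integral do rewrite EFinM.
  rewrite ge0_integralZl//; first by rewrite integral_indic// setIT.
  - by apply/measurable_EFinP; exact: measurable_indic.
  - by rewrite lee_fin powR_ge0.
pose g := scale_nnsfun (indic_nnsfun R mB) (powR_ge0 e 2).
rewrite (_ : (fun k => _) = (fun k => (g k)%:E))//.
rewrite integralT_nnsfun [leRHS]ge0_integralTE; last first.
  by move=> k; rewrite lee_fin powR_ge0.
apply: ereal_sup_ubound; exists g => // k.
rewrite /g /= lee_fin mindicE; have [Bk|_] := boolP (k \in B).
  by rewrite mulr1 ge0_ler_powR ?nnegrE ?h//; exact/set_mem.
by rewrite mulr0 powR_ge0.
Qed.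

(** If [f] and [synth] differed at a point, continuity of both and the uniform closeness of the
    truncated integrals to [synth] would keep [f] away from all late truncations on a fixed cube,
    against convergence in $L^2$. *)
Lemma fourier_inversion (f : 'rV[R]_3 -> R) : continuous f ->
  ('N[mu3]_2%:E[(fun x => (f (vec3 x) - inv_fourier_re a b r (vec3 x))%:E)])%E
        @[r --> +oo] --> 0%E ->
  f = synth.
Proof.
move=> cf H; apply/funext => x0; apply: contrapT => /eqP; rewrite -subr_eq0 => ne.
(* A quarter of the gap: three errors below [e] still leave a distance of at least [e]. *)
pose e := `|f x0 - synth x0| / 4.
have e0 : 0 < e by rewrite divr_gt0 ?normr_gt0.
have [r0 r00 hr] := inv_fourier_close e0.
have [d1 d10 hd1] := synth_continuous x0 e0.
have /cvgrPdist_lt/(_ _ e0)/nbhs_ballP [d2 /= d20 hd2] := cf x0.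
pose d := Num.min d1 d2 / 2.
have d0 : 0 < d by rewrite divr_gt0// lt_min d10.
have dd : d < d1 /\ d < d2.
  by split; rewrite /d ltr_pdivrMr//; [have := ge_min d1 d1 d2|have := ge_min d2 d1 d2];
    rewrite lexx ?orbT => /= h; lra.
have B k r : r0 <= r -> cube x0 d k -> e <= `|f (vec3 k) - inv_fourier_re a b r (vec3 k)|.
  move=> rr kB; have kn := cube_near d0 kB.
  have h1 := hr _ (vec3 k) rr.
  have h2 := hd1 (vec3 k) (le_lt_trans kn dd.1).
  have h3 : `|f x0 - f (vec3 k)| < e.
    apply: hd2; rewrite -ball_normE /= distrC; exact: le_lt_trans kn dd.2.
  have h4 : `|f x0 - synth x0| = 4 * e by rewrite /e; lra.
  move: h1 h2 h3 h4; set p := f x0; set q := synth x0; set p' := f _; set q' := synth _.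
  set z := inv_fourier_re _ _ _ _ => h1 h2 h3 h4.
  have : `|p - q| <= `|p - p'| + `|p' - z| + `|q' - z| + `|q' - q|.
    rewrite (_ : p - q = (p - p') + (p' - z) + (- (q' - z)) + (q' - q)); last ring.
    rewrite -(normrN (q' - z)).
    by do 2! (apply: (le_trans (ler_normD _ _)); rewrite lerD2r); exact: ler_normD.
  lra.
pose c : \bar R := (((e `^ 2)%:E * mu3 (cube x0 d)) `^ 2^-1)%E.
have c0 : (0 < c)%E.
  by rewrite poweR_gt0// measure_cube// -EFinM lte_fin mulr_gt0 ?powR_gt0// exprn_gt0// mulr_gt0.
have : \forall r \near +oo, ('N[mu3]_2%:E[(fun x => (f (vec3 x) - inv_fourier_re a b r (vec3 x))%:E)] < c)%E.
  apply: (H [set y | (y < c)%E]); apply: open_nbhs_nbhs; split => //.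
  exact: open_ereal_lt_ereal.
move=> near_c; near (pinfty_nbhs R) => r.
have rr : r0 <= r by near: r; apply: nbhs_pinfty_ge; rewrite num_real.
have : ('N[mu3]_2%:E[(fun x => (f (vec3 x) - inv_fourier_re a b r (vec3 x))%:E)] < c)%E by near: r.
rewrite ltNge => /negP; apply.
apply: (@Lnorm2_ge (cube x0 d) (fun k => f (vec3 k) - inv_fourier_re a b r (vec3 k)) e).
- exact: measurable_cube.
- exact: ltW.
- by move=> k kB; exact: B.
Unshelve. all: by end_near. Qed.

End fourier.

Section sobolev_embedding.
Variable R : realType.

(** The norm is an infimum, so the strict bound by [c] produces one transform whose weighted norm is
    below [c]. The constant $(6\pi+1)K$ covers the bounds on the function and on its differential at
    once. *)
Lemma sobolev_embedding (m : R) : 5 / 2 < m -> exists2 C : R, 0 < C &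
  forall (f : 'rV[R]_3 -> R) (c : R), continuous f -> (sobolev_norm m f < c%:E)%E ->
  exists D : 'rV[R]_3 -> 'rV[R]_3 -> R,
  [/\ forall x y z, D x (y + z) = D x y + D x z,
      forall x (s : R) y, D x (s *: y) = s * D x y,
      forall x y, `|D x y| <= C * c * `|y|,
      forall x, `|f x| <= C * c &
      forall e, 0 < e -> exists2 d, 0 < d &
        forall x y, `|y| < d -> `|f (x + y) - f x - D x y| <= e * `|y|].
Proof.
move=> m52; have [K K0 hK] := integral_fourier_le m52.
exists ((6 * pi + 1) * K); first by rewrite mulr_gt0// addr_gt0// mulr_gt0// pi_gt0.
move=> f c cf /ereal_inf_lt [_ [a [b [[[ma _] [mb _] fa _] ->]]] Nc].
have H := hK (modulus a b) (measurable_modulus ma mb) (modulus_ge0 a b).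
have b0 k : 0 <= bracket k `^ (m / 2) * modulus a b k :> R.
  by rewrite mulr_ge0 ?powR_ge0 ?modulus_ge0.
have {}H : (\int[leb3 R]_k (weighted a b k)%:E <= (K * c)%:E)%E.
  by apply: (le_trans H); rewrite EFinM lee_wpmul2l ?lee_fin ?(ltW K0)// ltW.
have Hy := le_lt_trans H (ltry _).
have M0 : mass a b <= K * c.
  rewrite -lee_fin fineK// ge0_fin_numE// integral_ge0// => k _.
  by rewrite lee_fin weighted_ge0.
have M1 := mass_ge0 a b; have P1 : 0 <= pi :> R := pi_ge0 R.
have E := fourier_inversion ma mb Hy cf fa.
exists (dsynth a b); split.
- by move=> x y z; exact: dsynthD.
- by move=> x s y; exact: dsynthZ.
- move=> x y; have [_ h] := dsynth_int ma mb Hy x y; apply: (le_trans h).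
  by rewrite ler_wpM2r//; nra.
- move=> x; have [_ h] := synth_int ma mb Hy x; rewrite E; apply: (le_trans h).
  by nra.
- by move=> e e0; rewrite E; exact: synth_diff.
Qed.
End sobolev_embedding.

(** * Velocity gradients of Sobolev solutions *)

Section frechet.
Variable R : realType.

Lemma rV_sum_delta n (y : 'rV[R]_n) : y = \sum_i y 0 i *: 'e_i.
Proof. by rewrite {1}(matrix_sum_delta y) big_ord1. Qed.

Lemma mulmx_norm_le (y : 'rV[R]_3) (A : 'M[R]_3) c : 0 <= c ->
  (forall i j, `|A i j| <= c) -> `|y *m A| <= 3 * c * `|y|.
Proof.
move=> c0 Ac; apply: rV_norm_le => [|i]; first by rewrite !mulr_ge0.
rewrite mxE (le_trans (ler_norm_sum _ _ _))//.
have -> : 3 * c * `|y| = \sum_(j < 3) c * `|y|.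
  by rewrite sumr_const card_ord -mulr_natl; ring.
by apply: ler_sum => j _; rewrite normrM mulrC ler_pM ?rV_coord_le.
Qed.

Lemma mulmxr_continuous (A : 'M[R]_3) : continuous (mulmxr A : 'rV[R]_3 -> 'rV[R]_3).
Proof.
pose c := \sum_i \sum_j `|A i j|.
have c0 : 0 <= c by do 2 apply: sumr_ge0 => ? _.
have Ac i j : `|A i j| <= c.
  rewrite /c (bigD1 i)//= (bigD1 j)//= -addrA lerDl addr_ge0//.
    by apply: sumr_ge0.
  by do 2 apply: sumr_ge0 => ? _.
apply: bounded_linear_continuous; rewrite /bounded_near; near=> M.
apply/nbhs_ballP; exists 1 => //= y; rewrite -ball_normE /= sub0r normrN => y1.
apply: (le_trans (mulmx_norm_le _ c0 Ac)).
apply: (@le_trans _ _ (3 * c)); first by rewrite ler_piMr ?mulr_ge0// ltW.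
by near: M; apply: nbhs_pinfty_ge; rewrite num_real.
Unshelve. all: by end_near. Qed.

(** The hypothesis is the little-o expansion in epsilon form, and a continuous linear map with such
    a remainder is the differential. *)
Lemma jacobianP (u : 'rV[R]_3 -> 'rV[R]_3) x (A : 'M[R]_3) :
  (forall e, 0 < e -> exists2 d, 0 < d &
    forall y, `|y| < d -> `|u (x + y) - u x - y *m A| <= e * `|y|) ->
  differentiable u x /\ 'J u x = A.
Proof.
move=> h.
have E : u \o shift x = cst (u x) + mulmxr A +o_ (0 : 'rV[R]_3) id.
  apply/eqaddoP => _/posnumP[e]; apply/nbhs_ballP.
  have [d d0 hd] := h e%:num [elaborate gt0 e].
  exists d => //= y; rewrite -ball_normE /= sub0r normrN => /hd.
  by rewrite -[(_ - _) y]/(u (y + x) - (u x + y *m A)) opprD addrA [y + x]addrC.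
have D := diff_unique (@mulmxr_continuous A) E.
split.
  apply/diff_locallyP; rewrite D; split; first exact: mulmxr_continuous.
  exact: E.
by rewrite /jacobian; apply/row_matrixP => i; rewrite !rowE mul_rV_lin1 D.
Qed.

Lemma jacobian_coord (u : 'rV[R]_3 -> 'rV[R]_3) x i j : differentiable u x ->
  is_derive x ('e_i : 'rV[R]_3) (fun z => u z 0 j) ('J u x i j).
Proof.
move=> du.
(* The coordinate projection is packaged as a linear map so that the chain rule for differentials
   applies. *)
have @f : {linear 'rV[R]_3 -> R}.
  by exists (fun N : 'rV[R]_3 => N 0 j); do 2![eexists]; do ?[constructor];
     rewrite ?mxE// => ? *; rewrite ?mxE//; move=> ?; rewrite !mxE.
have cf : continuous f by exact: coord_continuous.
have df : differentiable f (u x) by exact: linear_differentiable.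
rewrite (_ : (fun z => u z 0 j) = f \o u)//.
have dc : differentiable (f \o u) x by exact: differentiable_comp.
apply: DeriveDef; first exact: diff_derivable.
have E := diff_lin (u x) cf.
rewrite deriveE// (diff_comp du df) [LHS]/= -[LHS]/(('d f (u x) : 'rV[R]_3 -> R) ('d u x 'e_i)) E.
by rewrite /jacobian mxE.
Qed.

Lemma frechet_derive (f : 'rV[R]_3 -> R) x (D : 'rV[R]_3 -> R) y :
  (forall s y, D (s *: y) = s * D y) ->
  (forall e, 0 < e -> exists2 d, 0 < d &
    forall y, `|y| < d -> `|f (x + y) - f x - D y| <= e * `|y|) ->
  is_derive x y f (D y).
Proof.
move=> DZ h.
have H : h^-1 *: ((f \o shift x) (h *: y) - f x) @[h --> 0^'] --> D y.
  apply/cvgrPdist_le => e e0.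
  have y1 : 0 < `|y| + 1 by rewrite ltr_wpDl.
  have [d d0 hd] := h (e / (`|y| + 1)) (divr_gt0 e0 y1).
  apply/nbhs_ballP; exists (d / (`|y| + 1)); first by rewrite /= divr_gt0.
  move=> s; rewrite -ball_normE /= sub0r normrN => sd sn0.
  have s0 : 0 < `|s| by rewrite normr_gt0.
  have sy : `|s *: y| < d.
    rewrite normrZ; move: sd; rewrite ltr_pdivlMr//; apply: le_lt_trans.
    by rewrite ler_wpM2l// lerDl.
  have := hd _ sy; rewrite DZ normrZ => h1.
  rewrite -[D y](mulKf sn0) -[s^-1 *: _]/(s^-1 * _) -mulrBr normrM normfV.
  rewrite ler_pdivrMl// distrC [s *: y + x]addrC; apply: (le_trans h1).
  rewrite mulrCA ler_wpM2l// -mulrA ler_piMr//; first exact: ltW.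
  by rewrite ler_pdivrMl// mulr1 lerDl.
apply: DeriveDef; first by apply/cvg_ex; exists (D y).
exact: cvg_lim H.
Qed.

Lemma rV_subE n (a b : 'rV[R]_n) j : (a - b) 0 j = a 0 j - b 0 j.
Proof. by rewrite !mxE. Qed.

Lemma scaled_delta_mulmx s i j (A : 'M[R]_3) : ((s *: 'e_i : 'rV[R]_3) *m A) 0 j = s * A i j.
Proof. by rewrite -scalemxAl mxE -rowE mxE. Qed.

Lemma rV_sub_le n (a b : 'rV[R]_n) e : `|a - b| <= e -> forall j, `|a 0 j - b 0 j| <= e.
Proof. by move=> h j; rewrite -rV_subE; exact: le_trans (rV_coord_le _ _) h. Qed.

Lemma rV_difference_le (a b : 'rV[R]_3) s i (A : 'M[R]_3) e :
  `|a - b - (s *: 'e_i : 'rV[R]_3) *m A| <= e ->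
  forall j, `|a 0 j - b 0 j - s * A i j| <= e.
Proof.
move=> h j; rewrite -scaled_delta_mulmx -!rV_subE.
exact: le_trans (rV_coord_le _ _) h.
Qed.

(** Here [p], [p'] are the values of a function at the two ends of a step [s] from one point, [q],
    [q'] those from another point, and [a], [b] the derivatives there. The four errors of size
    $es/8$ add up to $es/2$. *)
Lemma difference_quotients (s e a b p q p' q' : R) : 0 < s -> 0 < e ->
  `|p' - p - s * a| <= e / 8 * s -> `|q' - q - s * b| <= e / 8 * s ->
  `|q - p| <= e * s / 8 -> `|q' - p'| <= e * s / 8 -> `|b - a| < e.
Proof.
move=> s0 e0; rewrite !ler_norml => /andP[? ?] /andP[? ?] /andP[? ?] /andP[? ?].
have es : 0 < e * s by rewrite mulr_gt0.
rewrite ltr_norml -(ltr_pM2l s0) -(ltr_pM2l s0 _ e); apply/andP; split; lra.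
Qed.

Lemma row_delta_norm (i : 'I_3) : `|'e_i : 'rV[R]_3| = 1.
Proof.
apply/eqP; rewrite eq_le; apply/andP; split.
  by apply: rV_norm_le => // j; rewrite mxE; case: (_ && _); rewrite ?normr1 ?normr0.
by have := rV_coord_le ('e_i : 'rV[R]_3) i; rewrite mxE !eqxx normr1.
Qed.
End frechet.

Lemma sobolev_norm_ge0 (R : realType) (s : R) (f : 'rV[R]_3 -> R) :
  (0 <= sobolev_norm s f)%E.
Proof. by apply: le_ereal_inf_tmp => _ [a [b [_ ->]]]; exact: Lnorm_ge0. Qed.

Section sobolev_fields.
Variables (R : realType) (m : R) (T : \bar R) (v : R -> 'rV[R]_3 -> 'rV[R]_3).
Hypothesis m52 : 5 / 2 < m.
Hypothesis vS : continuous_in_sobolev m T v.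
Hypothesis cv : forall t, lifespan T t -> continuous (v t).

Lemma coord_cont (u : 'rV[R]_3 -> 'rV[R]_3) i : continuous u -> continuous (fun x => u x 0 i).
Proof.
by move=> cu x; apply: (@continuous_comp _ _ _ u (fun M : 'rV[R]_3 => M 0 i)); [exact: cu|exact: coord_continuous].
Qed.

Lemma sobolev_jacobian t : lifespan T t -> exists M : R, exists A : 'rV[R]_3 -> 'M[R]_3,
 [/\ forall x i, `|v t x 0 i| <= M, forall x i j, `|A x i j| <= M &
  forall e, 0 < e -> exists2 d, 0 < d &
    forall x y, `|y| < d -> `|v t (x + y) - v t x - y *m A x| <= e * `|y|].
Proof.
move=> Tt; have [C C0 hC] := sobolev_embedding m52.
have H i : exists c D, [/\ forall x y z, D x (y + z) = D x y + D x z,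
      forall x (s : R) y, D x (s *: y) = s * D x y,
      forall x y, `|D x y| <= C * c * `|y|,
      forall x, `|v t x 0 i| <= C * c &
      forall e, 0 < e -> exists2 d, 0 < d &
        forall x y, `|y| < d -> `|v t (x + y) 0 i - v t x 0 i - D x y| <= e * `|y|].
  have [_ si] := vS.1 t Tt i.
  have sf : sobolev_norm m (fun x => v t x 0 i) \is a fin_num.
    rewrite ge0_fin_numE//; exact: sobolev_norm_ge0.
  exists (fine (sobolev_norm m (fun x => v t x 0 i)) + 1).
  apply: hC; first by apply: coord_cont; exact: cv.
  by rewrite EFinD fineK// lteDl// lte_fin.
have /choice[c /choice[D hD]] := H.
pose M := \sum_i `|C * c i|.
have cM i : C * c i <= M.
  by rewrite (le_trans (ler_norm _))// /M (bigD1 i)//= lerDl sumr_ge0.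
exists M, (fun x => \matrix_(i, j) D j x 'e_i).
have DE x y j : D j x y = (y *m \matrix_(i, j) D j x 'e_i) 0 j.
  have [Da Ds _ _ _] := hD j.
  rewrite [in LHS](rV_sum_delta y) mxE !big_ord_recl !big_ord0 !addr0 !Da !Ds.
  by rewrite !mxE.
split.
- by move=> x i; have [_ _ _ h _] := hD i; exact: le_trans (h x) (cM i).
- move=> x i j; rewrite mxE; have [_ _ h _ _] := hD j.
  by apply: (le_trans (h x _)); rewrite row_delta_norm mulr1.
- move=> e e0.
  have h i : exists2 d, 0 < d & forall x y, `|y| < d ->
      `|v t (x + y) 0 i - v t x 0 i - D i x y| <= e * `|y|.
    by have [_ _ _ _ h] := hD i; exact: h.
  have [d0 d00 h0] := h 0; have [d1 d10 h1] := h 1; have [d2 d20 h2] := h 2.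
  exists (Num.min d0 (Num.min d1 d2)); first by rewrite !lt_min d00 d10.
  move=> x y; rewrite !lt_min => /and3P[y0 y1 y2].
  apply: rV_norm_le; first by rewrite mulr_ge0// ltW.
  by apply: ord3P; rewrite 4!mxE -DE; [exact: h0|exact: h1|exact: h2].
Qed.

Lemma sobolev_differentiable t x : lifespan T t -> differentiable (v t) x.
Proof.
move=> Tt; have [M [A [_ _ h]]] := sobolev_jacobian Tt.
have [] // := @jacobianP _ (v t) x (A x) _.
by move=> e /h[d d0 hd]; exists d => // y yd; exact: hd.
Qed.

Lemma sobolev_bounded t : lifespan T t -> exists2 M : R, 0 <= M &
  (forall x i, `|v t x 0 i| <= M) /\ (forall x i j, `|('J (v t) x) i j| <= M).
Proof.
move=> Tt; have [M [A [h1 h2 h]]] := sobolev_jacobian Tt.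
exists M; first exact: le_trans (h1 0 0).
split=> // x i j; have [] := @jacobianP _ (v t) x (A x) _; last by move=> _ ->.
by move=> e /h[d d0 hd]; exists d => // y yd; exact: hd.
Qed.

Lemma sobolev_uniform_diff t : lifespan T t -> forall e, 0 < e -> exists2 d, 0 < d &
  forall x y, `|y| < d -> `|v t (x + y) - v t x - y *m 'J (v t) x| <= e * `|y|.
Proof.
move=> Tt; have [M [A [_ _ h]]] := sobolev_jacobian Tt.
move=> e e0; have [d d0 hd] := h e e0; exists d => // x y yd.
have [] := @jacobianP _ (v t) x (A x) _; last by move=> _ ->; exact: hd.
by move=> e' /h[d' d'0 hd']; exists d' => // z zd; exact: hd'.
Qed.

Lemma cont_eps (u : 'rV[R]_3 -> 'rV[R]_3) x e : continuous u -> 0 < e ->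
  exists2 d, 0 < d & forall y, `|y - x| < d -> `|u y - u x| < e.
Proof.
move=> cu e0.
have h i : exists2 d, 0 < d & forall y, `|y - x| < d -> `|u y 0 i - u x 0 i| < e / 2.
  have e20 : 0 < e / 2 by rewrite divr_gt0.
  have /cvgrPdist_lt/(_ _ e20)/nbhs_ballP[d /= d0 hd] := @coord_cont u i cu x.
  exists d => // y yd; rewrite distrC; apply: hd.
  by rewrite -ball_normE /= distrC.
have [d0 d00 h0] := h 0; have [d1 d10 h1] := h 1; have [d2 d20 h2] := h 2.
exists (Num.min d0 (Num.min d1 d2)); first by rewrite !lt_min d00 d10.
move=> y; rewrite !lt_min => /and3P[y0 y1 y2].
apply: (@le_lt_trans _ _ (e / 2)); last by rewrite ltr_pdivrMr//; lra.
apply: rV_norm_le; first by rewrite ltW// divr_gt0.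
by apply: ord3P; rewrite 2!mxE ltW//; [exact: h0|exact: h1|exact: h2].
Qed.

(** Uniform differentiability allows the same step [s] in the difference quotients at [x] and at
    [y], and those quotients are close because [v t] is continuous. No second derivative is
    involved. *)
Lemma sobolev_jacobian_continuous t x e : lifespan T t -> 0 < e ->
  exists2 d, 0 < d & forall y, `|y - x| < d ->
    forall i j, `|('J (v t) y) i j - ('J (v t) x) i j| < e.
Proof.
move=> Tt e0; have e4 : 0 < e / 8 by rewrite divr_gt0.
have [r r0 hr] := sobolev_uniform_diff Tt e4.
pose s := r / 2; have s0 : 0 < s by rewrite divr_gt0.
have es : 0 < e * s / 8 by rewrite divr_gt0// mulr_gt0.
have [d1 d10 h1] := cont_eps x (cv Tt) es.
have h' i : exists2 d, 0 < d & forall y, `|y - x| < d ->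
    `|v t (y + s *: 'e_i) - v t (x + s *: 'e_i)| < e * s / 8.
  have [d d0 hd] := cont_eps (x + s *: 'e_i) (cv Tt) es.
  by exists d => // y yd; apply: hd; rewrite opprD addrACA subrr addr0.
have [d2 d20 h2] := h' 0; have [d3 d30 h3] := h' 1; have [d4 d40 h4] := h' 2.
exists (Num.min d1 (Num.min d2 (Num.min d3 d4))); first by rewrite !lt_min d10 d20 d30.
move=> y; rewrite !lt_min => /and4P[y1 y2 y3 y4] i j.
have k1 : `|v t (y + s *: 'e_i) - v t (x + s *: 'e_i)| < e * s / 8.
  by move: i {j}; apply: ord3P; [exact: h2|exact: h3|exact: h4].
have sr : `|s *: 'e_i : 'rV[R]_3| < r.
  rewrite normrZ row_delta_norm mulr1 gtr0_norm// /s ltr_pdivrMr//; lra.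
have k2 := hr x _ sr; have k3 := hr y _ sr; have k4 := h1 y y1.
rewrite normrZ row_delta_norm mulr1 (gtr0_norm s0) in k2 k3.
exact: (difference_quotients s0 e0 (rV_difference_le k2 j) (rV_difference_le k3 j)
  (rV_sub_le (ltW k4) j) (rV_sub_le (ltW k1) j)).
Qed.

(** The embedding applied to the difference of the fields at two times: a Sobolev norm below [e / C]
    makes the difference and its gradient at most [e], uniformly in space. *)
Lemma sobolev_time_continuous t e : lifespan T t -> 0 < e ->
  exists2 d, 0 < d & forall t', lifespan T t' -> `|t' - t| < d -> forall x i,
    `|v t' x 0 i - v t x 0 i| <= e /\
    forall j, `|('J (v t') x) j i - ('J (v t) x) j i| <= e.
Proof.
move=> Tt e0; have [C C0 hC] := sobolev_embedding m52.
pose c := e / C; have c0 : 0 < c by rewrite divr_gt0.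
have cE : C * c = e by rewrite /c mulrC divfK// gt_eqF.
have H i : exists2 d, 0 < d & forall t', lifespan T t' -> `|t' - t| < d -> forall x,
    `|v t' x 0 i - v t x 0 i| <= e /\
    forall j, `|('J (v t') x) j i - ('J (v t) x) j i| <= e.
  have nb : nbhs (0%E : \bar R) [set y | (y < c%:E)%E].
    by apply: open_nbhs_nbhs; split; [exact: open_ereal_lt_ereal|rewrite /= lte_fin].
  have /nbhs_ballP[d /= d0 hd] := vS.2 t Tt i _ nb.
  exists d => // t' Tt' t'd x.
  have sn : (sobolev_norm m (fun x : 'rV[R]_3 => v t' x 0 i - v t x 0 i)%R < c%:E)%E.
    by apply: hd => //; rewrite -ball_normE /= distrC.
  have cf : continuous (fun x : 'rV[R]_3 => v t' x 0 i - v t x 0 i).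
    have ca := @coord_cont (v t') i (cv Tt'); have cb := @coord_cont (v t) i (cv Tt).
    by move=> z; apply: (@cvgB _ R^o _ _ _ _ _ _ _ (ca z) (cb z)).
  have [D [Da Ds Db fb hD]] := hC _ _ cf sn.
  rewrite cE in Db fb; split=> [|j]; first exact: fb.
  (* One partial derivative of the difference is evaluated in two ways, through the Jacobians and
     through the differential [D] of the embedding. *)
  have [_ <-] : is_derive x ('e_j : 'rV[R]_3) (fun x : 'rV[R]_3 => v t' x 0 i - v t x 0 i)
      ('J (v t') x j i - 'J (v t) x j i).
    apply: is_deriveB; apply: jacobian_coord; exact: sobolev_differentiable.
  have hx e' : 0 < e' -> exists2 d, 0 < d & forall y : 'rV[R]_3, `|y| < d ->
    `|(v t' (x + y) 0 i - v t (x + y) 0 i) - (v t' x 0 i - v t x 0 i) - D x y| <= e' * `|y|.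
    by move=> /hD [d' d'0 h]; exists d' => // y; exact: h.
  have [_ ->] := @frechet_derive _ (fun x : 'rV[R]_3 => v t' x 0 i - v t x 0 i) x (D x) 'e_j (Ds x) hx.
  by rewrite (le_trans (Db _ _))// row_delta_norm mulr1.
have [d0 d00 h0] := H 0; have [d1 d10 h1] := H 1; have [d2 d20 h2] := H 2.
exists (Num.min d0 (Num.min d1 d2)); first by rewrite !lt_min d00 d10.
move=> t' Tt'; rewrite !lt_min => /and3P[y0 y1 y2] x.
by apply: ord3P; [exact: h0|exact: h1|exact: h2].
Qed.

End sobolev_fields.

(** * Particle paths *)

Section primitive.
Variable R : realType.
Notation mu := (@lebesgue_measure R).
Implicit Types (f g : R -> R) (a b s K x : R).

Lemma is_derive_add f g x (a b : R) : is_derive x (1 : R) f a -> is_derive x (1 : R) g b ->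
  is_derive x (1 : R) (fun y => f y + g y) (a + b).
Proof. by move=> fa gb; exact: is_deriveD. Qed.

Lemma is_derive_sub f g x (a b : R) : is_derive x (1 : R) f a -> is_derive x (1 : R) g b ->
  is_derive x (1 : R) (fun y => f y - g y) (a - b).
Proof. by move=> fa gb; exact: is_deriveB. Qed.

Lemma is_derive_scale (c : R) f x (a : R) : is_derive x (1 : R) f a ->
  is_derive x (1 : R) (fun y => c * f y) (c * a).
Proof. by move=> fa; exact: is_deriveZ. Qed.

Lemma derive_ge0_le f (df : R -> R) a b : a <= b ->
  (forall x, a < x < b -> is_derive x (1 : R) f (df x)) ->
  {within `[a, b], continuous f} -> (forall x, a < x < b -> 0 <= df x) -> f a <= f b.
Proof.
rewrite le_eqVlt => /predU1P[->//|ab] h cf df0.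
have h' x : x \in `]a, b[ -> is_derive x (1 : R) f (df x) by rewrite in_itv; exact: h.
have [c] := MVT ab h' cf.
rewrite in_itv /= => /df0 c0 E.
by rewrite -subr_ge0 E mulr_ge0// subr_ge0 ltW.
Qed.

(** For negative [s] the interval is empty, so this primitive is 0 there instead of changing
    sign. *)
Definition prim f (s : R) : R := \int[mu]_(x in `[0, s]) f x.

Lemma cont_itv_integrable f a b : continuous f -> mu.-integrable `[a, b] (EFin \o f).
Proof.
move=> cf; apply: continuous_compact_integrable; first exact: segment_compact.
exact: continuous_subspaceT.
Qed.

Lemma prim_derive f s : continuous f -> 0 < s -> is_derive s (1 : R) (prim f) (f s).
Proof.
move=> cf s0.
have s1 : s < s + 1 by rewrite ltrDl.
have [h1 h2] := @continuous_FTC1_closed _ f 0 s (s + 1) s1 (cont_itv_integrable _ _ cf) s0 (cf s).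
by apply: DeriveDef => //; rewrite -derive1E.
Qed.

Lemma prim_le0 f s : s <= 0 -> prim f s = 0.
Proof.
rewrite /prim le_eqVlt => /predU1P[->|s0]; first by rewrite set_itv1 Rintegral_set1.
by rewrite set_itv_ge ?Rintegral_set0// bnd_simp -ltNge.
Qed.

Lemma integral_itv_le f a b K : continuous f -> a <= b ->
  (forall x, a <= x <= b -> `|f x| <= K) -> `|\int[mu]_(x in `[a, b]) f x| <= K * (b - a).
Proof.
move=> cf ab h.
have -> : K * (b - a) = \int[mu]_(x in `[a, b]) K.
  have E : lebesgue_measure `[a, b]%classic = (b - a)%:E.
    rewrite lebesgue_measure_itv /= lte_fin; case: ltP => [//|ba].
    by rewrite (_ : b = a) ?subrr//; apply/eqP; rewrite eq_le ab ba.
  rewrite Rintegral_cst; last exact: measurable_itv.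
  by congr (_ * _); rewrite -[b - a]/(fine (b - a)%:E) -E.
have ci := cont_itv_integrable a b cf.
apply: (le_trans (le_normr_Rintegral _ ci)) => //.
apply: le_Rintegral => //.
- apply: cont_itv_integrable => x; apply: (@continuous_comp _ _ _ f (@Num.norm _ R)); [exact: cf|exact: norm_continuous].
- by apply: cont_itv_integrable => x; exact: cvg_cst.
Qed.

Lemma prim_lip f K s s' : continuous f -> (forall x, `|f x| <= K) ->
  `|prim f s - prim f s'| <= K * `|s - s'|.
Proof.
move=> cf fK.
have K0 : 0 <= K := le_trans (normr_ge0 _) (fK 0).
wlog ss : s s' / s' <= s.
  move=> H; have [/H//|/ltW/H] := leP s' s.
  by rewrite distrC [`|s' - s|]distrC.
have [s0|s0] := leP s 0.
  by rewrite !prim_le0// ?subrr ?normr0 ?mulr_ge0//; exact: le_trans s0.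
have [s'0|s'0] := leP s' 0.
  rewrite (prim_le0 _ s'0) subr0.
  have := @integral_itv_le f 0 s K cf (ltW s0) (fun x _ => fK x).
  rewrite -/(prim f s) subr0 => h; apply: (le_trans h).
  rewrite ler_wpM2l// ger0_norm ?subr_ge0//; lra.
have e1 : (BLeft 0 <= BRight s' :> itv_bound R)%O by rewrite bnd_simp ltW.
have e2 : (BRight s' <= BRight s :> itv_bound R)%O by rewrite bnd_simp.
rewrite /prim (@Rintegral_itvB _ f (BLeft 0) (BRight s) s') //; last exact: cont_itv_integrable.
rewrite Rintegral_itv_obnd_cbnd; last first.
  apply: integrableS (cont_itv_integrable s' s cf) => //.
  by apply: subset_itvr; rewrite bnd_simp.
by rewrite [`|s - s'|]ger0_norm ?subr_ge0//; apply: integral_itv_le => // x _; exact: fK.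
Qed.

Lemma lipschitz_continuous f K : (forall s s', `|f s - f s'| <= K * `|s - s'|) -> continuous f.
Proof.
move=> h s; apply/cvgrPdist_lt => e e0; apply/nbhs_ballP.
have K1 : 0 < `|K| + 1 by rewrite ltr_wpDl.
exists (e / (`|K| + 1)); first by rewrite /= divr_gt0.
move=> s'; rewrite /= ltr_pdivlMr// => h1.
apply: (le_lt_trans (h s s')); apply: le_lt_trans h1.
rewrite mulrC ler_wpM2l//; have := ler_norm K; lra.
Qed.

Lemma is_derive_expM (k x : R) :
  is_derive x (1 : R) (fun r => expR (k * r)) (k * expR (k * x)).
Proof.
have h : is_derive x (1 : R) (fun r : R => k * r) k.
  rewrite (_ : (fun r : R => k * r) = k *: id)//.
  by apply: is_derive_eq; rewrite /GRing.scale /= mulr1.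
rewrite mulrC; exact: (@is_derive1_comp R expR (fun r => k * r)).
Qed.

Lemma primB f g s : continuous f -> continuous g ->
  prim f s - prim g s = prim (fun x => f x - g x) s.
Proof. by move=> cf cg; rewrite /prim RintegralB//; exact: cont_itv_integrable. Qed.

(** The intervals with centre [u n] and half-width $2A/2^n$ are nested, so the supremum of their
    left ends lies in all of them; this gives the limit together with its rate. *)
Lemma geometric_limit (u : nat -> R) A : (forall n, `|u n.+1 - u n| <= A / 2 ^+ n) ->
  exists l, forall n, `|l - u n| <= 2 * A / 2 ^+ n.
Proof.
move=> h.
have p0 n : 0 < 2 ^+ n :> R by rewrite exprn_gt0.
pose a n := u n + 2 * A / 2 ^+ n; pose b n := u n - 2 * A / 2 ^+ n.
have A0 : 0 <= A.
  by have := le_trans (normr_ge0 _) (h 0); rewrite expr0 divr1.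
have half n : 2 * A / 2 ^+ n.+1 = A / 2 ^+ n.
  by rewrite exprS; field; rewrite gt_eqF.
have da n : 2 * A / 2 ^+ n = A / 2 ^+ n + A / 2 ^+ n by ring.
have aS n : a n.+1 <= a n.
  by rewrite /a half da; have := h n; rewrite ler_norml => /andP[? ?]; lra.
have bS n : b n <= b n.+1.
  by rewrite /b half da; have := h n; rewrite ler_norml => /andP[? ?]; lra.
have am i j : (i <= j)%N -> a j <= a i.
  by move=> /subnK <-; elim: (j - i)%N => // k; rewrite addSn; exact: le_trans (aS _).
have bm i j : (i <= j)%N -> b i <= b j.
  move=> /subnK <-; elim: (j - i)%N => // k IH; rewrite addSn; exact: le_trans IH (bS _).
have ba n : b n <= a n by rewrite /a /b lerBlDr -addrA lerDl addr_ge0// divr_ge0 ?mulr_ge0// ltW.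
have bak i j : b i <= a j.
  have [ij|/ltnW ij] := leqP i j; first exact: le_trans (bm _ _ ij) (ba _).
  exact: le_trans (ba _) (am _ _ ij).
exists (sup (range b)) => n.
have hs : has_sup (range b).
  by split; [exists (b 0%N), 0%N|exists (a n) => _ [k _ <-]].
have h1 : b n <= sup (range b) by apply: ub_le_sup; [exact: hs.2|exists n].
have h2 : sup (range b) <= a n.
  by apply: ge_sup; [exact: hs.1|move=> _ [k _ <-]].
by rewrite ler_norml; move: h1 h2; rewrite /a /b; lra.
Qed.

Lemma le_geometric (a b c : R) : (forall n, a <= b + c / 2 ^+ n) -> a <= b.
Proof.
move=> h; rewrite leNgt; apply/negP => ba.
have d0 : 0 < a - b by rewrite subr_gt0.
have [n hn] : exists n, c / (a - b) < 2 ^+ n.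
  exists (Num.bound `|c / (a - b)|); apply: (le_lt_trans (ler_norm _)).
  apply: (lt_le_trans (archi_boundP (normr_ge0 _))).
  by rewrite -natrX ler_nat ltnW// ltn_expl.
have := h n; rewrite leNgt => /negP; apply.
rewrite -ltrBrDl ltr_pdivrMr ?exprn_gt0//.
by move: hn; rewrite ltr_pdivrMr// mulrC.
Qed.
End primitive.

(** * Global solutions of ordinary differential equations *)

Section picard.
Variables (R : realType) (F : R -> 'rV[R]_3 -> 'rV[R]_3) (B L : R).
Hypothesis L1 : 1 <= L.
Hypothesis FB : forall s x i, `|F s x 0 i| <= B.
Hypothesis FL : forall s x y i, `|F s x 0 i - F s y 0 i| <= L * `|x - y|.
Hypothesis Fc : forall s x e, 0 < e -> exists2 d, 0 < d &
  forall s' x', `|s' - s| < d -> `|x' - x| < d -> forall i, `|F s' x' 0 i - F s x 0 i| < e.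
Variable x0 : 'rV[R]_3.

Definition lipschitz_path (X : R -> 'rV[R]_3) := forall s s', `|X s - X s'| <= B * `|s - s'|.

Let B0 : 0 <= B. Proof. exact: le_trans (normr_ge0 _) (FB 0 0 0). Qed.

Lemma path_continuous X i : lipschitz_path X -> continuous (fun s => F s (X s) 0 i).
Proof.
move=> hX s; apply/cvgrPdist_lt => e e0; have [d d0 hd] := Fc s (X s) e0.
apply/nbhs_ballP; exists (Num.min d (d / (B + 1))).
  by rewrite /= lt_min d0 divr_gt0//; have := B0; lra.
move=> s'; rewrite /= lt_min => /andP[s1 s2].
rewrite distrC; apply: hd; first by rewrite distrC.
rewrite distrC; apply: le_lt_trans (hX _ _) _.
move: s2; rewrite ltr_pdivlMr; last by have := B0; lra.
by apply: le_lt_trans; rewrite mulrC ler_wpM2l//; lra.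
Qed.

(** Since [prim] vanishes at negative times, every iterate equals [x0] there, and only positive
    times carry the equation. *)
Definition picard_step (X : R -> 'rV[R]_3) (s : R) : 'rV[R]_3 :=
  \row_i (x0 0 i + prim (fun r => F r (X r) 0 i) s).

Lemma picard_step_lip X : lipschitz_path X -> lipschitz_path (picard_step X).
Proof.
move=> hX s s'; apply: rV_norm_le => [|i]; first by rewrite mulr_ge0// B0.
rewrite !mxE opprD addrACA subrr add0r; apply: prim_lip; last by move=> r; exact: FB.
exact: path_continuous.
Qed.

Definition picard n := iter n picard_step (fun=> x0).

Lemma picard_lip n : lipschitz_path (picard n).
Proof.
elim: n => [s s'|n IH]; last exact: picard_step_lip.
by rewrite /= subrr normr0 mulr_ge0// B0.
Qed.

(* The exponential weight in which one Picard step contracts by 2, so that the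
   iteration converges on the whole line. *)
Let w (s : R) := B * expR (2 * L * `|s|).

Lemma picard_dist n s : `|picard n.+1 s - picard n s| <= w s / 2 ^+ n.
Proof.
have L0 : 0 <= L := le_trans ler01 L1.
elim: n s => [|n IH] s.
  rewrite expr0 divr1; apply: rV_norm_le => [|i]; first by rewrite mulr_ge0 ?B0 ?expR_ge0.
  rewrite /= !mxE addrC addKr.
  have h := @prim_lip _ (fun r => F r x0 0 i) B s 0.
  rewrite (prim_le0 _ (lexx 0)) !subr0 in h.
  apply: (le_trans (h _ _)).
  - have hc : lipschitz_path (fun=> x0) := picard_lip 0.
    exact: (path_continuous hc).
  - by move=> r; exact: FB.
  - rewrite /w ler_wpM2l ?B0//; apply: le_trans (expR_ge1Dx _).
    have s0 := normr_ge0 s; have L10 : 0 <= L - 1 by rewrite subr_ge0.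
    have := mulr_ge0 L10 s0; lra.
have [s0|s0] := leP s 0.
  rewrite (_ : picard n.+2 s - picard n.+1 s = 0); last first.
    by apply/rowP => i; rewrite /= !mxE !prim_le0// subrr.
  by rewrite normr0 divr_ge0 ?exprn_ge0// mulr_ge0 ?B0 ?expR_ge0.
have P0 : 0 < 2 ^+ n :> R by rewrite exprn_gt0.
apply: rV_norm_le => [|i]; first by rewrite divr_ge0 ?exprn_ge0// mulr_ge0 ?B0 ?expR_ge0.
rewrite [picard n.+2]/(picard_step _) [picard n.+1]/(picard_step _) 2![in leLHS]mxE.
rewrite !mxE opprD addrACA subrr add0r.
set f := fun r => F r (picard n.+1 r) 0 i; set g := fun r => F r (picard n r) 0 i.
have cf : continuous f by exact: path_continuous (picard_lip n.+1).
have cg : continuous g by exact: path_continuous (picard_lip n).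
(* [H] is the bound claimed for the next distance. Differentiating the exponential brings out $2L$,
   so [dH] is exactly [L] times the previous bound, and comparing derivatives closes the
   induction. *)
pose H (r : R) := B / 2 ^+ n.+1 * expR (2 * L * r).
pose dH (r : R) := L * B / 2 ^+ n * expR (2 * L * r).
have Hd (r : R) : is_derive r (1 : R) H (dH r).
  rewrite (_ : H = (B / 2 ^+ n.+1) *: (fun r => expR (2 * L * r)))//.
  have hx := is_derive_expM (2 * L) r.
  apply: is_derive_eq; rewrite /dH /GRing.scale /= exprS; field.
  by rewrite gt_eqF.
have fg r : 0 < r -> `|f r - g r| <= dH r.
  move=> r0; apply: (le_trans (FL _ _ _ _)).
  have := IH r; rewrite /w (gtr0_norm r0) => h.
  by rewrite /dH (_ : L * B / _ * _ = L * (B * expR (2 * L * r) / 2 ^+ n)); [rewrite ler_wpM2l|ring].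
have cp h : continuous h -> (forall r, `|h r| <= B) -> continuous (prim h).
  by move=> ch hB; apply: (@lipschitz_continuous R _ B) => r r'; exact: prim_lip.
have cP : continuous (prim f) by apply: cp => // r; exact: FB.
have cQ : continuous (prim g) by apply: cp => // r; exact: FB.
have cH : continuous H.
  by move=> r; have [+ _] := Hd r; move/derivable1_diffP/differentiable_continuous.
have H0 : 0 <= H 0 by rewrite /H !mulr_ge0 ?invr_ge0 ?exprn_ge0 ?B0 ?expR_ge0.
have -> : w s / 2 ^+ n.+1 = H s by rewrite /w /H gtr0_norm//; ring.
have D (r : R) : 0 < r -> is_derive r (1 : R) (prim f) (f r) by exact: prim_derive.
have D' (r : R) : 0 < r -> is_derive r (1 : R) (prim g) (g r) by exact: prim_derive.
have h1 : H 0 - (prim f 0 - prim g 0) <= H s - (prim f s - prim g s).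
  apply: (@derive_ge0_le R (fun r => H r - (prim f r - prim g r))
    (fun r => dH r - (f r - g r)) 0 s (ltW s0)).
  - by move=> x /andP[xx _]; apply: is_derive_sub (Hd x) (is_derive_sub (D x xx) (D' x xx)).
  - apply: continuous_subspaceT => x.
    exact: (@cvgB _ R^o _ _ _ _ _ _ _ (cH x) (@cvgB _ R^o _ _ _ _ _ _ _ (cP x) (cQ x))).
  - by move=> x /andP[xx _]; have := fg x xx; rewrite ler_norml => /andP[_]; rewrite subr_ge0.
have h2 : H 0 + (prim f 0 - prim g 0) <= H s + (prim f s - prim g s).
  apply: (@derive_ge0_le R (fun r => H r + (prim f r - prim g r))
    (fun r => dH r + (f r - g r)) 0 s (ltW s0)).
  - by move=> x /andP[xx _]; apply: is_derive_add (Hd x) (is_derive_sub (D x xx) (D' x xx)).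
  - apply: continuous_subspaceT => x.
    exact: (@cvgD _ R^o _ _ _ _ _ _ _ (cH x) (@cvgB _ R^o _ _ _ _ _ _ _ (cP x) (cQ x))).
  - by move=> x /andP[xx _]; have := fg x xx; rewrite ler_norml => /andP[+ _]; lra.
move: h1 h2; rewrite (prim_le0 f (lexx 0)) (prim_le0 g (lexx 0)) subrr subr0 addr0.
by rewrite ler_norml; lra.
Qed.

Lemma picard_solution : exists X : R -> 'rV[R]_3,
  [/\ X 0 = x0, lipschitz_path X &
   forall (s : R) i, 0 < s -> is_derive s (1 : R) (fun r => X r 0 i) (F s (X s) 0 i)].
Proof.
have L0 : 0 <= L := le_trans ler01 L1.
have w0 s : 0 <= w s by rewrite mulr_ge0 ?B0 ?expR_ge0.
have H (si : R * 'I_3) : exists l, forall n, `|l - picard n si.1 0 si.2| <= 2 * w si.1 / 2 ^+ n.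
  apply: (@geometric_limit R (fun n => picard n si.1 0 si.2) (w si.1)) => n.
  by rewrite -rV_subE; exact: le_trans (rV_coord_le _ _) (picard_dist n si.1).
have [l hl] := choice H.
pose X s : 'rV[R]_3 := \row_i l (s, i).
have Xn n s : `|X s - picard n s| <= 2 * w s / 2 ^+ n.
  apply: rV_norm_le => [|i]; first by rewrite divr_ge0 ?exprn_ge0// mulr_ge0.
  by rewrite rV_subE mxE; exact: (hl (s, i)).
have XL : lipschitz_path X.
  move=> s s'; apply: (@le_geometric _ _ _ (2 * w s + 2 * w s')) => n.
  rewrite (_ : X s - X s' = (X s - picard n s) + (picard n s - picard n s') - (X s' - picard n s')); last first.
    by apply/rowP => i; rewrite !mxE; ring.
  have := Xn n s; have := Xn n s'; have := picard_lip n s s'.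
  set a := _ - _; set b := _ - _; set c := _ - _ => h1 h2 h3.
  apply: (le_trans (ler_normB _ _)); apply: (le_trans (lerD (ler_normD _ _) (lexx _))).
  rewrite mulrDl; lra.
(* The limit satisfies the integral equation up to an error of order $2^{-n}$, because on $[0,s]$
   the exponential weight is at most [w s]; letting $n$ grow removes the error. *)
have eqX s i : 0 <= s -> X s 0 i = x0 0 i + prim (fun r => F r (X r) 0 i) s.
  move=> s0; apply/eqP; rewrite -subr_eq0 -normr_le0.
  apply: (@le_geometric _ _ _ (2 * w s + 2 * L * w s * s)) => n.
  have cf : continuous (fun r => F r (picard n r) 0 i) by exact: path_continuous (picard_lip n).
  have cX : continuous (fun r => F r (X r) 0 i) by exact: path_continuous XL.
  have h1 : `|prim (fun r => F r (picard n r) 0 i) s - prim (fun r => F r (X r) 0 i) s| <= 2 * L * w s / 2 ^+ n * s.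
    rewrite primB// /prim -[X in _ * X]subr0; apply: integral_itv_le => //.
      by move=> r; exact: cvgB (cf r) (cX r).
    move=> r /andP[r0 rs]; apply: (le_trans (FL _ _ _ _)).
    rewrite (_ : 2 * L * w s / 2 ^+ n = L * (2 * w s / 2 ^+ n)); last ring.
    rewrite ler_wpM2l// distrC; apply: (le_trans (Xn n r)).
    rewrite ler_wpM2r ?invr_ge0 ?exprn_ge0// ler_wpM2l// /w ler_wpM2l ?B0// ler_expR.
    by rewrite !ger0_norm// ler_wpM2l// mulr_ge0.
  have h2 := rV_coord_le (X s - picard n.+1 s) i.
  have {}h2 := le_trans h2 (Xn n.+1 s).
  rewrite rV_subE [picard n.+1]/(picard_step _) [picard_step _ _ _ _]mxE in h2.
  move: h1 h2; rewrite !ler_norml exprS invfM.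
  move: (prim _ s) (prim _ s) (X s 0 i) (x0 0 i) (w0 s) => p q xs x00 ws.
  have n0 : 0 <= (2 ^+ n)^-1 :> R by rewrite invr_ge0 exprn_ge0.
  have := mulr_ge0 ws n0.
  rewrite mulrDl; move: ((2 ^+ n)^-1) => u.
  move=> wu /andP[? ?] /andP[? ?]; apply/andP; split; lra.
exists X; split=> //.
  by apply/rowP => i; rewrite eqX// prim_le0// addr0.
move=> s i s0.
have cX : continuous (fun r => F r (X r) 0 i) by exact: path_continuous XL.
have h := prim_derive cX s0.
apply: (@near_eq_is_derive _ _ _ (fun r => x0 0 i + prim (fun r => F r (X r) 0 i) r)) => //.
- apply/nbhs_ballP; exists s => //= r sr.
  have {}sr : `|s - r| < s by exact: sr.
  by rewrite eqX//; move: sr; rewrite ltr_norml; lra.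
- by have := is_derive_add (is_derive_cst (x0 0 i) s 1) h; rewrite add0r.
Qed.
End picard.

(** * Vorticity equation *)

Section local_calculus.
Variable R : realType.
Implicit Types (f : R -> R) (c x y l : R).

Lemma MVT_local f (df : R -> R) c r y : (forall x, `|x - c| < r -> is_derive x (1 : R) f (df x)) ->
  `|y - c| < r -> exists2 z, `|z - c| < r & f y - f c = df z * (y - c).
Proof.
move=> h yr.
have cf a b : `|a - c| < r -> `|b - c| < r -> {within `[a, b], continuous f}.
  move=> ar br; apply: continuous_in_subspaceT => z; rewrite inE /= in_itv /= => /andP[az zb].
  have [|+ _] := h z; first by move: ar br; rewrite !ltr_norml; lra.
  by move/derivable1_diffP/differentiable_continuous.
have cr : `|c - c| < r by rewrite subrr normr0 (le_lt_trans (normr_ge0 _) yr).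
have [yc|yc|->] := ltgtP y c; last by exists c => //; rewrite !subrr mulr0.
- have h' x : x \in `]y, c[ -> is_derive x (1 : R) f (df x).
    by rewrite in_itv /= => /andP[? ?]; apply: h; move: yr; rewrite !ltr_norml; lra.
  have [z] := MVT yc h' (cf _ _ yr cr); rewrite in_itv /= => /andP[? ?] E.
  by exists z; [move: yr; rewrite !ltr_norml; lra|lra].
- have h' x : x \in `]c, y[ -> is_derive x (1 : R) f (df x).
    by rewrite in_itv /= => /andP[? ?]; apply: h; move: yr; rewrite !ltr_norml; lra.
  have [z] := MVT yc h' (cf _ _ cr yr); rewrite in_itv /= => /andP[? ?] E.
  by exists z; [move: yr; rewrite !ltr_norml; lra|lra].
Qed.

Lemma is_derive_epsP f x l : is_derive x (1 : R) f l <->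
  (forall e, 0 < e -> exists2 d, 0 < d & forall y, `|y - x| < d ->
    `|f y - f x - l * (y - x)| <= e * `|y - x|).
Proof.
split=> [[df E] e e0|h].
  have : h^-1 *: ((f \o shift x) (h *: 1) - f x) @[h --> 0^'] --> l by rewrite -E; exact: df.
  move=> /cvgrPdist_le/(_ _ e0)/nbhs_ballP[d /= d0 hd]; exists d => // y yx.
  have [->|yn] := eqVneq y x; first by rewrite !subrr mulr0 subrr normr0 mulr0.
  have yn0 : y - x != 0 by rewrite subr_eq0.
  have yb : ball (0 : R) d (y - x) by rewrite /ball /= sub0r normrN.
  have := hd (y - x) yb yn0; rewrite scaler1 subrK -[_ *: _]/(_ * _) => h.
  rewrite -ler_pdivrMr ?normr_gt0// -normf_div.
  rewrite (_ : _ / _ = - (l - (y - x)^-1 * (f y - f x))) ?normrN//.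
  by field.
have H : h^-1 *: ((f \o shift x) (h *: 1) - f x) @[h --> 0^'] --> l.
  apply/cvgrPdist_le => e e0; have [d d0 hd] := h e e0.
  apply/nbhs_ballP; exists d => // k kd kn.
  have {}kd : `|0 - k| < d := kd; rewrite sub0r normrN in kd.
  have := hd (k + x); rewrite addrK => /(_ kd) h1.
  rewrite /= scaler1 /GRing.scale /=.
  have k0 : 0 < `|k| by rewrite normr_gt0.
  rewrite -(ler_pM2r k0) -normrM.
  rewrite (_ : (l - _) * k = - (f (k + x) - f x - l * k)) ?normrN//.
  by field.
apply: DeriveDef; first by apply/cvg_ex; exists l.
exact: cvg_lim H.
Qed.

Lemma is_derive_line (p : 'rV[R]_3 -> R) (a d : 'rV[R]_3) (t l : R) :
  is_derive (a + t *: d) d p l -> is_derive t (1 : R) (fun s => p (a + s *: d)) l.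
Proof.
move=> [h1 h2].
have E : (fun h : R => h^-1 *: (((fun s => p (a + s *: d)) \o shift t) (h *: 1) - p (a + t *: d))) =
  (fun h : R => h^-1 *: ((p \o shift (a + t *: d)) (h *: d) - p (a + t *: d))).
  apply/funext => h /=; congr (_ *: (p _ - _)).
  by rewrite scaler1 scalerDl addrCA.
by apply: DeriveDef; rewrite /derivable /derive E.
Qed.

Definition cont_eps_field (w : 'rV[R]_3 -> 'rV[R]_3) := forall (x : 'rV[R]_3) e, 0 < e ->
  exists2 d, 0 < d & forall y : 'rV[R]_3, `|y - x| < d -> `|w y - w x| < e.

Lemma continuous_line w (a d : 'rV[R]_3) k : cont_eps_field w ->
  continuous (fun t : R => w (a + t *: d) 0 k).
Proof.
move=> cw t; apply/cvgrPdist_lt => e e0; have [r r0 hr] := cw (a + t *: d) e e0.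
have d1 : 0 < `|d| + 1 by rewrite ltr_wpDl.
apply/nbhs_ballP; exists (r / (`|d| + 1)); first by rewrite /= divr_gt0.
move=> s ts; have {}ts : `|t - s| < r / (`|d| + 1) := ts.
rewrite distrC -rV_subE; apply: (le_lt_trans (rV_coord_le _ _)); apply: hr.
rewrite opprD addrACA subrr add0r -scalerBl normrZ distrC.
move: ts; rewrite ltr_pdivlMr//; apply: le_lt_trans.
by rewrite ler_wpM2l// lerDl.
Qed.
End local_calculus.

(** * Circulation around small squares *)

Section circulation.
Variables (R : realType) (i j : 'I_3).
Notation mu := (@lebesgue_measure R).
Implicit Types (w : 'rV[R]_3 -> 'rV[R]_3) (h : R).

(** Tangential components on the four sides, each parametrised by $[0,1]$: opposite sides are
    subtracted, in component [j] for the sides along ['e_j] and in component [i] for those along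
    ['e_i]. The length [h] of the tangent vectors is left out. *)
Definition loop w h (t : R) : R :=
  (w (h *: 'e_i + t *: (h *: 'e_j)) 0 j - w (0 + t *: (h *: 'e_j)) 0 j) -
  (w (h *: 'e_j + t *: (h *: 'e_i)) 0 i - w (0 + t *: (h *: 'e_i)) 0 i).

(* The circulation around the square with sides [h 'e_i], [h 'e_j], divided by [h]. *)
Definition circ w h : R := \int[mu]_(t in `[0, 1]) loop w h t.

Lemma loop_continuous w h : cont_eps_field w -> continuous (loop w h).
Proof.
move=> cw t.
have c a d k := @continuous_line _ w a d k cw t.
exact: (@cvgB _ R^o _ _ _ _ _ _ _ (@cvgB _ R^o _ _ _ _ _ _ _ (c _ _ _) (c _ _ _))
  (@cvgB _ R^o _ _ _ _ _ _ _ (c _ _ _) (c _ _ _))).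
Qed.

Lemma circD w1 w2 h : cont_eps_field w1 -> cont_eps_field w2 ->
  circ (fun y => w1 y + w2 y) h = circ w1 h + circ w2 h.
Proof.
move=> c1 c2; rewrite /circ -RintegralD//; last 2 first.
- by apply: cont_itv_integrable; exact: loop_continuous.
- by apply: cont_itv_integrable; exact: loop_continuous.
by apply: eq_Rintegral => t _; rewrite /loop !mxE; ring.
Qed.

(** For the affine field $w_0+yM$ everything cancels between opposite sides except
    $h(M_{ij}-M_{ji})$. Each of the four sides contributes an error of at most [K]; its points have
    norm at most $2h$ by the triangle inequality. *)
Lemma circ_approx w (w0 : 'rV[R]_3) (M : 'M[R]_3) h K : cont_eps_field w -> 0 < h ->
  (forall y, `|y| <= 2 * h -> `|w y - w0 - y *m M| <= K) ->
  `|circ w h - h * (M i j - M j i)| <= 4 * K.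
Proof.
move=> cw h0 hK.
have cl := loop_continuous (h := h) cw.
have E : circ w h - h * (M i j - M j i) =
    \int[mu]_(t in `[0, 1]) (loop w h t - h * (M i j - M j i)).
  rewrite /circ RintegralB//; last 2 first.
  - exact: cont_itv_integrable.
  - by apply: cont_itv_integrable => x; exact: cvg_cst.
  congr (_ - _); rewrite Rintegral_cst; last exact: measurable_itv.
  have E1 : lebesgue_measure `[0 : R, 1 : R]%classic = (1 : R)%:E.
    by rewrite lebesgue_measure_itv /= lte_fin ltr01 sube0.
  transitivity (h * (M i j - M j i) * 1); first by rewrite mulr1.
  by congr (_ * _); exact: (esym (congr1 fine E1)).
rewrite E (_ : 4 * K = 4 * K * (1 - 0)); last by rewrite subr0 mulr1.
apply: integral_itv_le => //.
  move=> t; exact: (@cvgB _ R^o _ _ _ _ _ _ _ (cl t) (cvg_cst _)).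
move=> t /andP[t0 t1].
have n1 k l : `|h *: 'e_k + t *: (h *: 'e_l) : 'rV[R]_3| <= 2 * h.
  apply: (le_trans (ler_normD _ _)); rewrite !normrZ !row_delta_norm !mulr1.
  rewrite !ger0_norm//; [nra|exact: ltW..].
have n2 l : `|0 + t *: (h *: 'e_l) : 'rV[R]_3| <= 2 * h.
  by rewrite add0r !normrZ !row_delta_norm !mulr1 !ger0_norm//; [nra|exact: ltW..].
have C k y : `|y| <= 2 * h -> `|w y 0 k - w0 0 k - (y *m M) 0 k| <= K.
  by move=> /hK hy; rewrite -!rV_subE; exact: le_trans (rV_coord_le _ _) hy.
have L (s r : R) k l n : ((s *: 'e_k + r *: (s *: 'e_l) : 'rV[R]_3) *m M) 0 n = s * M k n + r * s * M l n.
  by rewrite mulmxDl [LHS]mxE scaled_delta_mulmx scalerA scaled_delta_mulmx.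
have L0 (s r : R) l n : ((0 + r *: (s *: 'e_l) : 'rV[R]_3) *m M) 0 n = r * s * M l n.
  by rewrite add0r scalerA scaled_delta_mulmx.
have := C j _ (n1 i j); have := C j _ (n2 j); have := C i _ (n1 j i); have := C i _ (n2 i).
rewrite !L !L0 /loop.
move: (w _ 0 _) (w _ 0 _) (w _ 0 _) (w _ 0 _) => q1 q2 q3 q4.
move: (w0 0 i) (w0 0 j) (M i i) (M i j) (M j i) (M j j) => ? ? ? ? ? ?.
rewrite !ler_norml => /andP[? ?] /andP[? ?] /andP[? ?] /andP[? ?].
by apply/andP; split; lra.
Qed.

Lemma cont_eps_translate w (a : 'rV[R]_3) : cont_eps_field w -> cont_eps_field (fun y => w (a + y)).
Proof.
move=> cw x e e0; have [d d0 hd] := cw (a + x) e e0.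
by exists d => // y yx; apply: hd; rewrite opprD addrACA subrr add0r.
Qed.

(** On each side the integrand is, up to the factor [h], the derivative of [p] along that side, so
    its integral is a difference of values at two corners, and the corners cancel. Only first
    derivatives of [p] occur. *)
Lemma circ_grad (p : 'rV[R]_3 -> R) (a : 'rV[R]_3) h : h != 0 ->
  (forall x, differentiable p x) -> cont_eps_field (grad p) ->
  circ (fun y => grad p (a + y)) h = 0.
Proof.
move=> hn dp cg.
have cga := @cont_eps_translate (grad p) a cg.
have F c l : \int[mu]_(t in `[0, 1]) (h * grad p (a + (c + t *: (h *: 'e_l))) 0 l) =
    p (a + (c + h *: 'e_l)) - p (a + c).
  pose P (t : R) := p (a + c + t *: (h *: 'e_l)).
  have dP t : is_derive t (1 : R) P (h * grad p (a + (c + t *: (h *: 'e_l))) 0 l).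
    apply: is_derive_line; rewrite addrA; apply: DeriveDef; first exact: diff_derivable.
    by rewrite deriveE// linearZ /= mxE deriveE.
  have cP : continuous P.
    by move=> t; have [+ _] := dP t; move/derivable1_diffP/differentiable_continuous.
  have cd : continuous (fun t : R => h * grad p (a + (c + t *: (h *: 'e_l))) 0 l).
    by move=> t; apply: (@cvgMr _ R^o); exact: (@continuous_line _ (fun y => grad p (a + y)) c (h *: 'e_l) l cga t).
  rewrite /Rintegral (@continuous_FTC2 _ _ P 0 1 ltr01).
  - by rewrite /= /P scale1r scale0r addr0 addrA.
  - exact: continuous_subspaceT.
  - split.
    + by move=> t _; have [] := dP t.
    + by apply: cvg_at_right_filter; exact: cP.
    + by apply: cvg_at_left_filter; exact: cP.
  - by move=> t _; rewrite derive1E; have [_ ->] := dP t.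
have G c l : \int[mu]_(t in `[0, 1]) (grad p (a + (c + t *: (h *: 'e_l))) 0 l) =
    (p (a + (c + h *: 'e_l)) - p (a + c)) / h.
  rewrite -F RintegralZl//; first by field.
  apply: cont_itv_integrable => t.
  exact: (@continuous_line _ (fun y => grad p (a + y)) c (h *: 'e_l) l cga t).
have I c l : mu.-integrable `[0 : R, 1 : R] (EFin \o (fun t : R => grad p (a + (c + t *: (h *: 'e_l))) 0 l)).
  apply: cont_itv_integrable => t.
  exact: (@continuous_line _ (fun y => grad p (a + y)) c (h *: 'e_l) l cga t).
rewrite /circ /loop.
have J c c' l : mu.-integrable `[0 : R, 1 : R] (EFin \o (fun t : R =>
    grad p (a + (c + t *: (h *: 'e_l))) 0 l - grad p (a + (c' + t *: (h *: 'e_l))) 0 l)).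
  by apply: (integrableB _ (I c l) (I c' l)); exact: measurable_itv.
rewrite RintegralB//.
rewrite !RintegralB// !G !add0r addr0 [h *: 'e_j + _]addrC; ring.
Qed.

(** Differentiation under the integral sign, dominated by the constant $4K$: one [K] for each
    side. *)
Lemma circ_derive (V E : R -> 'rV[R]_3 -> 'rV[R]_3) h K (s0 d : R) : 0 < h ->
  (forall s, `|s - s0| < d -> cont_eps_field (V s)) ->
  (forall s, `|s - s0| < d -> forall y k,
    is_derive s (1 : R) (fun s => V s y 0 k) (E s y 0 k)) ->
  (forall s y k, `|s - s0| < d -> `|y| <= 2 * h -> `|E s y 0 k| <= K) ->
  forall s, `|s - s0| < d -> is_derive s (1 : R) (fun s => circ (V s) h) (circ (E s) h).
Proof.
move=> h0 cV dV EK s sd.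
have n1 k l (t : R) : 0 <= t <= 1 -> `|h *: 'e_k + t *: (h *: 'e_l) : 'rV[R]_3| <= 2 * h.
  move=> /andP[t0 t1].
  apply: (le_trans (ler_normD _ _)); rewrite !normrZ !row_delta_norm !mulr1.
  rewrite !ger0_norm//; [nra|exact: ltW..].
have n2 l (t : R) : 0 <= t <= 1 -> `|0 + t *: (h *: 'e_l) : 'rV[R]_3| <= 2 * h.
  move=> /andP[t0 t1].
  by rewrite add0r !normrZ !row_delta_norm !mulr1 !ger0_norm//; [nra|exact: ltW..].
pose f s t := loop (V s) h t.
have I (x : R) : `]s0 - d, s0 + d[%classic x -> `|x - s0| < d.
  by rewrite /= in_itv /= ltr_norml => /andP[? ?]; lra.
have sI : `]s0 - d, s0 + d[%classic s.
  by move: sd; rewrite /= in_itv /= ltr_norml => /andP[? ?]; lra.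
have intf x : `]s0 - d, s0 + d[%classic x -> mu.-integrable `[0, 1] (EFin \o f x).
  by move=> /I xd; apply: cont_itv_integrable; apply: loop_continuous; exact: cV.
have df x t : `|x - s0| < d -> is_derive x (1 : R) (f ^~ t) (loop (E x) h t).
  move=> xd; apply: is_derive_sub; apply: is_derive_sub; exact: dV.
have der x t : `]s0 - d, s0 + d[%classic x -> `[0, 1]%classic t -> derivable (f ^~ t) x 1.
  by move=> /I xd _; have [] := df x t xd.
have K0 : 0 <= K.
  by apply: le_trans (EK s 0 0 sd _); rewrite ?normr_ge0// normr0 mulr_ge0// ltW.
have iG : mu.-integrable `[0, 1] (EFin \o (cst (4 * K) : R -> R)).
  by apply: cont_itv_integrable => x; exact: cvg_cst.
have G_ub x t : `]s0 - d, s0 + d[%classic x -> `[0, 1]%classic t ->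
    `|partial1of2 f x t| <= (cst (4 * K) : R -> R) t.
  move=> /I xd; rewrite /= in_itv /= => t01.
  rewrite partial1of2E; have [_ ->] := df x t xd; rewrite /loop.
  apply: (le_trans (ler_normB _ _)); apply: (le_trans (lerD (ler_normB _ _) (ler_normB _ _))).
  have := EK x _ j xd (n1 i j t t01); have := EK x _ j xd (n2 j t t01).
  have := EK x _ i xd (n1 j i t t01); have := EK x _ i xd (n2 i t t01); lra.
have G0 (t : R) : 0 <= (cst (4 * K) : R -> R) t by rewrite /= mulr_ge0.
have m01 : measurable (`[0, 1]%classic : set (measurableTypeR R)) by exact: measurable_itv.
apply: DeriveDef.
  exact: (@derivable_under_integral R _ _ mu f _ m01 s _ _ sI intf der _ G0 iG G_ub).
rewrite -derive1E (@differentiation_under_integral R _ _ mu f _ m01 s _ _ sI intf der _ G0 iG G_ub).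
by apply: eq_Rintegral => t _; rewrite partial1of2E; have [_ ->] := df s t sd.
Qed.
End circulation.

(** * Joint continuity in time and space, and a chain rule along a path *)

Section joint_continuity.
Variable R : realType.
Implicit Types (f g : R -> 'rV[R]_3 -> R) (s : R) (x : 'rV[R]_3).

Definition jcts f s x := {for (s, x), continuous (fun z : R * 'rV[R]_3 => f z.1 z.2)}.

Lemma jctsP f s x : jcts f s x <-> (forall e, 0 < e -> exists2 d, 0 < d &
  forall s' (x' : 'rV[R]_3), `|s' - s| < d -> `|x' - x| < d -> `|f s' x' - f s x| < e).
Proof.
split=> [h e e0|h].
  have /cvgrPdist_lt/(_ _ e0)/nbhs_ballP[d /= d0 hd] := h.
  exists d => // s' x' sd xd.
  have := hd (s', x'); rewrite /= distrC; apply; split; first by rewrite /ball /= distrC.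
  by rewrite -ball_normE /= distrC.
apply/cvgrPdist_lt => e e0; have [d d0 hd] := h e e0.
exists (ball s d, ball x d) => /=; first by split; exact: nbhsx_ballx.
move=> [s' x'] [/= sd xd].
rewrite distrC; apply: hd; first by rewrite distrC.
by move: xd; rewrite -ball_normE /= distrC.
Qed.

Lemma jctsD f g s x : jcts f s x -> jcts g s x -> jcts (fun s x => f s x + g s x) s x.
Proof. by move=> hf hg; exact: (@cvgD _ R^o _ _ _ _ _ _ _ hf hg). Qed.

Lemma jctsN f s x : jcts f s x -> jcts (fun s x => - f s x) s x.
Proof. by move=> hf; exact: (@cvgN _ R^o _ _ _ _ _ hf). Qed.

Lemma jctsM f g s x : jcts f s x -> jcts g s x -> jcts (fun s x => f s x * g s x) s x.
Proof. by move=> hf hg; exact: (cvgM hf hg). Qed.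

Lemma rV_oppE n (u : 'rV[R]_n) k : (- u) 0 k = - u 0 k.
Proof. by rewrite mxE. Qed.

Lemma mx_oppE n p (M : 'M[R]_(n, p)) k l : (- M) k l = - M k l.
Proof. by rewrite mxE. Qed.

Lemma mulmx3E (u : 'rV[R]_3) (M : 'M[R]_3) k :
  (u *m M) 0 k = u 0 0 * M 0 k + u 0 1 * M 1 k + u 0 2 * M 2 k.
Proof.
rewrite mxE !big_ord_recr big_ord0 /= add0r.
by congr (_ + _ + _); congr (u 0 _ * M _ _); apply/val_inj.
Qed.

Lemma jcts_mulmx (u : R -> 'rV[R]_3 -> 'rV[R]_3) (M : R -> 'rV[R]_3 -> 'M[R]_3) s x k :
  (forall l, jcts (fun s x => u s x 0 l) s x) -> (forall l n, jcts (fun s x => M s x l n) s x) ->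
  jcts (fun s x => (u s x *m M s x) 0 k) s x.
Proof.
move=> hu hM.
rewrite (_ : (fun s x => _) = (fun s x => u s x 0 0 * M s x 0 k + u s x 0 1 * M s x 1 k + u s x 0 2 * M s x 2 k)).
  by do 2?[apply: jctsD]; apply: jctsM.
by apply/funext => s'; apply/funext => x'; rewrite mulmx3E.
Qed.

(** The increment is split into a time increment at the moved point, a space increment at the fixed
    time [s], and the increment of [l] along the path. The first is why the time expansion must hold
    uniformly in [z]. Dividing by $B+1$ in the second absorbs the Lipschitz constant of the path, so
    that each error is at most $(e/3)|s'-s|$. *)
Lemma transport_chain (V : R -> 'rV[R]_3 -> R) (Z : R -> 'rV[R]_3) (zeta a : 'rV[R]_3)
    (l : 'rV[R]_3 -> R) (q B s r : R) : 0 <= B -> 0 < r ->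
  (forall c u w, l (c *: u + w) = c * l u + l w) ->
  (forall e, 0 < e -> exists2 d, 0 < d & forall s' z, `|s' - s| < d -> `|z - a| < d ->
    `|V s' z - V s z - q * (s' - s)| <= e * `|s' - s|) ->
  (forall e, 0 < e -> exists2 d, 0 < d & forall z, `|z - a| < d ->
    `|V s z - V s a - l (z - a)| <= e * `|z - a|) ->
  Z s = a -> (forall s', `|Z s' - Z s| <= B * `|s' - s|) ->
  (forall k, is_derive s (1 : R) (fun s => Z s 0 k) (zeta 0 k)) ->
  is_derive s (1 : R) (fun s => V s (Z s)) (q + l zeta).
Proof.
move=> B0 r0 ll h1 h2 Zs ZL Zd.
have l0 : l 0 = 0 by have := ll 1 0 0; rewrite scale1r addr0 mul1r => h; lra.
have lD u w : l (u + w) = l u + l w by rewrite -[u]scale1r ll scale1r mul1r.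
have lZ c u : l (c *: u) = c * l u by rewrite -[c *: u]addr0 ll l0 addr0.
have lE (u : 'rV[R]_3) : l u = u 0 0 * l 'e_0 + u 0 1 * l 'e_1 + u 0 2 * l 'e_2.
  rewrite [in LHS](rV_sum_delta u) !big_ord_recr big_ord0 /= add0r !lD !lZ.
  by congr (u 0 _ * l 'e_ _ + u 0 _ * l 'e_ _ + u 0 _ * l 'e_ _); apply/val_inj.
have dl : is_derive s (1 : R) (fun s => l (Z s)) (l zeta).
  rewrite (_ : (fun s => _) = (fun s => l 'e_0 * Z s 0 0 + l 'e_1 * Z s 0 1 + l 'e_2 * Z s 0 2)); last first.
    by apply/funext => s'; rewrite lE; ring.
  rewrite (_ : l zeta = l 'e_0 * zeta 0 0 + l 'e_1 * zeta 0 1 + l 'e_2 * zeta 0 2); last by rewrite lE; ring.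
  have D k := is_derive_scale (l 'e_k) (Zd k).
  exact: (is_derive_add (is_derive_add (D 0) (D 1)) (D 2)).
apply/is_derive_epsP => e e0.
have e3 : 0 < e / 3 by rewrite divr_gt0.
have eB : 0 < e / (3 * (B + 1)) by rewrite divr_gt0// mulr_gt0//; lra.
have [d1 d10 H1] := h1 _ e3.
have [d2 d20 H2] := h2 _ eB.
have [d3 d30 H3] := (is_derive_epsP _ _ _).1 dl _ e3.
exists (Num.min (Num.min d1 d3) (Num.min (d1 / (B + 1)) (d2 / (B + 1)))).
  by rewrite !lt_min d10 d30 !divr_gt0//; lra.
move=> s'; rewrite !lt_min !ltr_pdivlMr; [|lra..].
move=> /andP[/andP[k1 k3] /andP[k4 k5]].
have Zd' : `|Z s' - a| <= `|s' - s| * (B + 1).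
  by rewrite -Zs (le_trans (ZL s'))// mulrC ler_wpM2l//; lra.
have := H1 s' (Z s') k1 (le_lt_trans Zd' k4).
have := H2 (Z s') (le_lt_trans Zd' k5).
have := H3 s' k3.
have -> : l (Z s' - a) = l (Z s') - l (Z s).
  by rewrite -Zs lD -scaleN1r lZ mulN1r.
rewrite Zs; move: (l zeta) (l (Z s')) (l a) => p1 p2 p3.
have : e / (3 * (B + 1)) * `|Z s' - a| <= e / 3 * `|s' - s|.
  apply: (le_trans (ler_wpM2l (ltW eB) Zd')); rewrite le_eqVlt; apply/orP; left; apply/eqP.
  by field; lra.
move: (V s' (Z s')) (V s (Z s')) (V s a) (e / (3 * (B + 1)) * `|Z s' - a|) => w1 w2 w3 w4 hw.
rewrite !ler_norml => /andP[? ?] /andP[? ?] /andP[? ?]; apply/andP; split; lra.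
Qed.
End joint_continuity.

Lemma ord3_radius (R : realType) (P : 'I_3 -> R -> Prop) :
  (forall k d d', P k d -> d' <= d -> P k d') ->
  (forall k, exists2 d, 0 < d & P k d) -> exists2 d, 0 < d & forall k, P k d.
Proof.
move=> mono H; have [d0 d00 h0] := H 0; have [d1 d10 h1] := H 1; have [d2 d20 h2] := H 2.
exists (Num.min d0 (Num.min d1 d2)); first by rewrite !lt_min d00 d10.
by apply: ord3P; [apply: mono h0 _|apply: mono h1 _|apply: mono h2 _];
  rewrite !ge_min lexx ?orbT.
Qed.

(** * The vorticity equation from the circulation of a rigidly moving square *)

Section vorticity_transport.
Variables (R : realType) (v g : R -> 'rV[R]_3 -> 'rV[R]_3) (A : R -> 'rV[R]_3 -> 'M[R]_3).
Variables (X : R -> 'rV[R]_3) (s0 r B : R).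
Implicit Types (s : R) (x y z : 'rV[R]_3) (h : R).
Hypothesis r0 : 0 < r.
Hypothesis B0 : 0 <= B.
Hypothesis dv : forall s x d k, `|s - s0| < r ->
  is_derive x d (fun z => v s z 0 k) ((d *m A s x) 0 k).
Hypothesis dfv : forall s x k, `|s - s0| < r -> forall e, 0 < e -> exists2 d, 0 < d &
  forall z, `|z - x| < d -> `|v s z 0 k - v s x 0 k - ((z - x) *m A s x) 0 k| <= e * `|z - x|.
Hypothesis jv : forall s x k, `|s - s0| < r -> jcts (fun s x => v s x 0 k) s x.
Hypothesis jA : forall s x k l, `|s - s0| < r -> jcts (fun s x => A s x k l) s x.
Hypothesis jg : forall s x k, `|s - s0| < r -> jcts (fun s x => g s x 0 k) s x.
Hypothesis dt : forall s x k, `|s - s0| < r ->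
  is_derive s (1 : R) (fun s => v s x 0 k) (- g s x 0 k - (v s x *m A s x) 0 k).
Hypothesis dX : forall s k, `|s - s0| < r ->
  is_derive s (1 : R) (fun s => X s 0 k) (v s (X s) 0 k).
Hypothesis XL : forall s s', `|X s - X s'| <= B * `|s - s'|.
Variables i j : 'I_3.
Hypothesis gcirc : forall s h, `|s - s0| < r -> 0 < h ->
  circ i j (fun y => g s (X s + y)) h = 0.

(* Euler's equation makes this the time derivative of the velocity at the point
   [X s + y], which moves rigidly with [X]. *)
Definition material s y : 'rV[R]_3 :=
  - g s (X s + y) - (v s (X s + y) - v s (X s)) *m A s (X s + y).

Lemma within_radius s d : `|s - s0| < r -> 0 < d -> exists2 d', 0 < d' & d' <= d /\
  forall s', `|s' - s| < d' -> `|s' - s0| < r.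
Proof.
move=> sr d0; exists (Num.min d (r - `|s - s0|)); first by rewrite lt_min d0 subr_gt0.
split=> [|s']; first by rewrite ge_min lexx.
rewrite lt_min => /andP[_ h]; rewrite (_ : s' - s0 = (s' - s) + (s - s0)); last ring.
apply: (le_lt_trans (ler_normD _ _)); lra.
Qed.

Lemma transport_derive s y k : `|s - s0| < r ->
  is_derive s (1 : R) (fun s => v s (X s + y) 0 k) (material s y 0 k).
Proof.
move=> sr; pose a := X s + y.
pose Q s x : R := - g s x 0 k - (v s x *m A s x) 0 k.
have jQ x : jcts Q s x.
  apply: jctsD; first by apply: jctsN; exact: jg.
  by apply: jctsN; apply: jcts_mulmx => *; [exact: jv|exact: jA].
have -> : material s y 0 k = Q s a + (v s (X s) *m A s a) 0 k.
  by rewrite /material rV_subE mulmxBl rV_subE rV_oppE /Q /a; ring.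
apply: (@transport_chain _ (fun s x => v s x 0 k) (fun s => X s + y) (v s (X s)) a
  (fun z => (z *m A s a) 0 k) (Q s a) B s r) => //.
- by move=> c u w; rewrite mulmxDl -scalemxAl !mxE.
(* Joint continuity of the time derivative [Q] and the mean value theorem in time give an expansion
   uniform over the points near [a]. *)
- move=> e e0; have [d d0 hd] := (jctsP _ _ _).1 (jQ a) e e0.
  have [d' d'0 [dd hd']] := within_radius sr d0.
  exists d' => // s' z s'd zd.
  have [|c cd E] := @MVT_local R (fun s => v s z 0 k) (fun s => Q s z) s d' s' _ s'd.
    by move=> c cd; apply: dt; exact: hd'.
  rewrite E -mulrBl normrM ler_wpM2r//; apply/ltW/hd; exact: lt_le_trans dd.
- by move=> e e0; exact: dfv.
- by move=> s'; rewrite opprD addrACA subrr addr0.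
- move=> l; have := is_derive_add (dX l sr) (is_derive_cst (y 0 l) s 1).
  rewrite addr0 (_ : (fun s => (X s + y) 0 l) = (fun s => X s 0 l + cst (y 0 l) s))//.
  by apply/funext => s'; rewrite mxE.
Qed.

Lemma cont_field (f : R -> 'rV[R]_3 -> 'rV[R]_3) s : (forall x k, jcts (fun s x => f s x 0 k) s x) ->
  cont_eps_field (f s).
Proof.
move=> jf x e e0; have e2 : 0 < e / 2 by rewrite divr_gt0.
have H k : exists2 d, 0 < d & forall y, `|y - x| < d -> `|f s y 0 k - f s x 0 k| < e / 2.
  have [d d0 hd] := (jctsP _ _ _).1 (jf x k) _ e2.
  by exists d => // y yd; apply: hd => //; rewrite subrr normr0.
have [d0 d00 h0] := H 0; have [d1 d10 h1] := H 1; have [d2 d20 h2] := H 2.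
exists (Num.min d0 (Num.min d1 d2)); first by rewrite !lt_min d00 d10.
move=> y; rewrite !lt_min => /and3P[y0 y1 y2].
apply: (@le_lt_trans _ _ (e / 2)); last by rewrite ltr_pdivrMr//; lra.
apply: rV_norm_le; first by rewrite ltW.
by apply: ord3P; rewrite rV_subE ltW//; [exact: h0|exact: h1|exact: h2].
Qed.

(** The mean value theorem on the segment from [X s] to [X s + y], with the Jacobian at the single
    space-time point [(s0, X s0)] as the linear part for all nearby times. *)
Lemma local_linear e : 0 < e -> exists2 d, 0 < d <= r & forall s y, `|s - s0| < d -> `|y| < d ->
  (forall k l, `|A s (X s + y) k l - A s0 (X s0) k l| <= e) /\
  `|v s (X s + y) - v s (X s) - y *m A s0 (X s0)| <= 3 * e * `|y|.
Proof.
move=> e0; have s0r : `|s0 - s0| < r by rewrite subrr normr0.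
have H k l : exists2 d, 0 < d & forall s x, `|s - s0| < d -> `|x - X s0| < d ->
    `|A s x k l - A s0 (X s0) k l| < e.
  have [d d0 hd] := (jctsP _ _ _).1 (@jA s0 (X s0) k l s0r) e e0.
  by exists d => // s x; exact: hd.
have H' k : exists2 d, 0 < d & forall s x, `|s - s0| < d -> `|x - X s0| < d ->
    forall l, `|A s x k l - A s0 (X s0) k l| < e.
  have [d0 d00 h0] := H k 0; have [d1 d10 h1] := H k 1; have [d2 d20 h2] := H k 2.
  exists (Num.min d0 (Num.min d1 d2)); first by rewrite !lt_min d00 d10.
  move=> s x; rewrite !lt_min => /and3P[? ? ?] /and3P[? ? ?].
  by apply: ord3P; [exact: h0|exact: h1|exact: h2].
have [d0 d00 h0] := H' 0; have [d1 d10 h1] := H' 1; have [d2 d20 h2] := H' 2.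
pose d := Num.min d0 (Num.min d1 d2); have dd : 0 < d by rewrite !lt_min d00 d10.
have hA s x : `|s - s0| < d -> `|x - X s0| < d -> forall k l, `|A s x k l - A s0 (X s0) k l| < e.
  rewrite !lt_min => /and3P[? ? ?] /and3P[? ? ?].
  by apply: ord3P; [exact: h0|exact: h1|exact: h2].
have B0' : 0 <= B := B0.
pose d' := Num.min r (d / (B + 2)).
have d'0 : 0 < d' by rewrite lt_min r0 divr_gt0//; lra.
exists d'; first by rewrite d'0 ge_min lexx.
move=> s y; rewrite !lt_min !ltr_pdivlMr; [|lra..].
move=> /andP[sr sd] /andP[_ yd].
have sn := normr_ge0 (s - s0); have yn := normr_ge0 y.
have near t : 0 <= t <= 1 -> `|X s + t *: y - X s0| < d.
  move=> /andP[t0 t1]; rewrite addrAC; apply: (le_lt_trans (ler_normD _ _)).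
  rewrite normrZ ger0_norm//; have := XL s s0; nra.
have sd' : `|s - s0| < d by nra.
split=> [k l|]; first by rewrite -[y]scale1r ltW// hA// near// ler01 lexx.
apply: rV_norm_le => [|k]; first by rewrite !mulr_ge0// ltW.
have D t : is_derive t (1 : R) (fun t : R => v s (X s + t *: y) 0 k) ((y *m A s (X s + t *: y)) 0 k).
  by apply: (@is_derive_line R (fun x => v s x 0 k)); exact: dv.
have cD a b : {within `[a, b], continuous (fun t : R => v s (X s + t *: y) 0 k)}.
  by apply: continuous_subspaceT => t; have [+ _] := D t; move/derivable1_diffP/differentiable_continuous.
have [t] := MVT_segment ler01 (fun t _ => D t) (cD 0 1).
rewrite in_itv /= scale1r scale0r addr0 subr0 mulr1 => t01 E.
rewrite !rV_subE E -rV_subE -mulmxBr.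
apply: le_trans (rV_coord_le _ _) _; apply: mulmx_norm_le; first exact: ltW.
by move=> k' l'; rewrite !mxE ltW// hA// near.
Qed.

Lemma convection_jcts s (c : 'rV[R]_3) x k : `|s - s0| < r ->
  jcts (fun s x => ((v s x - c) *m A s x) 0 k) s x.
Proof.
move=> sr; apply: jcts_mulmx => [l|l n]; last exact: jA.
rewrite (_ : (fun s x => _) = (fun s x => v s x 0 l + - c 0 l)).
  by apply: jctsD; [exact: jv|exact: cvg_cst].
by apply/funext => s'; apply/funext => x'; rewrite rV_subE.
Qed.

Lemma convection_continuous s : `|s - s0| < r ->
  cont_eps_field (fun y => - ((v s (X s + y) - v s (X s)) *m A s (X s + y))).
Proof.
move=> sr; pose f s' x := - ((v s' x - v s (X s)) *m A s' x).
apply: (@cont_eps_translate R (f s) (X s)); apply: cont_field => x k.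
rewrite (_ : (fun s x => _) = (fun s' x => - ((v s' x - v s (X s)) *m A s' x) 0 k)).
  by apply: jctsN; exact: convection_jcts.
by apply/funext => s'; apply/funext => x'; rewrite rV_oppE.
Qed.

Lemma material_continuous s : `|s - s0| < r -> cont_eps_field (material s).
Proof.
move=> sr; pose f s' x := - g s' x - (v s' x - v s (X s)) *m A s' x.
apply: (@cont_eps_translate R (f s) (X s)); apply: cont_field => x k.
rewrite (_ : (fun s x => _) = (fun s' x => - g s' x 0 k + - ((v s' x - v s (X s)) *m A s' x) 0 k)).
  by apply: jctsD; apply: jctsN; [exact: jg|exact: convection_jcts].
by apply/funext => s'; apply/funext => x'; rewrite /f rV_subE rV_oppE.
Qed.

(** The pressure term drops out by [gcirc]. To first order in [y] the convection term is $-yA_0^2$,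
    whose circulation [circ_approx] evaluates; the error is uniform over a time window that does not
    depend on [h]. *)
Lemma circ_material e : 0 < e -> exists2 d, 0 < d <= r & forall s h, `|s - s0| < d -> 0 < h < d ->
  `|circ i j (material s) h + h * ((A s0 (X s0) *m A s0 (X s0)) i j -
    (A s0 (X s0) *m A s0 (X s0)) j i)| <= e * h.
Proof.
move=> e0; pose A0 := A s0 (X s0).
have [Ma Ma1 hMa] : exists2 Ma, 1 <= Ma & forall k l, `|A0 k l| <= Ma.
  exists (1 + \sum_k \sum_l `|A0 k l|).
    by rewrite lerDl; do 2 apply: sumr_ge0 => ? _.
  move=> k l; rewrite (bigD1 k)//= (bigD1 l)//=.
  have h1 : 0 <= \sum_(l' < 3 | l' != l) `|A0 k l'| by apply: sumr_ge0.
  have h2 : 0 <= \sum_(k' < 3 | k' != k) \sum_l `|A0 k' l| by do 2 apply: sumr_ge0 => ? _.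
  lra.
(* The remainder is, up to sign, $(u-yA_0)N+yA_0(N-A_0)$, with entries of $N$ bounded by $2M_a$; the
   two terms produce the coefficients $18M_a$ and $9M_a$. The factor 8 is 4 sides times the 2 in
   $|y|\le 2h$. *)
pose e1 := Num.min 1 (e / (8 * (18 * Ma + 9 * Ma))).
have Ma0 : 0 < Ma by lra.
have e10 : 0 < e1 by rewrite lt_min ltr01 divr_gt0// mulr_gt0//; lra.
have [d /andP[d0 dr] hd] := local_linear e10.
exists (d / 2); first by apply/andP; split; lra.
move=> s h sd /andP[h0 hh]; rewrite -/A0.
have sr : `|s - s0| < r by lra.
have sd' : `|s - s0| < d by lra.
have -> : circ i j (material s) h =
    circ i j (fun y => - ((v s (X s + y) - v s (X s)) *m A s (X s + y))) h.
  have cg : cont_eps_field (fun y => g s (X s + y)).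
    apply: (@cont_eps_translate R (g s) (X s)); apply: cont_field => x k; exact: jg.
  have h0' : 0 < h := h0.
  rewrite -[RHS]subr0 -(gcirc sr h0'); apply: (canRL (addrK _)).
  rewrite -circD//; last exact: material_continuous.
  by congr circ; apply/funext => y; rewrite /material addrAC addNr add0r.
rewrite (_ : _ + _ = circ i j (fun y => - ((v s (X s + y) - v s (X s)) *m A s (X s + y))) h
   - h * ((- (A0 *m A0)) i j - (- (A0 *m A0)) j i)); last by rewrite !mx_oppE; ring.
pose K := e / 4 * h.
rewrite (_ : e * h = 4 * K); last by rewrite /K; field.
apply: (@circ_approx R i j _ 0 (- (A0 *m A0)) h K _ h0); first exact: convection_continuous.
move=> y yh.
have yd : `|y| < d by lra.
have [h1 h2] := hd s y sd' yd.
set u := v s _ - _ in h2 *; set N := A s _ in h1 *.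
rewrite -/A0 in h1 h2; clearbody u N.
have -> : - (u *m N) - 0 - y *m - (A0 *m A0) = - ((u - y *m A0) *m N + (y *m A0) *m (N - A0)).
  by rewrite subr0 mulmxN opprK mulmxBl mulmxBr mulmxA addrA subrK opprB addrC.
rewrite normrN; apply: (le_trans (ler_normD _ _)).
have N2 k l : `|N k l| <= 2 * Ma.
  rewrite (_ : N k l = (N k l - A0 k l) + A0 k l); last by rewrite subrK.
  apply: (le_trans (ler_normD _ _)); have := h1 k l; have := hMa k l.
  have : e1 <= 1 by rewrite ge_min lexx.
  lra.
have M20 : 0 <= 2 * Ma by lra.
have k1 := mulmx_norm_le (u - y *m A0) M20 N2.
have NA k l : `|(N - A0) k l| <= e1 by rewrite !mxE.
have k2 := mulmx_norm_le (y *m A0) (ltW e10) NA.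
have k3 := mulmx_norm_le y (ltW Ma0) hMa.
have y0 := normr_ge0 y.
have e1e : e1 * (8 * (18 * Ma + 9 * Ma)) <= e.
  have : e1 <= e / (8 * (18 * Ma + 9 * Ma)) by rewrite ge_min lexx orbT.
  by rewrite ler_pdivlMr// mulr_gt0//; lra.
have q1 : `|(u - y *m A0) *m N| <= 18 * Ma * e1 * `|y|.
  apply: (le_trans k1); rewrite (_ : 18 * Ma * e1 * `|y| = 3 * (2 * Ma) * (3 * e1 * `|y|)); last ring.
  by rewrite ler_wpM2l// mulr_ge0.
have q2 : `|(y *m A0) *m (N - A0)| <= 9 * Ma * e1 * `|y|.
  apply: (le_trans k2); rewrite (_ : 9 * Ma * e1 * `|y| = 3 * e1 * (3 * Ma * `|y|)); last ring.
  by rewrite ler_wpM2l// mulr_ge0// ltW.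
apply: (le_trans (lerD q1 q2)).
have q3 : (18 * Ma + 9 * Ma) * e1 * `|y| <= (18 * Ma + 9 * Ma) * e1 * (2 * h).
  by rewrite ler_wpM2l// mulr_ge0//; lra.
rewrite /K; have := ler_wpM2r (ltW h0) e1e; lra.
Qed.

(** Supplies the dominating constant for differentiating the circulation under the integral. *)
Lemma material_bounded : exists2 d, 0 < d <= r & exists K, forall s y k,
  `|s - s0| < d -> `|y| < d -> `|material s y 0 k| <= K.
Proof.
have s0r : `|s0 - s0| < r by rewrite subrr normr0.
have B0' : 0 <= B := B0.
have [d1 d10 H1] : exists2 d, 0 < d & forall k s x, `|s - s0| < d -> `|x - X s0| < d ->
    `|g s x 0 k| <= \sum_l (`|g s0 (X s0) 0 l| + 1).
  apply: ord3_radius => [k d d' h dd s x sd xd|k].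
    by apply: h; [exact: lt_le_trans dd|exact: lt_le_trans dd].
  have [d d0 hd] := (jctsP _ _ _).1 (@jg s0 (X s0) k s0r) 1 ltr01.
  exists d => // s x sd xd; have := hd s x sd xd.
  rewrite (bigD1 k)//= => h.
  have h1 : 0 <= \sum_(l < 3 | l != k) (`|g s0 (X s0) 0 l| + 1).
    by apply: sumr_ge0 => l _; rewrite addr_ge0.
  have := ler_normD (g s x 0 k - g s0 (X s0) 0 k) (g s0 (X s0) 0 k).
  rewrite subrK; lra.
have [d2 /andP[d20 d2r] H2] := local_linear ltr01.
set A0 := A s0 (X s0) in H2.
pose Ma := \sum_k \sum_l (`|A0 k l| + 1).
have Ma0 : 0 <= Ma by do 2 apply: sumr_ge0 => ? _; rewrite addr_ge0.
have hMa k l : `|A0 k l| + 1 <= Ma.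
  rewrite /Ma (bigD1 k)//= (bigD1 l)//= -addrA lerDl addr_ge0//.
    by apply: sumr_ge0 => *; rewrite addr_ge0.
  by do 2 apply: sumr_ge0 => ? _; rewrite addr_ge0.
pose d := Num.min d2 (d1 / (B + 1 + 1)).
have d0 : 0 < d by rewrite lt_min d20 divr_gt0//; lra.
exists d; first by rewrite d0 ge_min d2r.
exists (\sum_l (`|g s0 (X s0) 0 l| + 1) + 3 * Ma * (3 * d + 3 * Ma * d)) => s y k.
rewrite !lt_min !ltr_pdivlMr; [|lra..].
move=> /andP[sd2 sd1] /andP[yd2 yd1].
have yd : `|y| <= d by rewrite le_min (ltW yd2) ler_pdivlMr ?(ltW yd1)//; lra.
have [h1 h2] := H2 s y sd2 yd2.
have xd : `|X s + y - X s0| < d1.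
  rewrite addrAC; apply: (le_lt_trans (ler_normD _ _)); have := XL s s0.
  have := normr_ge0 (s - s0); have := normr_ge0 y; nra.
have sd1' : `|s - s0| < d1 by have := normr_ge0 (s - s0); nra.
have h3 := H1 k s (X s + y) sd1' xd.
rewrite /material rV_subE rV_oppE; apply: (le_trans (ler_normB _ _)); rewrite normrN.
apply: lerD => //; apply: (le_trans (rV_coord_le _ _)).
set u := v s _ - _ in h2 *; set N := A s _ in h1 *; clearbody u N.
have NM k' l : `|N k' l| <= Ma.
  apply: le_trans (hMa k' l).
  have := ler_normD (N k' l - A0 k' l) (A0 k' l); rewrite subrK.
  have := h1 k' l; lra.
apply: (le_trans (mulmx_norm_le u Ma0 NM)); rewrite ler_wpM2l ?mulr_ge0//.
have AM k' l : `|A0 k' l| <= Ma by have := hMa k' l; lra.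
have h4 := mulmx_norm_le y Ma0 AM.
have := ler_normD (u - y *m A0) (y *m A0); rewrite subrK.
have := ler_wpM2l (mulr_ge0 (ler0n R 3) Ma0) yd; lra.
Qed.

(** The time window [d] is fixed before the size [h] of the square. For each small [h] the
    circulation has the expected increment up to $eh|s-s_0|$; dividing by [h] and shrinking the
    square at the fixed times [s] and [s0] carries this estimate over to [W], so that no limit of
    derivatives is exchanged. *)
Lemma vorticity_derive :
  let W s := A s (X s) i j - A s (X s) j i in
  let A0 := A s0 (X s0) in
  is_derive s0 (1 : R) W (- ((A0 *m A0) i j - (A0 *m A0) j i)).
Proof.
move=> W A0.
apply/is_derive_epsP => e e0.
have [d1 /andP[d10 d1r] H1] := circ_material e0.
have [d2 /andP[d20 d2r] [K HK]] := material_bounded.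
pose d := Num.min d1 d2; have d0 : 0 < d by rewrite lt_min d10.
exists d => // s sd.
have sd1 : `|s - s0| < d1 by move: sd; rewrite lt_min => /andP[].
have sr : `|s - s0| < r by exact: lt_le_trans d1r.
have s00 : `|s0 - s0| < r by rewrite subrr normr0.
pose Phi h s := circ i j (fun y => v s (X s + y)) h.
pose l := - ((A0 *m A0) i j - (A0 *m A0) j i).
have step h : 0 < h -> 2 * h < d -> `|Phi h s - Phi h s0 - l * h * (s - s0)| <= e * h * `|s - s0|.
  move=> h0 hd.
  have hd1 : h < d1 by move: hd; rewrite lt_min => /andP[? _]; lra.
  have D c : `|c - s0| < d -> is_derive c (1 : R) (Phi h) (circ i j (material c) h).
    apply: (@circ_derive R i j (fun s y => v s (X s + y)) material h K s0 d h0).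
    - move=> c'; rewrite lt_min => /andP[c'd _].
      apply: (@cont_eps_translate R (v c') (X c')); apply: cont_field => x k.
      by apply: jv; exact: lt_le_trans d1r.
    - move=> c'; rewrite lt_min => /andP[c'd _] y k.
      by apply: transport_derive; exact: lt_le_trans d1r.
    - move=> c' y k; rewrite lt_min => /andP[_ c'd] yh; apply: HK => //.
      by apply: (le_lt_trans yh); move: hd; rewrite lt_min => /andP[].
  have [c cd E] := MVT_local D sd.
  rewrite E -mulrBl normrM ler_wpM2r//.
  have cd1 : `|c - s0| < d1 by move: cd; rewrite lt_min => /andP[].
  rewrite (_ : _ - _ = circ i j (material c) h + h * ((A0 *m A0) i j - (A0 *m A0) j i)); last by rewrite /l; ring.
  by apply: H1 => //; rewrite h0.
have lim c : `|c - s0| < r -> forall e', 0 < e' -> exists2 d', 0 < d' &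
    forall h, 0 < h < d' -> `|Phi h c - h * W c| <= e' * h.
  move=> cr e' e'0.
  have e80 : 0 < e' / 8 by rewrite divr_gt0.
  have [d' d'0 hd'] : exists2 d', 0 < d' & forall k z, `|z - X c| < d' ->
      `|v c z 0 k - v c (X c) 0 k - ((z - X c) *m A c (X c)) 0 k| <= e' / 8 * `|z - X c|.
    apply: ord3_radius => [k a b h ba z zb|k]; first by apply: h; exact: lt_le_trans ba.
    exact: dfv.
  exists (d' / 2); first by rewrite divr_gt0.
  move=> h /andP[h0 hd].
  rewrite (_ : e' * h = 4 * (e' / 8 * (2 * h))); last by field.
  apply: (@circ_approx R i j _ (v c (X c)) (A c (X c)) h _ _ h0).
    apply: (@cont_eps_translate R (v c) (X c)); apply: cont_field => x k; exact: jv.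
  move=> y yh; apply: (@le_trans _ _ (e' / 8 * `|y|)); last by rewrite ler_wpM2l// ltW.
  apply: rV_norm_le => [|k]; first by rewrite mulr_ge0// ltW.
  have := hd' k (X c + y); rewrite [X c + y]addrC addrK => /(_ _).
  by rewrite !rV_subE; apply; lra.
rewrite -/l; apply/ler_addgt0Pr => e' e'0.
have e20 : 0 < e' / 2 by rewrite divr_gt0.
have [da da0 Ha] := lim s sr _ e20.
have [db db0 Hb] := lim s0 s00 _ e20.
(* The bound $d/3$ gives $2h<d$; the other two make the circulation divided by [h] close to [W] at
   both times, each within $e'/2$. *)
pose h := Num.min (d / 3) (Num.min (da / 2) (db / 2)).
have h0 : 0 < h by rewrite !lt_min !divr_gt0.
have [hd ha hb] : [/\ h <= d / 3, h <= da / 2 & h <= db / 2].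
  by rewrite /h !ge_min !lexx ?orbT.
have h1 : 2 * h < d by lra.
have h2 := step h h0 h1.
have h3 : `|Phi h s - h * W s| <= e' / 2 * h by apply: Ha; rewrite h0; lra.
have h4 : `|Phi h s0 - h * W s0| <= e' / 2 * h by apply: Hb; rewrite h0; lra.
rewrite -(ler_pM2l h0) -[X in X * `|_|](gtr0_norm h0) -normrM.
move: h2 h3 h4; move: (Phi h s) (Phi h s0) (W s) (W s0) => p q a b.
rewrite !ler_norml => /andP[? ?] /andP[? ?] /andP[? ?].
by apply/andP; split; lra.
Qed.

End vorticity_transport.

(** * Bernoulli inequalities *)

Section calculus.
Variable R : realType.
Implicit Types f g : R -> R.

Lemma is_derive_mul f g (x a b : R) : is_derive x (1 : R) f a -> is_derive x (1 : R) g b ->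
  is_derive x (1 : R) (fun y => f y * g y) (f x * b + g x * a).
Proof. by move=> fa gb; exact: is_deriveM. Qed.

Lemma is_derive_inv f (x a : R) : f x != 0 -> is_derive x (1 : R) f a ->
  is_derive x (1 : R) (fun y => (f y)^-1) (- (f x ^+ 2)^-1 * a).
Proof. by move=> fx fa; exact: is_deriveV. Qed.

Lemma is_derive_sqrt f (x a : R) : 0 < f x -> is_derive x (1 : R) f a ->
  is_derive x (1 : R) (fun y => Num.sqrt (f y)) ((2 * Num.sqrt (f x))^-1 * a).
Proof. by move=> fx fa; exact: (is_derive1_comp (is_derive1_sqrt fx) fa). Qed.

Lemma derive_ge0_le_itv f (df : R -> R) (a b : R) : a <= b ->
  (forall x, a <= x <= b -> {for x, continuous f}) ->
  (forall x, a < x < b -> is_derive x (1 : R) f (df x)) ->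
  (forall x, a < x < b -> 0 <= df x) -> f a <= f b.
Proof.
move=> ab cf h h0; apply: (derive_ge0_le ab h) => //.
by apply: continuous_in_subspaceT => z; rewrite inE /= in_itv /= => /cf.
Qed.

Lemma cont_mul f g (x : R) : {for x, continuous f} -> {for x, continuous g} ->
  {for x, continuous (fun y => f y * g y)}.
Proof. by move=> cf cg; exact: (cvgM cf cg). Qed.

Lemma cont_scale f (c x : R) : {for x, continuous f} -> {for x, continuous (fun y => c * f y)}.
Proof. by move=> cf; apply: cont_mul => //; exact: cvg_cst. Qed.

Lemma cont_add f g (x : R) : {for x, continuous f} -> {for x, continuous g} ->
  {for x, continuous (fun y => f y + g y)}.
Proof. by move=> cf cg; exact: (@cvgD _ R^o _ _ _ _ _ _ _ cf cg). Qed.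

Lemma cont_sub f g (x : R) : {for x, continuous f} -> {for x, continuous g} ->
  {for x, continuous (fun y => f y - g y)}.
Proof. by move=> cf cg; exact: (@cvgB _ R^o _ _ _ _ _ _ _ cf cg). Qed.
End calculus.

Section exponential_weight.
Variable R : realType.
Implicit Types c s t : R.

Lemma is_derive_continuous (f : R -> R) (x a : R) : is_derive x (1 : R) f a -> {for x, continuous f}.
Proof. by move=> [+ _] => /derivable1_diffP/differentiable_continuous. Qed.

(** At positive times the primitive is differentiable. At other times it vanishes, and the bound of
    [f] near 0 takes care of the approach from the right. *)
Lemma prim_continuous (f : R -> R) : continuous f -> continuous (prim f).
Proof.
move=> cf s; have [s0|s0] := ltP 0 s; first exact: (is_derive_continuous (prim_derive cf s0)).
have /cvgrPdist_lt/(_ _ ltr01)/nbhs_ballP[d /= d0 hd] := cf 0.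
pose M := `|f 0| + 1; have M0 : 0 < M by rewrite ltr_wpDl.
apply/cvgrPdist_lt => e e0; apply/nbhs_ballP.
exists (Num.min d (e / M)); first by rewrite /= lt_min d0 divr_gt0.
move=> s' h; have {}h : `|s - s'| < Num.min d (e / M) := h.
rewrite (prim_le0 _ s0) sub0r normrN.
have [s'0|s'0] := leP s' 0; first by rewrite prim_le0// normr0.
move: h; rewrite lt_min ltr_norml => /andP[/andP[s'd _]].
rewrite ltr_pdivlMr// mulrC => hs.
have fM x : 0 <= x <= s' -> `|f x| <= M.
  move=> /andP[x0 xs]; have /ltW : `|f 0 - f x| < 1.
    by apply: hd; rewrite -ball_normE /= ltr_norml; lra.
  have := ler_normB (f 0) (f 0 - f x); rewrite subKr /M; lra.
have := @integral_itv_le _ f 0 s' M cf (ltW s'0) fM.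
rewrite subr0 => h1; apply: (le_lt_trans h1); apply: le_lt_trans hs.
by rewrite ler_wpM2l ?(ltW M0)// ler_normr; lra.
Qed.

Variable g : R -> R.
Hypothesis gc : continuous g.

Definition weight c s := expR (c * prim g s).

Lemma weight_gt0 c s : 0 < weight c s. Proof. exact: expR_gt0. Qed.

Lemma weight0 c : weight c 0 = 1.
Proof. by rewrite /weight prim_le0// mulr0 expR0. Qed.

Lemma weight_continuous c : continuous (weight c).
Proof.
move=> s; apply: (@continuous_comp _ _ _ (fun s => c * prim g s) expR); last exact: continuous_expR.
by apply: cont_scale; exact: prim_continuous.
Qed.

Lemma weight_derive c s : 0 < s -> is_derive s (1 : R) (weight c) (c * g s * weight c s).
Proof.
move=> s0; have h := is_derive_scale c (prim_derive gc s0).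
by rewrite mulrC; exact: (@is_derive1_comp R expR (fun r => c * prim g r)).
Qed.
End exponential_weight.

(** * Differential inequalities for the squared vorticity *)

Section bernoulli.
Variables (R : realType) (g z dz : R -> R) (t : R).
Hypothesis gc : continuous g.
Hypothesis t0 : 0 <= t.
Hypothesis zc : continuous z.
Hypothesis z0 : forall s, 0 <= z s.
Hypothesis zd : forall s, 0 < s < t -> is_derive s (1 : R) z (2 * dz s).
Hypothesis dzg : forall s, 0 < s < t -> `|dz s| <= g s * z s.
Hypothesis zg : forall s, 0 < s < t -> Num.sqrt (z s) <= g s.
Implicit Types b c s : R.
Notation E := (weight g).

(** Here [z] is $y^2$ and [dz] half of its derivative, so $(ze^{2G})'=2e^{2G}(gz+dz)\ge 0$. A
    positive initial value therefore stays positive, and $y=\sqrt z$ may be differentiated and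
    inverted. *)
Lemma square_growth s : 0 <= s <= t -> z 0 <= z s * E 2 s.
Proof.
move=> /andP[s0 st].
have -> : z 0 = z 0 * E 2 0 by rewrite weight0 mulr1.
apply: (@derive_ge0_le_itv _ (fun s => z s * E 2 s)
  (fun s => z s * (2 * g s * E 2 s) + E 2 s * (2 * dz s))) => //.
- by move=> x _; apply: cont_mul; [exact: zc|exact: weight_continuous].
- move=> x /andP[x0 xs]; apply: is_derive_mul; first by apply: zd; lra.
  exact: weight_derive.
move=> x /andP[x0 xs]; have xt : 0 < x < t by lra.
have := dzg xt; rewrite ler_norml => /andP[h _].
rewrite (_ : _ + _ = 2 * E 2 x * (g x * z x + dz x)); last ring.
by apply: mulr_ge0; [rewrite mulr_ge0// ltW// weight_gt0|lra].
Qed.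

(** The companion bound, by which a vanishing initial value stays zero. *)
Lemma square_decay s : 0 <= s <= t -> z s * E (- 2) s <= z 0.
Proof.
move=> /andP[s0 st].
have -> : z 0 = z 0 * E (- 2) 0 by rewrite weight0 mulr1.
rewrite -lerN2.
apply: (@derive_ge0_le_itv _ (fun s => - (z s * E (- 2) s))
  (fun s => - (z s * (- 2 * g s * E (- 2) s) + E (- 2) s * (2 * dz s)))) => //.
- move=> x _; apply: (@cvgN _ R^o); apply: cont_mul; [exact: zc|exact: weight_continuous].
- move=> x /andP[x0 xs]; apply: is_deriveN; apply: is_derive_mul; first by apply: zd; lra.
  exact: weight_derive.
move=> x /andP[x0 xs]; have xt : 0 < x < t by lra.
have := dzg xt; rewrite ler_norml => /andP[_ h].
rewrite (_ : - _ = 2 * E (- 2) x * (g x * z x - dz x)); last ring.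
by apply: mulr_ge0; [rewrite mulr_ge0// ltW// weight_gt0|lra].
Qed.

Lemma root_cont s : {for s, continuous (fun s => Num.sqrt (z s))}.
Proof. by apply: continuous_comp; [exact: zc|exact: sqrt_continuous]. Qed.

Lemma square_zero : z 0 = 0 -> z t = 0.
Proof.
move=> e; have := @square_decay t; rewrite t0 lexx e => /(_ isT) h.
apply/eqP; rewrite eq_le z0 andbT.
by rewrite -(pmulr_lle0 (z t) (weight_gt0 g (- 2) t)).
Qed.

Lemma square_pos s : 0 < z 0 -> 0 <= s <= t -> 0 < z s.
Proof.
move=> zp /square_growth h; have := lt_le_trans zp h.
by rewrite pmulr_lgt0// weight_gt0.
Qed.

(* With [y = sqrt z], the logarithmic derivative [y' / y = dz / z] lies between [- g] and [g]. *)
Lemma ratio_derive c s : 0 < z 0 -> 0 < s < t ->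
  is_derive s (1 : R) (fun s => E c s * (Num.sqrt (z s))^-1)
    (E c s / Num.sqrt (z s) * (c * g s - dz s / z s)).
Proof.
move=> zp st; have /andP[s0 s1] := st.
have zs : 0 < z s by apply: square_pos => //; lra.
have y0 : 0 < Num.sqrt (z s) by rewrite sqrtr_gt0.
have -> : E c s / Num.sqrt (z s) * (c * g s - dz s / z s) =
  E c s * (- (Num.sqrt (z s) ^+ 2)^-1 * ((2 * Num.sqrt (z s))^-1 * (2 * dz s))) +
  (Num.sqrt (z s))^-1 * (c * g s * E c s).
  by rewrite sqr_sqrtr ?z0//; field; rewrite !gt_eqF.
apply: is_derive_mul; first exact: weight_derive.
apply: is_derive_inv; first by rewrite gt_eqF.
by apply: is_derive_sqrt => //; exact: zd.
Qed.

Lemma ratio_cont c s : 0 < z 0 -> 0 <= s <= t ->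
  {for s, continuous (fun s => E c s * (Num.sqrt (z s))^-1)}.
Proof.
move=> zp st; apply: cont_mul; first exact: weight_continuous.
by apply: cvgV; [rewrite gt_eqF// sqrtr_gt0 square_pos|exact: root_cont].
Qed.

Lemma log_derivative_bound s : 0 < z 0 -> 0 < s < t -> `|dz s / z s| <= g s.
Proof.
move=> zp st; have zs : 0 < z s by apply: square_pos => //; lra.
by rewrite normrM normfV (gtr0_norm zs) ler_pdivrMr// dzg.
Qed.

(** With $c=b+1$ the derivative of the monotone quantity is $(E_c/y)(cg-dz/z-by)$: one $g$ pays for
    $dz/z$ and $bg$ for $by$. The conclusion is multiplied out so as to include $y=0$. *)
Lemma bernoulli_upper b : 0 <= b ->
  Num.sqrt (z t) * (1 + b * Num.sqrt (z 0) * prim (E (b + 1)) t) <=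
  Num.sqrt (z 0) * E (b + 1) t.
Proof.
move=> b0; have := z0 0; rewrite le_eqVlt => /predU1P[/esym z00|zp].
  by rewrite square_zero// z00 sqrtr0 !mul0r.
set c := b + 1.
have y0 s : 0 <= s <= t -> 0 < Num.sqrt (z s) by move=> st; rewrite sqrtr_gt0 square_pos.
have yt : 0 < Num.sqrt (z t) by apply: y0; rewrite t0 lexx.
have y00 : 0 < Num.sqrt (z 0) by apply: y0; rewrite t0 lexx.
have cE := weight_continuous gc (c := c).
have : E c 0 * (Num.sqrt (z 0))^-1 - b * prim (E c) 0 <=
       E c t * (Num.sqrt (z t))^-1 - b * prim (E c) t.
  apply: (@derive_ge0_le_itv _ (fun s => E c s * (Num.sqrt (z s))^-1 - b * prim (E c) s)
    (fun s => E c s / Num.sqrt (z s) * (c * g s - dz s / z s) - b * E c s)) => //.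
  - move=> s st; apply: cont_sub; first exact: ratio_cont.
    by apply: cont_scale; exact: prim_continuous.
  - move=> s st; apply: is_derive_sub; first exact: ratio_derive.
    by apply: is_derive_scale; apply: prim_derive => //; case/andP: st.
  move=> s st; have ys : 0 < Num.sqrt (z s) by apply: y0; lra.
  have := log_derivative_bound zp st; rewrite ler_norml => /andP[_ h].
  have -> : E c s / Num.sqrt (z s) * (c * g s - dz s / z s) - b * E c s =
    E c s / Num.sqrt (z s) * (c * g s - dz s / z s - b * Num.sqrt (z s)).
    by field; rewrite !gt_eqF// -sqrtr_gt0.
  apply: mulr_ge0; first by rewrite divr_ge0// ltW// weight_gt0.
  have := ler_wpM2l b0 (zg st); rewrite /c; lra.
rewrite weight0 (prim_le0 _ (lexx 0)) mulr0 subr0 mul1r.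
move: (prim _ t) (E c t) yt y00 => P W; move: (Num.sqrt (z t)) (Num.sqrt (z 0)) => yt y00 h1 h2 h.
have := ler_wpM2l (ltW (mulr_gt0 h1 h2)) h.
have -> : yt * y00 * y00^-1 = yt by field; rewrite gt_eqF.
have -> : yt * y00 * (W / yt - b * P) = y00 * W - yt * (b * y00 * P) by field; rewrite gt_eqF.
by lra.
Qed.

(** The same balance with $c=-(b+1)$: $(b+1)g+dz/z-by\ge 0$ now uses $dz/z\ge -g$. *)
Lemma bernoulli_lower b : 0 <= b ->
  Num.sqrt (z 0) * E (- (b + 1)) t <=
  Num.sqrt (z t) * (1 - b * Num.sqrt (z 0) * prim (E (- (b + 1))) t).
Proof.
move=> b0; have := z0 0; rewrite le_eqVlt => /predU1P[/esym z00|zp].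
  by rewrite square_zero// z00 sqrtr0 !mul0r.
set c := - (b + 1).
have y0 s : 0 <= s <= t -> 0 < Num.sqrt (z s) by move=> st; rewrite sqrtr_gt0 square_pos.
have yt : 0 < Num.sqrt (z t) by apply: y0; rewrite t0 lexx.
have y00 : 0 < Num.sqrt (z 0) by apply: y0; rewrite t0 lexx.
have cE := weight_continuous gc (c := c).
have : - b * prim (E c) 0 - E c 0 * (Num.sqrt (z 0))^-1 <=
       - b * prim (E c) t - E c t * (Num.sqrt (z t))^-1.
  apply: (@derive_ge0_le_itv _ (fun s => - b * prim (E c) s - E c s * (Num.sqrt (z s))^-1)
    (fun s => - b * E c s - E c s / Num.sqrt (z s) * (c * g s - dz s / z s))) => //.
  - move=> s st; apply: cont_sub; last exact: ratio_cont.
    by apply: cont_scale; exact: prim_continuous.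
  - move=> s st; apply: is_derive_sub; last exact: ratio_derive.
    by apply: is_derive_scale; apply: prim_derive => //; case/andP: st.
  move=> s st; have ys : 0 < Num.sqrt (z s) by apply: y0; lra.
  have := log_derivative_bound zp st; rewrite ler_norml => /andP[h _].
  have -> : - b * E c s - E c s / Num.sqrt (z s) * (c * g s - dz s / z s) =
    E c s / Num.sqrt (z s) * (- c * g s + dz s / z s - b * Num.sqrt (z s)).
    by field; rewrite !gt_eqF// -sqrtr_gt0.
  apply: mulr_ge0; first by rewrite divr_ge0// ltW// weight_gt0.
  have := ler_wpM2l b0 (zg st); rewrite /c; lra.
rewrite weight0 (prim_le0 _ (lexx 0)) mulr0 sub0r mul1r.
move: (prim _ t) (E c t) yt y00 => P W; move: (Num.sqrt (z t)) (Num.sqrt (z 0)) => yt y00 h1 h2 h.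
have := ler_wpM2l (ltW (mulr_gt0 h1 h2)) h.
have -> : yt * y00 * - y00^-1 = - yt by field; rewrite gt_eqF.
have -> : yt * y00 * (- b * P - W / yt) = - (y00 * W) - yt * (b * y00 * P) by field; rewrite gt_eqF.
by lra.
Qed.
End bernoulli.

(** * The denominator of the lower estimate *)

Section lower_denominator.
Variables (R : realType) (g : R -> R) (w0 t : R).
Hypothesis gc : continuous g.
Hypothesis w00 : 0 <= w0.
Hypothesis t0 : 0 <= t.
Hypothesis growth : forall s, 0 < s < t -> w0 <= g s * weight g 1 s.
Implicit Types s b : R.

Lemma weight_linear s : 0 <= s <= t -> 1 + w0 * s <= weight g 1 s.
Proof.
move=> /andP[s0 st].
have : weight g 1 0 - w0 * 0 <= weight g 1 s - w0 * s.
  apply: (@derive_ge0_le_itv _ (fun s => weight g 1 s - w0 * s)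
    (fun s => 1 * g s * weight g 1 s - w0 * 1)) => //.
  - move=> x _; apply: cont_sub; first exact: weight_continuous.
    by apply: cont_scale; exact: cvg_id.
  - move=> x /andP[x0 xs]; exact: (is_derive_sub (weight_derive gc 1 x0) (is_derive_scale w0 (is_derive_id x (1 : R)))).
  by move=> x /andP[x0 xs]; rewrite mul1r mulr1 subr_ge0; apply: growth; lra.
rewrite weight0; lra.
Qed.

(** [l] is $(1+w_0s)^{-b}$, with derivative $-bw_0(1+w_0s)^{-(b+1)}$. By [weight_linear] the weight
    of exponent $-(b+1)$ is at most $(1+w_0s)^{-(b+1)}$, so the denominator decreases no faster than
    [l], and both start at 1. *)
Lemma denominator_lower b : 0 <= b ->
  1 / (1 + w0 * t) `^ b <= 1 - b * w0 * prim (weight g (- (b + 1))) t.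
Proof.
move=> b0; pose c := - (b + 1).
pose l s := expR (- b * ln (1 + w0 * s)).
have p0 s : 0 <= s -> 0 < 1 + w0 * s by move=> s0; rewrite ltr_pwDl// mulr_ge0.
have dl s : 0 <= s -> is_derive s (1 : R) l (- b * w0 * l s / (1 + w0 * s)).
  move=> s0.
  have h1 : is_derive s (1 : R) (fun s => 1 + w0 * s) (0 + w0 * 1).
    exact: (@is_derive_add _ (cst (1 : R)) _ _ _ _ (is_derive_cst (1 : R) s (1 : R)) (is_derive_scale w0 (is_derive_id s (1 : R)))).
  have h2 : is_derive s (1 : R) (fun s => ln (1 + w0 * s)) ((1 + w0 * s)^-1 * (0 + w0 * 1)).
    exact: (@is_derive1_comp R (@ln R) (fun s => 1 + w0 * s) s _ _ (is_derive1_ln (p0 s s0)) h1).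
  have h3 := is_derive_scale (- b) h2.
  have -> : - b * w0 * l s / (1 + w0 * s) = l s * (- b * ((1 + w0 * s)^-1 * (0 + w0 * 1))).
    by rewrite add0r; ring.
  exact: (@is_derive1_comp R expR (fun s => - b * ln (1 + w0 * s))).
have cE := weight_continuous gc (c := c).
have : - (b * w0) * prim (weight g c) 0 - l 0 <= - (b * w0) * prim (weight g c) t - l t.
  apply: (@derive_ge0_le_itv _ (fun s => - (b * w0) * prim (weight g c) s - l s)
    (fun s => - (b * w0) * weight g c s - - b * w0 * l s / (1 + w0 * s))) => //.
  - move=> s /andP[s0 _]; apply: cont_sub; first by apply: cont_scale; exact: prim_continuous.
    exact: (is_derive_continuous (dl s s0)).
  - move=> s /andP[s0 _]; apply: is_derive_sub; last by apply: dl; rewrite ltW.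
    by apply: is_derive_scale; exact: prim_derive.
  move=> s /andP[s0 st].
  have -> : - (b * w0) * weight g c s - - b * w0 * l s / (1 + w0 * s) =
    b * w0 * (l s / (1 + w0 * s) - weight g c s) by ring.
  apply: mulr_ge0; first exact: mulr_ge0.
  have ps := p0 s (ltW s0).
  have -> : l s / (1 + w0 * s) = expR (c * ln (1 + w0 * s)).
    have -> : (1 + w0 * s)^-1 = expR (- ln (1 + w0 * s)) by rewrite expRN lnK.
    by rewrite /l -expRD; congr expR; rewrite /c; ring.
  rewrite subr_ge0 /weight ler_expR /c mulNr mulNr lerN2.
  apply: ler_wpM2l; first lra.
  rewrite -ler_expR lnK//; have := @weight_linear s; rewrite /weight mul1r; apply; lra.
have -> : l 0 = 1 by rewrite /l mulr0 addr0 ln1 mulr0 expR0.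
rewrite (prim_le0 _ (lexx 0)) /l mulr0 sub0r.
rewrite /powR gt_eqF ?p0// div1r -expRN !mulNr -/c.
by move: (prim _ t) (expR _) => P e; lra.
Qed.
End lower_denominator.

(** * Admissible matrix norms and suprema over space *)

Section matrix_norm.
Variables (R : realType) (N : 'M[R]_3 -> R).
Hypothesis aN : admissible_norm N.

Lemma norm0 : N 0 = 0.
Proof. by rewrite -(scale0r (0 : 'M[R]_3)) (admissible_scale aN) normr0 mul0r. Qed.

Lemma normN A : N (- A) = N A.
Proof. by rewrite -scaleN1r (admissible_scale aN) normrN1 mul1r. Qed.

Lemma norm_ge0 A : 0 <= N A.
Proof.
have := admissible_triangle aN A (- A); rewrite subrr norm0 normN; lra.
Qed.

Lemma norm_dist A B : `|N A - N B| <= N (A - B).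
Proof.
rewrite ler_norml; apply/andP; split.
  by have := admissible_triangle aN (B - A) A; rewrite subrK -(normN (A - B)) opprB; lra.
by have := admissible_triangle aN (A - B) B; rewrite subrK; lra.
Qed.

Lemma norm_sum (I : finType) (F : I -> 'M[R]_3) : N (\sum_i F i) <= \sum_i N (F i).
Proof.
apply: (big_ind2 (fun A c => N A <= c)) => //; first by rewrite norm0.
by move=> A a B b hA hB; apply: (le_trans (admissible_triangle aN A B)); exact: lerD.
Qed.

(** Expansion in matrix units. It turns the entrywise bounds on Jacobians into bounds for [N]. *)
Lemma norm_entries : exists2 C, 0 <= C & forall (A : 'M[R]_3) c, (forall i j, `|A i j| <= c) -> N A <= C * c.
Proof.
exists (\sum_i \sum_j N (delta_mx i j)).
  by apply: sumr_ge0 => i _; apply: sumr_ge0 => j _; exact: norm_ge0.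
move=> A c h; rewrite {1}(matrix_sum_delta A); apply: (le_trans (norm_sum _)).
rewrite mulr_suml; apply: ler_sum => i _; apply: (le_trans (norm_sum _)).
rewrite mulr_suml; apply: ler_sum => j _.
by rewrite (admissible_scale aN) mulrC ler_wpM2l// norm_ge0.
Qed.

Lemma edotZ (c d : R) (u w : 'rV[R]_3) : edot (c *: u) (d *: w) = c * d * edot u w.
Proof. by rewrite !edotE !mxE; ring. Qed.

(** The strain bound extended from unit vectors by homogeneity, the zero vector being treated
    apart. *)
Lemma norm_strain A (w : 'rV[R]_3) : `|edot w (w *m A)| <= N A * edot w w.
Proof.
have [w0|wn0] := eqVneq (enorm w) 0.
  have e0 : edot w w = 0 by rewrite -enorm_sqr w0 expr0n.
  have {}w0 : w = 0.
    apply/rowP => i; rewrite mxE; apply/eqP; rewrite -sqrf_eq0 -normr_le0.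
    move: e0; rewrite edotE => e0; rewrite ger0_norm ?sqr_ge0//.
    by move: i; apply: ord3P; rewrite expr2; move: e0;
       have := sqr_ge0 (w 0 0); have := sqr_ge0 (w 0 1); have := sqr_ge0 (w 0 2);
       rewrite !expr2; lra.
  by rewrite e0 w0 mul0mx edotE !mxE !mul0r !addr0 normr0 mulr0.
have wp : 0 < enorm w by rewrite lt_neqAle eq_sym wn0 enorm_ge0.
pose xi := (enorm w)^-1 *: w.
have E1 : enorm xi = 1.
  by rewrite /enorm edotZ -[edot w w]enorm_sqr (_ : _ * _ = 1) ?sqrtr1//; field.
have := admissible_strain aN A E1; rewrite -scalemxAl edotZ normrM.
rewrite gtr0_norm ?mulr_gt0 ?invr_gt0// -[edot w w]enorm_sqr => h.
have -> : `|edot w (w *m A)| = enorm w ^+ 2 * ((enorm w)^-1 * (enorm w)^-1 * `|edot w (w *m A)|).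
  by field.
by rewrite [N A * _]mulrC ler_wpM2l// sqr_ge0.
Qed.
End matrix_norm.

Section sup_family.
Variables (R : realType) (S : Type) (q : R -> S -> R) (x0 : S).
Hypothesis qb : forall s, exists M, forall x, q s x <= M.

Lemma sup_family_ub s x : q s x <= sup (range (q s)).
Proof.
apply: sup_ubound; last by exists x.
by have [M hM] := qb s; exists M => _ [y _ <-].
Qed.

Lemma sup_family_le s c : (forall x, q s x <= c) -> sup (range (q s)) <= c.
Proof. by move=> h; apply: ge_sup; [exists (q s x0); exists x0|move=> _ [y _ <-]]. Qed.

(** The modulus of continuity in time is uniform in [x], hence passes to the supremum. *)
Lemma sup_family_continuous :
  (forall s e, 0 < e -> exists2 d, 0 < d & forall s' x, `|s' - s| < d -> `|q s' x - q s x| <= e) ->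
  continuous (fun s => sup (range (q s))).
Proof.
move=> qc s; apply/cvgrPdist_le => e e0; have [d d0 hd] := qc s e e0.
apply/nbhs_ballP; exists d => // s' h; have {}h : `|s - s'| < d := h.
rewrite distrC in h.
rewrite ler_norml; apply/andP; split.
  rewrite -(lerD2r (sup (range (q s')))) subrK; rewrite -lerBrDl opprK addrC.
  apply: sup_family_le => x; have := sup_family_ub s x; have := hd s' x h.
  by rewrite ler_norml; lra.
rewrite lerBlDr; apply: sup_family_le => x; have := sup_family_ub s' x; have := hd s' x h.
by rewrite ler_norml; lra.
Qed.
End sup_family.

(** * The estimates *)

Section clamp.
Variables (R : realType) (t : R).
Hypothesis t0 : 0 <= t.
Implicit Type s : R.

(* Freezing time outside [0, t] makes every field below continuous on the whole line. *)
Definition clamp s := if s <= 0 then 0 else if s <= t then s else t.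

Lemma clamp_itv s : 0 <= clamp s <= t.
Proof. by have := t0; rewrite /clamp; case: (leP s 0) => ?; case: (leP s t) => ?; lra. Qed.

Lemma clamp_id s : 0 <= s <= t -> clamp s = s.
Proof. by have := t0; rewrite /clamp; case: (leP s 0) => ?; case: (leP s t) => ?; lra. Qed.

Lemma clamp_lip s s' : `|clamp s - clamp s'| <= `|s - s'|.
Proof.
wlog ss : s s' / s' <= s.
  by move=> H; have [/H//|/ltW/H] := leP s' s; rewrite distrC [`|s' - s|]distrC.
have := t0; rewrite [`|s - s'|]ger0_norm ?subr_ge0// ler_norml /clamp.
by case: (leP s 0) => ?; case: (leP s t) => ?; case: (leP s' 0) => ?; case: (leP s' t) => ?; lra.
Qed.

(** At interior times freezing changes nothing nearby, so time derivatives are unaffected. *)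
Lemma near_eq_clamp (S : Type) (f : R -> S) s : 0 < s < t -> \near s, f s = f (clamp s).
Proof.
move=> /andP[s0 st]; apply/nbhs_ballP; exists (Num.min s (t - s)); first by rewrite /= lt_min s0 subr_gt0.
move=> s' h; have {}h : `|s - s'| < Num.min s (t - s) := h.
by move: h; rewrite lt_min !ltr_norml => h /=; rewrite clamp_id//; lra.
Qed.
End clamp.

Lemma dist_half_trans (R : realType) (e p q r : R) :
  `|p - q| <= e / 2 -> `|q - r| < e / 2 -> `|p - r| < e.
Proof.
by rewrite ler_norml !ltr_norml => /andP[? ?] /andP[? ?]; apply/andP; split; lra.
Qed.

Section clamped_field.
Variables (R : realType) (m t : R) (T : \bar R) (v : R -> 'rV[R]_3 -> 'rV[R]_3).
Hypothesis m52 : 5 / 2 < m.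
Hypothesis vS : continuous_in_sobolev m T v.
Hypothesis cv : forall t, lifespan T t -> continuous (v t).
Hypothesis t0 : 0 <= t.
Hypothesis tT : (t%:E < T)%E.
Implicit Types (s e : R) (x y : 'rV[R]_3).

Let u s := v (clamp t s).

Lemma clamp_lifespan s : lifespan T (clamp t s).
Proof.
have /andP[c0 ct] := clamp_itv t0 s; split=> //.
by apply: le_lt_trans tT; rewrite lee_fin.
Qed.

Lemma clamped_time_continuous s e : 0 < e -> exists2 d, 0 < d & forall s', `|s' - s| < d ->
  forall x i, `|u s' x 0 i - u s x 0 i| <= e /\ forall j, `|('J (u s') x) j i - ('J (u s) x) j i| <= e.
Proof.
move=> e0; have [d d0 hd] := sobolev_time_continuous m52 vS cv (clamp_lifespan s) e0.
exists d => // s' s'd; apply: hd; first exact: clamp_lifespan.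
exact: le_lt_trans (clamp_lip t0 s' s) s'd.
Qed.

Lemma clamped_field_jcts s x k : jcts (fun s x => u s x 0 k) s x.
Proof.
apply/jctsP => e e0; have e2 : 0 < e / 2 by rewrite divr_gt0.
have [d1 d10 h1] := clamped_time_continuous s e2.
have [d2 d20 h2] := cont_eps x (cv (clamp_lifespan s)) e2.
exists (Num.min d1 d2); first by rewrite lt_min d10.
move=> s' x'; rewrite !lt_min => /andP[sd _] /andP[_ xd].
have [a _] := h1 s' sd x' k.
have b := le_lt_trans (rV_coord_le (u s x' - u s x) k) (h2 x' xd).
rewrite rV_subE in b; exact: dist_half_trans a b.
Qed.

Lemma clamped_jacobian_jcts s x k l : jcts (fun s x => 'J (u s) x k l) s x.
Proof.
apply/jctsP => e e0; have e2 : 0 < e / 2 by rewrite divr_gt0.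
have [d1 d10 h1] := clamped_time_continuous s e2.
have [d2 d20 h2] := sobolev_jacobian_continuous m52 vS cv x (clamp_lifespan s) e2.
exists (Num.min d1 d2); first by rewrite lt_min d10.
move=> s' x'; rewrite !lt_min => /andP[sd _] /andP[_ xd].
have [_ /(_ k) a] := h1 s' sd x' l.
have b := h2 x' xd k l.
exact: dist_half_trans a b.
Qed.

Lemma continuous_bounded_clamp (f : R -> R) : continuous f -> (forall s, f s = f (clamp t s)) ->
  exists M, forall s, f s <= M.
Proof.
move=> cf fc; have [c _ hc] := EVT_max t0 (continuous_subspaceT cf).
by exists (f c) => s; rewrite fc; apply: hc; rewrite in_itv /= clamp_itv.
Qed.

Lemma clamp_idem s : clamp t (clamp t s) = clamp t s.
Proof. by rewrite clamp_id// clamp_itv. Qed.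

Lemma clamped_bounded : exists2 M : R, 0 <= M & forall s x,
  (forall i, `|u s x 0 i| <= M) /\ (forall i j, `|'J (u s) x i j| <= M).
Proof.
pose qv s (z : 'rV[R]_3 * 'I_3) := `|u s z.1 0 z.2|.
pose qJ s (z : 'rV[R]_3 * 'I_3 * 'I_3) := `|'J (u s) z.1.1 z.1.2 z.2|.
have bv s : exists M, forall z, qv s z <= M.
  have [M _ [h _]] := sobolev_bounded m52 vS cv (clamp_lifespan s).
  by exists M => z; exact: h.
have bJ s : exists M, forall z, qJ s z <= M.
  have [M _ [_ h]] := sobolev_bounded m52 vS cv (clamp_lifespan s).
  by exists M => z; exact: h.
have [||Mv hv] := @continuous_bounded_clamp (fun s => sup (range (qv s))).
- apply: (sup_family_continuous (0, 0) bv) => s e e0.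
  have [d d0 hd] := clamped_time_continuous s e0; exists d => // s' [x i] sd.
  by apply: (le_trans (ler_dist_dist _ _)); have [] := hd s' sd x i.
- by move=> s; rewrite /qv /u clamp_idem.
have [||MJ hJ] := @continuous_bounded_clamp (fun s => sup (range (qJ s))).
- apply: (sup_family_continuous (0, 0, 0) bJ) => s e e0.
  have [d d0 hd] := clamped_time_continuous s e0; exists d => // s' [[x i] j] sd.
  by apply: (le_trans (ler_dist_dist _ _)); have [_] := hd s' sd x j.
- by move=> s; rewrite /qJ /u clamp_idem.
exists (Num.max 0 (Num.max Mv MJ)); first by rewrite le_max lexx.
move=> s x; split=> [i|i j]; rewrite !le_max; apply/orP; right; apply/orP.
  by left; apply: le_trans (hv s); exact: (sup_family_ub bv s (x, i)).
by right; apply: le_trans (hJ s); exact: (sup_family_ub bJ s (x, i, j)).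
Qed.

Lemma clamped_frechet s x k e : 0 < e -> exists2 r, 0 < r & forall z, `|z - x| < r ->
  `|u s z 0 k - u s x 0 k - ((z - x) *m 'J (u s) x) 0 k| <= e * `|z - x|.
Proof.
move=> e0; have [r r0 hr] := sobolev_uniform_diff m52 vS cv (clamp_lifespan s) e0.
exists r => // z zr; have := hr x (z - x) zr; have -> : x + (z - x) = z by rewrite addrC subrK.
have := rV_coord_le (u s z - u s x - (z - x) *m 'J (u s) x) k.
by rewrite !rV_subE; exact: le_trans.
Qed.

Lemma clamped_derive s x d k : is_derive x d (fun z => u s z 0 k) ((d *m 'J (u s) x) 0 k).
Proof.
apply: (@frechet_derive R (fun z => u s z 0 k) x (fun y => (y *m 'J (u s) x) 0 k) d).
  by move=> c y; rewrite -scalemxAl mxE.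
move=> e e0; have [r r0 hr] := clamped_frechet s x k e0; exists r => // y yr.
have E : x + y - x = y by rewrite addrC addKr.
by have := hr (x + y); rewrite E; apply.
Qed.

Lemma clamped_lipschitz M s x y k : 0 <= M -> (forall x i j, `|'J (u s) x i j| <= M) ->
  `|u s x 0 k - u s y 0 k| <= 3 * M * `|x - y|.
Proof.
move=> M0 hM.
have h (r : R) : `|r - 0| < 2 -> is_derive r (1 : R) (fun r => u s (y + r *: (x - y)) 0 k)
    (((x - y) *m 'J (u s) (y + r *: (x - y))) 0 k).
  by move=> _; apply: (@is_derive_line R (fun z => u s z 0 k)); exact: clamped_derive.
have [|r _] := MVT_local h (y := 1); first by rewrite subr0 normr1 ltr1n.
have E : y + (x - y) = x by rewrite addrC subrK.
rewrite scale1r scale0r addr0 subr0 mulr1 E => ->.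
by apply: (le_trans (rV_coord_le _ _)); apply: mulmx_norm_le.
Qed.

Lemma clamped_joint s x e : 0 < e -> exists2 d, 0 < d & forall s' x', `|s' - s| < d ->
  `|x' - x| < d -> forall i, `|u s' x' 0 i - u s x 0 i| < e.
Proof.
move=> e0; have [|k|d d0 hd] := @ord3_radius R (fun k d => forall s' x', `|s' - s| < d ->
  `|x' - x| < d -> `|u s' x' 0 k - u s x 0 k| < e).
- by move=> k d d' h dd s' x' sd xd; apply: h; exact: lt_le_trans dd.
- have [d d0 hd] := (jctsP _ _ _).1 (@clamped_field_jcts s x k) e e0.
  by exists d.
by exists d => // s' x' sd xd i; exact: hd.
Qed.

Lemma forward_trajectory x : exists B, exists2 X : R -> 'rV[R]_3, X 0 = x &
  lipschitz_path B X /\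
  forall s k, 0 < s < t -> is_derive s (1 : R) (fun r => X r 0 k) (u s (X s) 0 k).
Proof.
have [M M0 hM] := clamped_bounded.
have L1 : 1 <= 3 * M + 1 by lra.
have [|||X [X0 XL dX]] := @picard_solution R u M (3 * M + 1) L1 _ _ _ x.
- by move=> s y i; exact: (hM s y).1.
- move=> s y z i; apply: (@le_trans _ _ (3 * M * `|y - z|)).
    by apply: clamped_lipschitz => // w; exact: (hM s w).2.
  by rewrite ler_wpM2r//; lra.
- exact: clamped_joint.
by exists M; exists X => //; split=> // s k /andP[s0 _]; exact: dX.
Qed.

(** Picard's solution is prescribed at time 0 and solves the equation at positive times. A path with
    a prescribed end is obtained by solving for the reversed field [- u (t - s)] and reading the
    solution backward. *)
Lemma backward_trajectory x : exists B, exists2 X : R -> 'rV[R]_3, X t = x &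
  lipschitz_path B X /\
  forall s k, 0 < s < t -> is_derive s (1 : R) (fun r => X r 0 k) (u s (X s) 0 k).
Proof.
have [M M0 hM] := clamped_bounded.
have L1 : 1 <= 3 * M + 1 by lra.
have [|||Y [Y0 YL dY]] := @picard_solution R (fun s x => - u (t - s) x) M (3 * M + 1) L1 _ _ _ x.
- by move=> s y i; rewrite rV_oppE normrN; exact: (hM _ y).1.
- move=> s y z i; rewrite !rV_oppE -opprD normrN.
  apply: (@le_trans _ _ (3 * M * `|y - z|)).
    by apply: clamped_lipschitz => // w; exact: (hM _ w).2.
  by rewrite ler_wpM2r//; lra.
- move=> s y e e0; have [d d0 hd] := clamped_joint (t - s) y e0.
  exists d => // s' y' sd yd i; rewrite !rV_oppE -opprD normrN; apply: hd => //.
  by rewrite (_ : _ - _ = s - s') ?[`|s - s'|]distrC//; ring.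
exists M; exists (fun s => Y (t - s)); first by rewrite subrr.
split=> [s s'|s k /andP[s0 st]].
  by apply: (le_trans (YL _ _)); rewrite (_ : _ - _ = s' - s) ?[`|s' - s|]distrC//; ring.
have ts : 0 < t - s by rewrite subr_gt0.
have h : is_derive s (1 : R) (fun r => t - r) (0 - 1).
  exact: (@is_derive_sub R (cst t) id s 0 1 (is_derive_cst t s (1 : R)) (is_derive_id s (1 : R))).
have := @is_derive1_comp R (fun r => Y r 0 k) (fun r => t - r) s _ _ (dY _ k ts) h.
by rewrite sub0r mulrN1 rV_oppE opprK subKr.
Qed.

End clamped_field.

(* For a trace-free matrix the antisymmetric part of [A ^ 2] is the vortex stretching term. *)
Lemma curl_mx_square (R : realType) (A : 'M[R]_3) i : \tr A = 0 ->
  - ((A *m A) (i + 1) (i + 2) - (A *m A) (i + 2) (i + 1)) = (curl_mx A *m A) 0 i.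
Proof.
rewrite /mxtrace !big_ord_recl big_ord0 addr0.
have E1 : lift ord0 ord0 = 1 :> 'I_3 by exact: val_inj.
have E2 : lift ord0 (lift ord0 ord0) = 2 :> 'I_3 by exact: val_inj.
(* The trace condition eliminates [A 0 0]; each component is then a polynomial identity. *)
rewrite E1 E2 => h; have {}h : A 0 0 = - A 1 1 - A 2 2 by rewrite -[LHS]subr0 -h; ring.
rewrite mulmx3E /curl_mx !mxE !big_ord_recl !big_ord0 !addr0 E1 E2.
have e00 : 0 + 1 = 1 :> 'I_3 by exact: val_inj.
have e01 : 0 + 2 = 2 :> 'I_3 by exact: val_inj.
have e10 : 1 + 1 = 2 :> 'I_3 by exact: val_inj.
have e11 : 1 + 2 = 0 :> 'I_3 by exact: val_inj.
have e20 : 2 + 1 = 0 :> 'I_3 by exact: val_inj.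
have e21 : 2 + 2 = 1 :> 'I_3 by exact: val_inj.
have e0 : ord0 = 0 :> 'I_3 by exact: val_inj.
move: i; apply: ord3P; rewrite ?(e0, e00, e01, e10, e11, e20, e21) h; ring.
Qed.

(** * The vorticity equation along particle paths *)

Section vorticity_along_trajectories.
Variables (R : realType) (m t : R) (T : \bar R) (v : R -> 'rV[R]_3 -> 'rV[R]_3).
Variables (p : R -> 'rV[R]_3 -> R) (X : R -> 'rV[R]_3) (B : R).
Hypothesis m52 : 5 / 2 < m.
Hypothesis vS : continuous_in_sobolev m T v.
Hypothesis cv : forall t, lifespan T t -> continuous (v t).
Hypothesis t0 : 0 <= t.
Hypothesis tT : (t%:E < T)%E.
Hypothesis euler : forall t x, 0 < t -> (t%:E < T)%E ->
  [/\ derivable (v ^~ x) t 1, differentiable (v t) x, differentiable (p t) x,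
      {for (t, x), continuous (fun z : R * 'rV[R]_3 => grad (p z.1) z.2)}
    & 'D_1 (v ^~ x) t + v t x *m 'J (v t) x = - grad (p t) x /\ div (v t) x = 0].
Let u s := v (clamp t s).
Let A s x := 'J (u s) x.
Hypothesis XL : lipschitz_path B X.
Hypothesis dX : forall s k, 0 < s < t ->
  is_derive s (1 : R) (fun r => X r 0 k) (u s (X s) 0 k).

Lemma before_T s : s < t -> (s%:E < T)%E.
Proof. by move=> st; apply: lt_trans tT; rewrite lte_fin. Qed.

Lemma clamped_euler s x k : 0 < s < t ->
  is_derive s (1 : R) (fun s => u s x 0 k) (- grad (p s) x 0 k - (u s x *m A s x) 0 k).
Proof.
move=> /andP[s0 st]; have [dv _ _ _ [E _]] := euler x s0 (before_T st).
apply: (@near_eq_is_derive _ _ _ (fun s => v s x 0 k)).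
  by apply: (@near_eq_clamp _ _ t0 _ (fun s => v s x 0 k)); rewrite s0.
have us : u s = v s by rewrite /u clamp_id// !ltW.
have -> : - grad (p s) x 0 k - (u s x *m A s x) 0 k = ('D_1 (v ^~ x) s) 0 k.
  rewrite /A us; have := congr1 (fun w : 'rV[R]_3 => w 0 k) E => /=.
  rewrite [in LHS]mxE rV_oppE => <-; ring.
have := dv; rewrite derivable_mxP => dk.
by rewrite derive_mx// mxE; apply: DeriveDef => //; exact: dk.
Qed.

Lemma pressure_jcts s x k : 0 < s < t -> jcts (fun s x => grad (p s) x 0 k) s x.
Proof.
move=> /andP[s0 st]; have [_ _ _ c _] := euler x s0 (before_T st).
exact: (@continuous_comp _ _ _ (fun z : R * 'rV[R]_3 => grad (p z.1) z.2)
  (fun w : 'rV[R]_3 => w 0 k) (s, x) c (@coord_continuous R 1 3 0 k _)).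
Qed.

Lemma vorticity_equation s i : 0 < s < t ->
  is_derive s (1 : R) (fun s => curl (u s) (X s) 0 i) ((curl (u s) (X s) *m A s (X s)) 0 i).
Proof.
move=> /andP[s0 st].
(* Within [r] of [s] all times are interior to $[0,t]$, where freezing is invisible and the Euler
   equations hold. *)
pose r := Num.min s (t - s); have r0 : 0 < r by rewrite lt_min s0 subr_gt0.
have inr s' : `|s' - s| < r -> 0 < s' < t.
  by rewrite lt_min !ltr_norml => /andP[/andP[? ?] /andP[? ?]]; lra.
have B0 : 0 <= B.
  have := XL 1 0; rewrite subr0 normr1 mulr1; apply: le_trans; exact: normr_ge0.
have trA : \tr (A s (X s)) = 0.
  have [_ _ _ _ [_]] := euler (X s) s0 (before_T st).
  by rewrite /A /u clamp_id// !ltW.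
have -> : (fun s => curl (u s) (X s) 0 i) =
    (fun s => A s (X s) (i + 1) (i + 2) - A s (X s) (i + 2) (i + 1)).
  by apply/funext => s'; rewrite /curl [LHS]mxE.
rewrite -[curl (u s) (X s)]/(curl_mx (A s (X s))) -curl_mx_square//.
apply: (@vorticity_derive R u (fun s => grad (p s)) A X s r B r0 B0 _ _ _ _ _ _ _ XL
  (i + 1) (i + 2)).
- by move=> *; exact: (clamped_derive m52 vS cv t0 tT).
- by move=> s' x k _ e e0; exact: (clamped_frechet m52 vS cv t0 tT).
- by move=> s' x k _; exact: (clamped_field_jcts m52 vS cv t0 tT).
- by move=> s' x k l _; exact: (clamped_jacobian_jcts m52 vS cv t0 tT).
- by move=> s' x k /inr; exact: pressure_jcts.
- by move=> s' x k /inr; exact: clamped_euler.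
- by move=> s' k /inr; exact: dX.
- move=> s' h /inr/andP[s'0 s't] h0; apply: circ_grad; first by rewrite gt_eqF.
    by move=> x; have [] := euler x s'0 (before_T s't).
  apply: (@cont_field R (fun s => grad (p s))) => x k; apply: pressure_jcts.
  by rewrite s'0.
Qed.

End vorticity_along_trajectories.

(** * From single paths to suprema *)

Section monotone_transfer.
Variable R : realType.
Implicit Types b I E y w : R.

(** The bound $y_0E/(1+by_0I)$ increases with the initial value $y_0$, which may thus be replaced by
    the supremum $w$; the inequality is written without division. *)
Lemma upper_transfer b I E y y0 w : 0 <= I -> 0 < E -> 0 <= y -> 0 <= y0 -> y0 <= w ->
  y * (1 + b * y0 * I) <= y0 * E -> y * (1 + b * w * I) <= w * E.
Proof.
move=> I0 E0 yp y0p y0w h; have w0 := le_trans y0p y0w.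
have [y00|y00] := eqVneq y0 0.
  have -> : y = 0.
    by apply/eqP; rewrite eq_le yp andbT; move: h; rewrite y00 mulr0 !mul0r addr0 mulr1.
  by rewrite mul0r mulr_ge0// ltW.
have {}y0p : 0 < y0 by rewrite lt_neqAle eq_sym y00.
rewrite -(ler_pM2l y0p).
have -> : y0 * (y * (1 + b * w * I)) = y * y0 + w * (b * y * y0 * I) by ring.
have := ler_wpM2l w0 h; have := ler_wpM2l yp y0w; lra.
Qed.

(** The hypothesis forces $1-by_0J\ge 0$, so $y$ may be enlarged to $w$. Collecting $y_0$ on one
    side leaves a coefficient free of $y_0$, which is the form needed for a supremum over initial
    values. *)
Lemma lower_transfer b (J : R) E y y0 w : 0 < E -> 0 <= y -> 0 <= y0 -> y <= w ->
  y0 * E <= y * (1 - b * y0 * J) -> y0 * (E + b * J * w) <= w.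
Proof.
move=> E0 yp y0p yw h.
have D : 0 <= 1 - b * y0 * J.
  have [y00|y00] := eqVneq y 0.
    have -> : y0 = 0; last by rewrite mulr0 mul0r subr0.
    by apply/eqP; rewrite eq_le y0p andbT -(pmulr_lle0 _ E0); move: h; rewrite y00 mul0r.
  have {}yp : 0 < y by rewrite lt_neqAle eq_sym y00.
  by rewrite -(pmulr_rge0 _ yp); apply: le_trans h; rewrite mulr_ge0// ltW.
have := ler_wpM2r D yw; lra.
Qed.
Lemma lower_rearrange b (J : R) E y w : y * (E + b * J * w) <= w -> y * E <= w * (1 - b * y * J).
Proof. by lra. Qed.
End monotone_transfer.

Section trajectory_estimates.
Variables (R : realType) (N : 'M[R]_3 -> R) (m t : R) (T : \bar R).
Variables (v : R -> 'rV[R]_3 -> 'rV[R]_3) (p : R -> 'rV[R]_3 -> R).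
Hypothesis aN : admissible_norm N.
Hypothesis m52 : 5 / 2 < m.
Hypothesis vS : continuous_in_sobolev m T v.
Hypothesis cv : forall t, lifespan T t -> continuous (v t).
Hypothesis t0 : 0 <= t.
Hypothesis tT : (t%:E < T)%E.
Hypothesis euler : forall t x, 0 < t -> (t%:E < T)%E ->
  [/\ derivable (v ^~ x) t 1, differentiable (v t) x, differentiable (p t) x,
      {for (t, x), continuous (fun z : R * 'rV[R]_3 => grad (p z.1) z.2)}
    & 'D_1 (v ^~ x) t + v t x *m 'J (v t) x = - grad (p t) x /\ div (v t) x = 0].
Implicit Types (s b : R) (x : 'rV[R]_3).
Let u s := v (clamp t s).

Definition clamped_sup s := grad_sup N (v (clamp t s)).
Notation g := clamped_sup.
Let q s x := N ('J (u s) x).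

Lemma gradient_bounded s : exists M, forall x, q s x <= M.
Proof.
have [C C0 hC] := norm_entries aN; have [M M0 hM] := clamped_bounded m52 vS cv t0 tT.
by exists (C * M) => x; apply: hC; exact: (hM s x).2.
Qed.

Lemma clamped_sup_ub s x : q s x <= g s.
Proof. exact: (sup_family_ub gradient_bounded s x). Qed.

Lemma clamped_sup_continuous : continuous g.
Proof.
apply: (sup_family_continuous (0 : 'rV[R]_3) gradient_bounded) => s e e0.
have [C C0 hC] := norm_entries aN.
have C1 : 0 < C + 1 by lra.
have [d d0 hd] := clamped_time_continuous m52 vS cv t0 tT s (divr_gt0 e0 C1).
exists d => // s' x sd; apply: (le_trans (norm_dist aN _ _)).
apply: (le_trans (hC _ (e / (C + 1)) _)); last first.
  by rewrite mulrA ler_pdivrMr// mulrC ler_wpM2l ?(ltW e0)//; lra.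
by move=> i j; rewrite [X in `|X|]mxE mx_oppE; have [_] := hd s' sd x j; exact.
Qed.

Lemma clamped_curl_ub s x : enorm (curl (u s) x) <= g s.
Proof. by apply: le_trans (clamped_sup_ub s x); exact: admissible_curl. Qed.

Section along.
Variables (X : R -> 'rV[R]_3) (B : R).
Hypothesis XL : lipschitz_path B X.
Hypothesis dX : forall s k, 0 < s < t ->
  is_derive s (1 : R) (fun r => X r 0 k) (u s (X s) 0 k).
Let W s := curl (u s) (X s).

Lemma path_comp_continuous (f : R -> 'rV[R]_3 -> R) s : jcts f s (X s) ->
  {for s, continuous (fun s => f s (X s))}.
Proof.
move=> /jctsP jf; apply/cvgrPdist_lt => e e0; have [d d0 hd] := jf e e0.
have B1 : 0 < `|B| + 1 by rewrite ltr_wpDl.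
apply/nbhs_ballP; exists (Num.min d (d / (`|B| + 1))); first by rewrite /= lt_min d0 divr_gt0.
move=> s' h; have {}h : `|s - s'| < Num.min d (d / (`|B| + 1)) := h.
move: h; rewrite lt_min ltr_pdivlMr// => /andP[h1 h2].
rewrite distrC; apply: hd; first by rewrite distrC.
apply: (le_lt_trans (XL s' s)); apply: le_lt_trans h2.
rewrite [`|s' - s|]distrC mulrC ler_wpM2l//; have := ler_norm B; lra.
Qed.

Lemma vorticity_continuous i : continuous (fun s => W s 0 i).
Proof.
move=> s; rewrite (_ : (fun s => W s 0 i) =
  (fun s => 'J (u s) (X s) (i + 1) (i + 2) - 'J (u s) (X s) (i + 2) (i + 1))); last first.
  by apply/funext => s'; rewrite /W /curl [LHS]mxE.
apply: cont_sub.
  apply: (@path_comp_continuous (fun s x => 'J (u s) x (i + 1) (i + 2))).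
  exact: (clamped_jacobian_jcts m52 vS cv t0 tT).
apply: (@path_comp_continuous (fun s x => 'J (u s) x (i + 2) (i + 1))).
exact: (clamped_jacobian_jcts m52 vS cv t0 tT).
Qed.

Let z s := edot (W s) (W s).
Let dz s := edot (W s) (W s *m 'J (u s) (X s)).

Lemma enstrophy_derive s : 0 < s < t -> is_derive s (1 : R) z (2 * dz s).
Proof.
move=> st; pose D i := (W s *m 'J (u s) (X s)) 0 i.
have d i : is_derive s (1 : R) (fun s => W s 0 i) (D i).
  exact: (vorticity_equation m52 vS cv t0 tT euler XL dX).
have d2 i : is_derive s (1 : R) (fun s => W s 0 i * W s 0 i) (W s 0 i * D i + W s 0 i * D i).
  exact: (is_derive_mul (d i) (d i)).
have -> : z = (fun s => W s 0 0 * W s 0 0 + W s 0 1 * W s 0 1 + W s 0 2 * W s 0 2).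
  by apply/funext => s'; rewrite /z edotE.
have -> : 2 * dz s = W s 0 0 * D 0 + W s 0 0 * D 0 + (W s 0 1 * D 1 + W s 0 1 * D 1) +
    (W s 0 2 * D 2 + W s 0 2 * D 2).
  by rewrite /dz edotE -/(D 0) -/(D 1) -/(D 2); ring.
exact: (is_derive_add (is_derive_add (d2 0) (d2 1)) (d2 2)).
Qed.

Lemma enstrophy_continuous : continuous z.
Proof.
move=> s; rewrite (_ : z = (fun s => W s 0 0 * W s 0 0 + W s 0 1 * W s 0 1 + W s 0 2 * W s 0 2)).
  have c i : {for s, continuous (fun s => W s 0 i * W s 0 i)}.
    by apply: cont_mul; exact: (@vorticity_continuous i).
  exact: (cont_add (cont_add (c 0) (c 1)) (c 2)).
by apply/funext => s'; rewrite /z edotE.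
Qed.

Lemma stretching_le s : `|dz s| <= g s * z s.
Proof.
apply: (le_trans (norm_strain aN _ _)); rewrite ler_wpM2r ?edot_ge0//.
exact: clamped_sup_ub.
Qed.

Lemma trajectory_upper b : 0 <= b ->
  enorm (W t) * (1 + b * enorm (W 0) * prim (weight g (b + 1)) t) <= enorm (W 0) * weight g (b + 1) t.
Proof.
move=> b0; apply: (@bernoulli_upper R g z dz t clamped_sup_continuous t0 enstrophy_continuous) => //.
- by move=> s; exact: edot_ge0.
- exact: enstrophy_derive.
- by move=> s _; exact: stretching_le.
- by move=> s _; exact: clamped_curl_ub.
Qed.

Lemma trajectory_lower b : 0 <= b ->
  enorm (W 0) * weight g (- (b + 1)) t <=
  enorm (W t) * (1 - b * enorm (W 0) * prim (weight g (- (b + 1))) t).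
Proof.
move=> b0; apply: (@bernoulli_lower R g z dz t clamped_sup_continuous t0 enstrophy_continuous) => //.
- by move=> s; exact: edot_ge0.
- exact: enstrophy_derive.
- by move=> s _; exact: stretching_le.
- by move=> s _; exact: clamped_curl_ub.
Qed.

End along.

Let w s := vec_sup (curl (u s)).

Lemma vorticity_sup_ub s x : enorm (curl (u s) x) <= w s.
Proof.
apply: (@sup_family_ub R _ (fun s x => enorm (curl (u s) x))) => s'.
by exists (g s') => y; exact: clamped_curl_ub.
Qed.

Lemma vorticity_sup_le s c : (forall x, enorm (curl (u s) x) <= c) -> w s <= c.
Proof. exact: (@sup_family_le R _ (fun s x => enorm (curl (u s) x)) 0). Qed.

Lemma vorticity_sup_ge0 s : 0 <= w s.
Proof. exact: le_trans (enorm_ge0 _) (vorticity_sup_ub s 0). Qed.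

Lemma vorticity_sup_le_gradient s : w s <= g s.
Proof. by apply: vorticity_sup_le => x; exact: clamped_curl_ub. Qed.

Lemma prim_weight_ge0 c s : 0 <= prim (weight g c) s.
Proof. by apply: Rintegral_ge0 => x _; rewrite ltW// weight_gt0. Qed.

(** Every point at time [t] is the end of a path, and the initial vorticity on that path is at most
    [w 0]. *)
Lemma sup_upper b : 0 <= b ->
  w t * (1 + b * w 0 * prim (weight g (b + 1)) t) <= w 0 * weight g (b + 1) t.
Proof.
move=> b0; have I0 := prim_weight_ge0 (b + 1) t; have E0 := weight_gt0 g (b + 1) t.
have w0 := vorticity_sup_ge0 0.
have D0 : 0 < 1 + b * w 0 * prim (weight g (b + 1)) t.
  by rewrite ltr_pwDl// !mulr_ge0.
rewrite -ler_pdivlMr//; apply: vorticity_sup_le => x; rewrite ler_pdivlMr//.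
have [B [X Xt [XL dX]]] := backward_trajectory m52 vS cv t0 tT x.
have h := trajectory_upper XL dX b0; rewrite Xt in h.
exact: upper_transfer I0 E0 (enorm_ge0 _) (enorm_ge0 _) (vorticity_sup_ub 0 (X 0)) h.
Qed.

(** Every point at time 0 is the start of a path, and the final vorticity on that path is at most
    [w t]. *)
Lemma sup_lower b : 0 <= b ->
  w 0 * weight g (- (b + 1)) t <= w t * (1 - b * w 0 * prim (weight g (- (b + 1))) t).
Proof.
move=> b0; have J0 := prim_weight_ge0 (- (b + 1)) t; have E0 := weight_gt0 g (- (b + 1)) t.
have wt := vorticity_sup_ge0 t.
set J := prim _ t in J0 *; set E := weight g _ t in E0 *.
have D0 : 0 < E + b * J * w t by rewrite ltr_pwDl// !mulr_ge0.
suff h : w 0 <= w t / (E + b * J * w t).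
  by apply: lower_rearrange; rewrite -ler_pdivlMr.
apply: vorticity_sup_le => x; rewrite ler_pdivlMr//.
have [B [X X0 [XL dX]]] := forward_trajectory m52 vS cv t0 tT x.
have h := trajectory_lower XL dX b0; rewrite X0 in h.
exact: lower_transfer E0 (enorm_ge0 _) (enorm_ge0 _) (vorticity_sup_ub t (X t)) h.
Qed.
End trajectory_estimates.

Lemma prim_clamped (R : realType) (N : 'M[R]_3 -> R) (t s : R) (v : R -> 'rV[R]_3 -> 'rV[R]_3) :
  0 <= t -> s <= t ->
  prim (clamped_sup N t v) s = \int[lebesgue_measure]_(r in `[0, s]) grad_sup N (v r).
Proof.
move=> t0 st; apply: eq_Rintegral => r; rewrite inE /= in_itv /= => /andP[r0 rs].
by rewrite /clamped_sup clamp_id// r0 (le_trans rs).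
Qed.

Lemma prim_weight_clamped (R : realType) (N : 'M[R]_3 -> R) (t c : R) (v : R -> 'rV[R]_3 -> 'rV[R]_3) :
  0 <= t ->
  prim (weight (clamped_sup N t v) c) t = \int[lebesgue_measure]_(s in `[0, t])
    expR (c * \int[lebesgue_measure]_(r in `[0, s]) grad_sup N (v r)).
Proof.
move=> t0; apply: eq_Rintegral => s; rewrite inE /= in_itv /= => /andP[s0 st].
by rewrite /weight prim_clamped.
Qed.

Lemma lower_base (R : realType) (J E y w : R) : y * E <= w * (1 - 0 * y * J) -> y * E <= w.
Proof. by rewrite !mul0r subr0 mulr1. Qed.

(** The lower denominator is positive because it is at least [D], so both product inequalities can
    be divided. *)
Lemma fractional_estimates (R : realType) (b D I J EI EJ w0 w : R) :
  0 <= b -> 0 <= w0 -> 0 <= I -> 0 < D ->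
  w0 * EJ <= w * (1 - b * w0 * J) -> w * (1 + b * w0 * I) <= w0 * EI -> D <= 1 - b * w0 * J ->
  [/\ w <= w0 * EI / (1 + b * w0 * I), w >= w0 * EJ / (1 - b * w0 * J) & 1 - b * w0 * J >= D].
Proof.
move=> b0 w00 I0 D0 hl hu hd; split=> //.
- by rewrite ler_pdivlMr// ltr_pwDl// !mulr_ge0.
- by rewrite ler_pdivrMr//; exact: lt_le_trans hd.
Qed.

Theorem theorem2p1 (R : realType) (N : 'M[R]_3 -> R) (m : R) (T : \bar R)
    (v0 : 'rV[R]_3 -> 'rV[R]_3) (v : R -> 'rV[R]_3 -> 'rV[R]_3) :
  admissible_norm N ->
  5 / 2 < m ->
  continuous v0 -> in_sobolev3 m v0 -> (forall x, div v0 x = 0) ->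
  (0 < T)%E ->
  euler_solution m T v0 v ->
  let w0 := vec_sup (curl v0) in
  let w t := vec_sup (curl (v t)) in
  let G t := \int[lebesgue_measure]_(s in `[0, t]) grad_sup N (v s) in
  forall gamma t : R, 1 <= gamma -> 0 <= t -> (t%:E < T)%E ->
  let I := \int[lebesgue_measure]_(s in `[0, t]) expR (gamma * G s) in
  let J := \int[lebesgue_measure]_(s in `[0, t]) expR (- gamma * G s) in
  [/\ w t <= w0 * expR (gamma * G t) / (1 + (gamma - 1) * w0 * I),
      w t >= w0 * expR (- gamma * G t) / (1 - (gamma - 1) * w0 * J)
    & 1 - (gamma - 1) * w0 * J >= 1 / (1 + w0 * t) `^ (gamma - 1)].
Proof.
move=> aN m52 _ _ _ _ [vS cv v00 [p euler]] w0 w G gamma t gamma1 t0 tT I J.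
have b0 : 0 <= gamma - 1 by rewrite subr_ge0.
have c0 (s : R) : 0 <= s -> clamp s 0 = 0 by move=> s0; rewrite clamp_id// lexx.
have ct (s : R) : 0 <= s -> clamp s s = s by move=> s0; rewrite clamp_id// s0 lexx.
have w00 : 0 <= w0.
  by have := vorticity_sup_ge0 aN m52 vS cv t0 tT 0; rewrite (c0 t t0) v00.
(* The case $\gamma=1$, that is $b=0$, at every intermediate time; time is frozen at [s] here
   instead of [t]. *)
have lower s : 0 <= s -> (s%:E < T)%E -> w0 * expR (- G s) <= w s.
  move=> s0 sT; have h := sup_lower aN m52 vS cv s0 sT euler (lexx 0).
  rewrite (c0 s s0) (ct s s0) v00 in h.
  have <- : weight (clamped_sup N s v) (- (0 + 1)) s = expR (- G s).
    by rewrite /weight (prim_clamped N v s0 (lexx s)) add0r mulN1r.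
  exact: lower_base h.
(* Together with $|\omega|_\infty\le g$ the case $\gamma=1$ becomes the hypothesis under which the
   denominator is bounded below. *)
have growth s : 0 < s < t -> w0 <= clamped_sup N t v s * weight (clamped_sup N t v) 1 s.
  move=> /andP[s0 st].
  have sT : (s%:E < T)%E by apply: lt_trans tT; rewrite lte_fin.
  have h := vorticity_sup_le_gradient aN m52 vS cv t0 tT s.
  have e : clamp t s = s by rewrite clamp_id// !ltW.
  rewrite e in h.
  have := le_trans (lower s (ltW s0) sT) h.
  rewrite expRN ler_pdivrMr ?expR_gt0// /weight (prim_clamped N v t0 (ltW st)).
  by rewrite mul1r.
have gc := clamped_sup_continuous aN m52 vS cv t0 tT.
have := denominator_lower gc w00 t0 growth b0.
have := sup_upper aN m52 vS cv t0 tT euler b0.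
have := sup_lower aN m52 vS cv t0 tT euler b0.
rewrite (c0 t t0) (ct t t0) v00 !(prim_weight_clamped N _ v t0) /weight (prim_clamped N v t0 (lexx t)) (subrK 1 gamma).
have I0 : 0 <= I by apply: Rintegral_ge0 => s _; exact: expR_ge0.
apply: fractional_estimates => //.
by rewrite divr_gt0// powR_gt0// ltr_pwDl// mulr_ge0.
Qed.
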